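(* Let $M=\mathbb N$ or $M=\mathbb Z$. Given two sofically presented $M$-systems $X,Y$ (given by presentations), the following properties are recursively inseparable: (i) $X$ and $Y$ are conjugate; (ii) $X$ and $Y$ are not homeomorphic (as topological spaces).
   Context: A dynamical $M$-system is an action of $M$ by continuous maps on a compact metrizable space. Two systems are conjugate if there is an equivariant homeomorphism between them. A subshift over $M$ is a closed shift-invariant subset of $\Sigma^M$, $\Sigma$ a finite alphabet; it is an SFT if it is defined by finitely many forbidden words, and sofic if it is the image of an SFT under a continuous shift-commuting map. $(\Sigma^2)^M$ is identified with $\Sigma^M\times\Sigma^M$. A sofically presented system is one conjugate to $Y/Z$ for some sofic shifts $Y\subset\Sigma^M$, $Z\subset(\Sigma^2)^M$ such that $Z\cap Y^2$ is an equivalence relation on $Y$, where $Y/Z$ is the topological quotient $Y/(Z\cap Y^2)$ with the induced shift action. It is given to an algorithm by a pair of finite-state automata for (the languages of) $Y$ and $Z$. Disjoint sets $A,B$ of (encoded) inputs are recursively inseparable if there is no recursive set $C$ with $A\subset C$ and $C\cap B=\emptyset$. Here $A$ and $B$ are the sets of pairs of presentations satisfying (i) and (ii), respectively. *)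

(* Defs.v *)
From HB Require Import structures.
From mathcomp Require Import all_boot all_order all_algebra.
From mathcomp Require Import all_classical topology.

Set Implicit Arguments.
Unset Strict Implicit.
Unset Printing Implicit Defensive.

Import GRing.Theory.
Local Open Scope classical_set_scope.
Local Open Scope ring_scope.

(* Compactness and metrizability of the space are not fields: every system
   considered below is conjugate to a quotient of a subshift by a closed
   equivalence relation, for which both hold automatically. *)
Record msystem (M : nmodType) := MSystem {
  msys_space :> topologicalType;
  msys_act : M -> msys_space -> msys_space;
  msys_act_id : forall x, msys_act 0 x = x;
  msys_act_add : forall m n x, msys_act (m + n) x = msys_act m (msys_act n x);
  msys_act_continuous : forall m, continuous (msys_act m) }.

Definition homeomorphic (X Y : topologicalType) : Prop :=
  exists (f : X -> Y) (g : Y -> X),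
    [/\ cancel f g, cancel g f, continuous f & continuous g].

Definition conjugate (M : nmodType) (X Y : msystem M) : Prop :=
  exists (f : X -> Y) (g : Y -> X),
    [/\ cancel f g, cancel g f, continuous f, continuous g &
        forall m x, f (msys_act m x) = msys_act m (f x)].

Section QuotientSystem.
Context (M : nmodType) (X : msystem M) (E : equiv_rel X).
Hypothesis E_act : forall m x y, E x y -> E (msys_act m x) (msys_act m y).
Local Open Scope quotient_scope.

Let Q : Type := quotient_topology {eq_quot E}.

Definition quotient_act (m : M) (q : Q) : Q := \pi_Q (msys_act m (repr q)).

Lemma quotient_act_pi m x : quotient_act m (\pi_Q x) = \pi_Q (msys_act m x).
Proof.
apply/eqmodP; apply: E_act; apply/eqmodP; exact: reprK.
Qed.

Lemma quotient_act_id q : quotient_act 0 q = q.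
Proof. by rewrite /quotient_act msys_act_id reprK. Qed.

Lemma quotient_act_add m n q :
  quotient_act (m + n) q = quotient_act m (quotient_act n q).
Proof. by rewrite [quotient_act n q]/quotient_act quotient_act_pi -msys_act_add. Qed.

Lemma quotient_act_continuous m : continuous (quotient_act m).
Proof.
apply/quotient_continuous.
have -> : quotient_act m \o \pi_Q = \pi_Q \o msys_act m :> (X -> Q).
  by apply/funext => x; exact: quotient_act_pi.
move=> x; apply: continuous_comp; first exact: msys_act_continuous.
exact: pi_continuous.
Qed.

Definition quotient_system : msystem M :=
  MSystem quotient_act_id quotient_act_add quotient_act_continuous.

End QuotientSystem.

Notation config M A := (prod_topology (fun _ : M => discrete_topology A)).

Definition shift_by (M : nmodType) (A : finType) (m : M) (x : config M A) :
  config M A := fun i => x (i + m).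

Definition subshift (M : nmodType) (A : finType) (X : set (config M A)) : Prop :=
  closed X /\ (forall m x, X x -> X (shift_by m x)).

Definition word_at (M : pzSemiRingType) (A : finType) (x : config M A)
  (i : M) (n : nat) : seq A := mkseq (fun j => x (i + j%:R)) n.

Definition language (M : pzSemiRingType) (A : finType) (X : set (config M A)) :
  set (seq A) :=
  [set w | exists x i, X x /\ word_at x i (size w) = w].

Definition sft (M : pzSemiRingType) (A : finType) (X : set (config M A)) : Prop :=
  exists F : seq (seq A),
    X = [set x | forall i w, w \in F -> word_at x i (size w) <> w].

Definition sofic (M : pzSemiRingType) (A : finType) (Y : set (config M A)) : Prop :=
  subshift Y /\
  exists (B : finType) (X : set (config M B)) (f : X -> config M A),
    [/\ sft X, continuous f,
        forall m (x y : X), val y = shift_by m (val x) -> f y = shift_by m (f x) &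
        range f = Y].

Lemma shift_by_continuous (M : nmodType) (A : finType) (m : M) :
  continuous (@shift_by M A m).
Proof.
move=> x.
have xF : Filter (nbhs x) by exact: nbhs_filter.
have FF := @fmap_filter _ _ (shift_by m) _ xF.
apply/cvg_sup => i.
apply: (@continuous_comp_initial _ _ _ (fun f : config M A => f i) (shift_by m)).
exact: (@proj_continuous M (fun _ => discrete_topology A)).
Qed.

Section SubshiftSystem.
Context (M : nmodType) (A : finType) (X : set (config M A)).
Hypothesis X_subshift : subshift X.

Definition subshift_act (m : M) (x : X) : X :=
  exist _ (shift_by m (val x)) (mem_set (X_subshift.2 m _ (set_valP x))).

Lemma subshift_act_id x : subshift_act 0 x = x.
Proof. by apply/val_inj/funext => i /=; rewrite /shift_by addr0. Qed.

Lemma subshift_act_add m n x :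
  subshift_act (m + n) x = subshift_act m (subshift_act n x).
Proof. by apply/val_inj/funext => i /=; rewrite /shift_by addrA. Qed.

Lemma subshift_act_continuous m : continuous (subshift_act m).
Proof.
apply/continuous_comp_initial.
have -> : set_val \o subshift_act m = shift_by m \o set_val :> (X -> config M A).
  by [].
move=> x; apply: continuous_comp; first exact: initial_continuous.
exact: shift_by_continuous.
Qed.

Definition subshift_system : msystem M :=
  MSystem subshift_act_id subshift_act_add subshift_act_continuous.

End SubshiftSystem.

Section SoficQuotient.
Context (M : nmodType) (A : finType).

(* The identification of A^M x A^M with (A * A)^M. *)
Definition config_pair (x y : config M A) : config M (A * A)%type :=
  fun i => (x i, y i).

Definition equivalence_on (Y : set (config M A))
  (Z : set (config M (A * A)%type)) : Prop :=
  [/\ forall x, Y x -> Z (config_pair x x),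
      forall x y, Y x -> Y y -> Z (config_pair x y) -> Z (config_pair y x) &
      forall x y z, Y x -> Y y -> Y z ->
        Z (config_pair x y) -> Z (config_pair y z) -> Z (config_pair x z)].

Context (Y : set (config M A)) (Z : set (config M (A * A)%type)).
Hypotheses (Y_subshift : subshift Y) (Z_subshift : subshift Z).
Hypothesis YZ : equivalence_on Y Z.

Definition quotient_rel : rel Y :=
  fun x y => `[< Z (config_pair (val x) (val y)) >].

Lemma quotient_rel_refl : reflexive quotient_rel.
Proof. by case: YZ => YZr _ _ x; apply/asboolP; apply: YZr; exact: set_valP. Qed.

Lemma quotient_rel_sym : symmetric quotient_rel.
Proof.
by case: YZ => _ YZs _ x y; apply/asboolP/asboolP; apply: YZs; exact: set_valP.
Qed.

Lemma quotient_rel_trans : transitive quotient_rel.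
Proof.
case: YZ => _ _ YZt y x z /asboolP xy /asboolP yz; apply/asboolP.
by apply: YZt xy yz; exact: set_valP.
Qed.

Definition quotient_equiv : equiv_rel Y :=
  EquivRel quotient_rel quotient_rel_refl quotient_rel_sym quotient_rel_trans.

Lemma quotient_equiv_act m (x y : subshift_system Y_subshift) :
  quotient_equiv x y -> quotient_equiv (msys_act m x) (msys_act m y).
Proof. by move=> /asboolP xy; apply/asboolP; exact: (Z_subshift.2 m _ xy). Qed.

Definition sofic_quotient : msystem M :=
  quotient_system (X := subshift_system Y_subshift) quotient_equiv_act.

End SoficQuotient.

Record nfa (A : Type) := Nfa {
  initial_states : seq nat;
  final_states : seq nat;
  transitions : seq (nat * A * nat) }.

Fixpoint nfa_accept_from (A : eqType) (N : nfa A) (q : nat) (w : seq A) : bool :=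
  if w is a :: w' then
    has (fun t => (t.1 == (q, a)) && nfa_accept_from N t.2 w') (transitions N)
  else q \in final_states N.

Definition nfa_language (A : eqType) (N : nfa A) : set (seq A) :=
  [set w | has (fun q => nfa_accept_from N q w) (initial_states N)].

Record presentation := Presentation {
  alphabet_size : nat;
  automatonY : nfa 'I_alphabet_size;
  automatonZ : nfa ('I_alphabet_size * 'I_alphabet_size)%type }.

Definition presents (M : pzSemiRingType) (p : presentation) (X : msystem M) :
  Prop :=
  exists (Y : set (config M 'I_(alphabet_size p)))
         (Z : set (config M ('I_(alphabet_size p) * 'I_(alphabet_size p))%type))
         (Y_sofic : sofic Y) (Z_sofic : sofic Z) (YZ : equivalence_on Y Z),
    [/\ nfa_language (automatonY p) = language Y,
        nfa_language (automatonZ p) = language Z &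
        conjugate X (sofic_quotient Y_sofic.1 Z_sofic.1 YZ)].

(* CodeSeq.code is MathComp's explicit bijection from seq nat to nat. *)
Definition encode_nfa (A : Type) (encode_letter : A -> nat) (N : nfa A) : nat :=
  CodeSeq.code
    [:: CodeSeq.code (initial_states N);
        CodeSeq.code (final_states N);
        CodeSeq.code
          [seq CodeSeq.code [:: t.1.1; encode_letter t.1.2; t.2]
             | t <- transitions N]].

Definition encode_presentation (p : presentation) : nat :=
  CodeSeq.code
    [:: alphabet_size p;
        encode_nfa (fun a => nat_of_ord a) (automatonY p);
        encode_nfa (fun ab => CodeSeq.code [:: nat_of_ord ab.1; nat_of_ord ab.2])
          (automatonZ p)].

Definition encode_pair (p q : presentation) : nat :=
  CodeSeq.code [:: encode_presentation p; encode_presentation q].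

Definition conjugate_inputs (M : pzSemiRingType) : set nat :=
  [set n | exists (p q : presentation) (X Y : msystem M),
    [/\ n = encode_pair p q, presents p X, presents q Y & conjugate X Y]].

Definition nonhomeomorphic_inputs (M : pzSemiRingType) : set nat :=
  [set n | exists (p q : presentation) (X Y : msystem M),
    [/\ n = encode_pair p q, presents p X, presents q Y & ~ homeomorphic X Y]].

Lemma encode_nfa_inj (A : Type) (encode_letter : A -> nat) :
  injective encode_letter -> injective (encode_nfa encode_letter).
Proof.
have codeI : injective CodeSeq.code := can_inj CodeSeq.codeK.
move=> lI [i f t] [i' f' t'] /codeI eqs.
have /codeI ii' := congr1 (nth 0%N ^~ 0%N) eqs.
have /codeI ff' := congr1 (nth 0%N ^~ 1%N) eqs.
have /codeI tt' := congr1 (nth 0%N ^~ 2%N) eqs.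
congr Nfa; [exact: ii'|exact: ff'|].
by apply: inj_map tt' => -[[q a] r] [[q' a'] r'] /codeI[-> /lI -> ->].
Qed.

Lemma encode_presentation_inj : injective encode_presentation.
Proof.
have codeI : injective CodeSeq.code := can_inj CodeSeq.codeK.
move=> [k N L] [k' N' L'] /codeI eqs.
have kk' : k = k' := congr1 (nth 0%N ^~ 0%N) eqs.
case: _ / kk' => {k'} in N' L' eqs *.
have /encode_nfa_inj NN' := congr1 (nth 0%N ^~ 1%N) eqs.
have /encode_nfa_inj LL' := congr1 (nth 0%N ^~ 2%N) eqs.
congr Presentation; first by apply: NN'; exact: ord_inj.
by apply: LL' => -[a b] [a' b'] /codeI[/ord_inj -> /ord_inj ->].
Qed.

Lemma encode_pair_inj p q p' q' :
  encode_pair p q = encode_pair p' q' -> p = p' /\ q = q'.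
Proof.
move=> /(can_inj CodeSeq.codeK)[].
by move=> /encode_presentation_inj -> /encode_presentation_inj ->.
Qed.

(* Kleene's partial recursive functions. Functions take their arguments as a
   list; the arity is left implicit, and an argument missing from the list is
   read as 0 by Succ and Proj. *)
Inductive recfun :=
  | Zero
  | Succ
  | Proj of nat
  | Comp of recfun & seq recfun
  | PrimRec of recfun & recfun
  | Mu of recfun.

Inductive eval : recfun -> seq nat -> nat -> Prop :=
  | eval_Zero xs : eval Zero xs 0%N
  | eval_Succ xs : eval Succ xs (head 0%N xs).+1
  | eval_Proj i xs : eval (Proj i) xs (nth 0%N xs i)
  | eval_Comp f gs xs ys z :
      eval_all gs xs ys -> eval f ys z -> eval (Comp f gs) xs z
  | eval_PrimRec0 f g xs y :
      eval f xs y -> eval (PrimRec f g) (0%N :: xs) y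
  | eval_PrimRecS f g n xs y z :
      eval (PrimRec f g) (n :: xs) y -> eval g [:: n, y & xs] z ->
      eval (PrimRec f g) (n.+1 :: xs) z
  | eval_Mu f xs n (v : nat -> nat) :
      (forall m, (m < n)%N -> eval f (m :: xs) (v m).+1) ->
      eval f (n :: xs) 0%N -> eval (Mu f) xs n
with eval_all : seq recfun -> seq nat -> seq nat -> Prop :=
  | eval_nil xs : eval_all [::] xs [::]
  | eval_cons g gs xs y ys :
      eval g xs y -> eval_all gs xs ys -> eval_all (g :: gs) xs (y :: ys).

Definition recursive (C : set nat) : Prop :=
  exists f : recfun, forall n,
    (C n -> eval f [:: n] 1%N) /\ (~ C n -> eval f [:: n] 0%N).

(* Disjointness is part of the definition: without it, two sets that meet would
   be vacuously inseparable. *)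
Definition recursively_inseparable (A B : set nat) : Prop :=
  A `&` B = set0 /\
  ~ exists C : set nat, [/\ recursive C, A `<=` C & C `&` B = set0].

(* Main.v *)
(* A register machine is turned into two quotients of sofic shifts. A point
   carries one marker; the symbols to its right encode a machine configuration
   (registers in unary) and the binary expansion of a point of an arc. The
   relation identifies the two expansions of a dyadic point, the end of the arc
   of a configuration with the start of the arc of its successor, and collapses
   all sequences without marker or with an infinite register to one point. So
   the quotient is the one-point compactification of countably many copies of
   the graph of configurations, taken twice because the marker also carries a
   copy bit. Isolated points converging to the start configuration are added in
   copy 0 and others converging to the halting configuration are added in copy
   [e]; the systems for e = 0 and e = 1 are compared.
   If the machine does not halt, then the component of the halting configuration
   does not contain the start, and exchanging its two copies is a conjugacy. If
   it halts, then for e = 0 two limits of isolated points are joined by arcs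
   avoiding the point at infinity, and for e = 1 no two such limits are.
   The initial register value m enters the presentations only through a chain of
   m states. As m may also encode all the remaining data, a machine can compute
   the pair of presentations that is built from it, ask a decision procedure
   about this pair and do the opposite. *)
From mathcomp Require Import all_boot all_algebra.
From mathcomp Require Import all_classical topology zify.
Require Import Defs.

Set Implicit Arguments.
Unset Strict Implicit.
Unset Printing Implicit Defensive.

Import GRing.Theory.

(** * Computable functions *)

(** Exchanging the copies is no local rule, since it depends on whether a configuration leads to the
    halting one. It is still continuous on the quotient: a finite window fixes a configuration with
    finite registers, hence the decision taken there, and near infinity both candidates for an image
    are close to the same point. This is why limits with an infinite register must be collapsed.
    Marker-free points join them as limits of points whose marker moves away, and as what remains
    over [nat] when a shift pushes the marker off the left end. The relation is sofic because no
    chains of identifications occur: [glue_to] is a partial function from expansions ending in ones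
    to expansions ending in zeros, so two points are identified iff they share a value [w], which
    can be guessed as a hidden sequence. The isolated points make two configurations topologically
    visible: away from infinity their closure meets the arcs only at the starts of the arcs of these
    two. The diagonal machine halts with either answer. What matters is whether it stops in
    [mfinal], the halting configuration with output 0. *)

Definition computable (p : nat) (F : seq nat -> nat) : Prop :=
  exists f, forall xs, size xs = p -> eval f xs (F xs).

Definition computable1 (h : nat -> nat) := computable 1 (fun xs => h (nth 0 xs 0)).

Definition computable2 (h : nat -> nat -> nat) :=
  computable 2 (fun xs => h (nth 0 xs 0) (nth 0 xs 1)).

Lemma eq_computable p F G :
  (forall xs, size xs = p -> F xs = G xs) -> computable p F -> computable p G.
Proof. by move=> FG [f fF]; exists f => xs sx; rewrite -FG //; exact: fF. Qed.

Lemma computable_nth p i : computable p (fun xs => nth 0 xs i).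
Proof. by exists (Proj i) => xs _; exact: eval_Proj. Qed.

Lemma computable1_comp p h F :
  computable1 h -> computable p F -> computable p (fun xs => h (F xs)).
Proof.
move=> [g gP] [f fP]; exists (Comp g [:: f]) => xs sx.
apply: (@eval_Comp g [:: f] xs [:: F xs]); last exact: (gP [:: F xs]).
by apply: eval_cons; [exact: fP|exact: eval_nil].
Qed.

Lemma computable2_comp p h F G :
  computable2 h -> computable p F -> computable p G ->
  computable p (fun xs => h (F xs) (G xs)).
Proof.
move=> [e eP] [f fP] [g gP]; exists (Comp e [:: f; g]) => xs sx.
apply: (@eval_Comp e [:: f; g] xs [:: F xs; G xs]).
  by apply: eval_cons (fP _ sx) _; apply: eval_cons (gP _ sx) (eval_nil _).
exact: (eP [:: F xs; G xs]).
Qed.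

Lemma computableS : computable1 succn.
Proof. by exists Succ => -[|x []] // _; exact: eval_Succ. Qed.

Lemma computable_const p n : computable p (fun=> n).
Proof.
elim: n => [|n IHn]; first by exists Zero => xs _; exact: eval_Zero.
exact: computable1_comp computableS IHn.
Qed.

(** The prefix [ys] is what lets the induction on [xs] go through; the case of an empty prefix is
    the one used. *)
Lemma eval_all_proj xs ys :
  eval_all [seq Proj i | i <- iota (size ys) (size xs)] (ys ++ xs) xs.
Proof.
elim: xs ys => [|x xs IHxs] ys; first exact: eval_nil.
apply: eval_cons.
  by have := eval_Proj (size ys) (ys ++ x :: xs); rewrite nth_cat ltnn subnn.
by have := IHxs (rcons ys x); rewrite size_rcons cat_rcons.
Qed.

Lemma computable_rec p F G N :
  computable p F -> computable p.+2 G -> computable p N ->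
  computable p (fun xs =>
    nat_rect (fun=> nat) (F xs) (fun i a => G [:: i, a & xs]) (N xs)).
Proof.
move=> [f fP] [g gP] [n nP].
exists (Comp (PrimRec f g) (n :: [seq Proj i | i <- iota 0 p])) => xs sx.
apply: (@eval_Comp _ _ _ (N xs :: xs)).
  apply: eval_cons; first exact: nP.
  by have := eval_all_proj xs [::]; rewrite sx.
elim: (N xs) => [|i IHi] /=; first by apply: eval_PrimRec0; exact: fP.
by apply: eval_PrimRecS IHi _; apply: gP; rewrite /= sx.
Qed.

Lemma computable1_rec a (g : nat -> nat -> nat) h :
  computable2 g -> h 0 = a -> (forall i, h i.+1 = g i (h i)) -> computable1 h.
Proof.
move=> cg h0 hS.
have cG : computable 3 (fun xs => g (nth 0 xs 0) (nth 0 xs 1)).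
  by apply: computable2_comp => //; exact: computable_nth.
apply: eq_computable (computable_rec (computable_const 1 a) cG (computable_nth 1 0)).
by move=> xs _; elim: (nth _ _ _) => //= n ->.
Qed.

Lemma computable2_rec (h0 : nat -> nat) (g : nat -> nat -> nat -> nat)
    (h : nat -> nat -> nat) :
  computable1 h0 ->
  computable 3 (fun xs => g (nth 0 xs 0) (nth 0 xs 1) (nth 0 xs 2)) ->
  (forall x, h 0 x = h0 x) -> (forall i x, h i.+1 x = g i (h i x) x) ->
  computable2 h.
Proof.
move=> ch0 cg hE0 hES.
have cF : computable 2 (fun xs => h0 (nth 0 xs 1)).
  by apply: computable1_comp => //; exact: computable_nth.
(* The recursion keeps the whole argument list, so the parameter sits at index 3, behind the step
   index, the accumulator and the original counter. *)
have cG : computable 4 (fun xs => g (nth 0 xs 0) (nth 0 xs 1) (nth 0 xs 3)).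
  case: cg => e eP.
  exists (Comp e [:: Proj 0; Proj 1; Proj 3]) => xs sx.
  apply: (@eval_Comp _ _ _ [:: nth 0 xs 0; nth 0 xs 1; nth 0 xs 3]).
    by do 3!(apply: eval_cons; first exact: eval_Proj); exact: eval_nil.
  exact: (eP [:: nth 0 xs 0; nth 0 xs 1; nth 0 xs 3]).
apply: eq_computable (computable_rec cF cG (computable_nth 2 0)).
by move=> xs _ /=; elim: (nth 0 xs 0) => [|n IHn] /=; rewrite ?hE0 // hES IHn.
Qed.


Lemma computable_pred : computable1 predn.
Proof. by apply: (@computable1_rec 0 (fun i _ => i)) => //; exact: (computable_nth 2 0). Qed.

Lemma computable_rsub1 : computable1 (fun x => 1 - x).
Proof.
apply: (@computable1_rec 1 (fun _ _ => 0)) => //.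
exact: computable_const.
Qed.

Lemma computableD : computable2 addn.
Proof.
apply: (@computable2_rec id (fun _ a _ => a.+1)) => //; first exact: computable_nth.
by apply: computable1_comp computableS _; exact: computable_nth.
Qed.

Lemma computableM : computable2 muln.
Proof.
apply: (@computable2_rec (fun=> 0) (fun _ a x => x + a)) => //.
  exact: computable_const.
by apply: computable2_comp computableD _ _; exact: computable_nth.
Qed.

Lemma computable_pow2 : computable1 (expn 2).
Proof.
apply: (@computable1_rec 1 (fun _ a => a + a)) => // [|i].
  by apply: computable2_comp computableD _ _; exact: computable_nth.
by rewrite expnS mul2n addnn.
Qed.

(** This is the step by which [CodeSeq.code] puts one element in front of a list. *)
Definition code_cons (a x : nat) := 2 ^ a * x.*2.+1.

Lemma computable_code_cons : computable2 code_cons.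
Proof.
apply: (computable2_comp computableM).
  by apply: computable1_comp computable_pow2 _; exact: computable_nth.
apply: (computable1_comp computableS).
apply: (@eq_computable _ (fun xs => nth 0 xs 1 + nth 0 xs 1)).
  by move=> xs _; rewrite addnn.
by apply: computable2_comp computableD _ _; exact: computable_nth.
Qed.

Lemma computable_odd : computable1 (fun x => odd x : nat).
Proof.
apply: (@computable1_rec 0 (fun _ a => 1 - a)) => // [|i].
  by apply: computable1_comp computable_rsub1 _; exact: computable_nth.
by rewrite /=; case: (odd i).
Qed.

Lemma computable_half : computable1 half.
Proof.
apply: (@computable1_rec 0 (fun i a => odd i + a)) => // [|i].
  apply: computable2_comp computableD _ _; last exact: computable_nth.
  by apply: computable1_comp computable_odd _; exact: computable_nth.
by rewrite /= uphalf_half.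
Qed.

(* Iterating [strip2] removes the factors 2, hence decodes [code_cons]. *)
Definition strip2 (y : nat) := y./2 + odd y * (y - y./2).

Lemma strip2E y : strip2 y = if odd y then y else y./2.
Proof. by rewrite /strip2; case: (odd y) => /=; lia. Qed.

(** For [t = code_cons a x] the iterates are even for exactly [a] rounds and odd from then on. Since
    [a < t], running [t] rounds is enough for both head and tail. *)
Definition code_head (t : nat) := \sum_(i < t) ~~ odd (iter i strip2 t).
Definition code_tail (t : nat) := (iter t strip2 t)./2.

Lemma iter_strip2 a x i :
  iter i strip2 (code_cons a x) = if i <= a then code_cons (a - i) x else x.*2.+1.
Proof.
elim: i => [|i IHi]; first by rewrite subn0.
rewrite iterS {}IHi strip2E; case: (ltnP i a) => [ia|ai].
  rewrite (ltnW ia) /code_cons -[a - i](@prednK (a - i)) ?subn_gt0 // expnS -mulnA.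
  by rewrite mul2n odd_double doubleK -subnS.
case: (leqP i a) => [ia|_]; last by rewrite /= odd_double.
by rewrite /code_cons (eqP (_ : a - i == 0)) ?subn_eq0 // mul1n /= odd_double.
Qed.

Lemma code_cons_gt a x : a < code_cons a x.
Proof.
by rewrite -[a.+1]muln1; apply: leq_mul => //; exact: ltn_expl.
Qed.

Lemma code_headK a x : code_head (code_cons a x) = a.
Proof.
set t := code_cons a x; have at_ : a <= t by exact: ltnW (code_cons_gt _ _).
rewrite /code_head (eq_bigr (fun i : 'I_t => (i < a : nat))) => [|i _].
  rewrite -(big_mkord xpredT (fun i => (i < a : nat))) (big_cat_nat (leq0n a) at_) /=.
  rewrite (eq_big_nat _ _ (F2 := fun=> 1)) => [|i /andP[_ ->] //].
  rewrite sum_nat_const_nat subn0 muln1 (eq_big_nat _ _ (F2 := fun=> 0)).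
    by rewrite sum_nat_const_nat muln0 addn0.
  by move=> i /andP[ai _]; rewrite ltnNge ai.
rewrite iter_strip2; case: ltngtP => // [ia|ai|->].
- by rewrite /code_cons oddM oddX subn_eq0 leqNgt ia.
- by rewrite /= odd_double.
- by rewrite subnn /code_cons mul1n /= odd_double.
Qed.

Lemma code_tailK a x : code_tail (code_cons a x) = x.
Proof.
rewrite /code_tail iter_strip2 leqNgt code_cons_gt /=; lia.
Qed.

Lemma computable_strip2_iter : computable2 (fun i t => iter i strip2 t).
Proof.
apply: (@computable2_rec id (fun _ a _ => strip2 a)) => //; first exact: computable_nth.
(* Writing [y - y./2] as [odd y + y./2] avoids subtraction. *)
apply: (@eq_computable _
  (fun xs => (nth 0 xs 1)./2 + odd (nth 0 xs 1) * (odd (nth 0 xs 1) + (nth 0 xs 1)./2))).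
  by move=> xs _; rewrite /strip2; case: (odd _) (odd_double_half (nth 0 xs 1)) => /=; lia.
have co : computable 3 (fun xs => odd (nth 0 xs 1) : nat).
  by apply: computable1_comp computable_odd _; exact: computable_nth.
have ch : computable 3 (fun xs => (nth 0 xs 1)./2).
  by apply: computable1_comp computable_half _; exact: computable_nth.
apply: (computable2_comp computableD ch).
by apply: (computable2_comp computableM co); exact: computable2_comp computableD co ch.
Qed.

Lemma computable_code_tail : computable1 code_tail.
Proof.
apply: (computable1_comp computable_half).
by apply: computable2_comp computable_strip2_iter _ _; exact: computable_nth.
Qed.

Lemma computable_code_head : computable1 code_head.
Proof.
pose G (xs : seq nat) := (1 - odd (iter (nth 0 xs 0) strip2 (nth 0 xs 2))) + nth 0 xs 1.
have cG : computable 3 G.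
  apply: computable2_comp computableD _ (computable_nth _ _).
  apply: computable1_comp computable_rsub1 _.
  apply: computable1_comp computable_odd _.
  by apply: computable2_comp computable_strip2_iter _ _; exact: computable_nth.
apply: eq_computable (computable_rec (computable_const 1 0) cG (computable_nth 1 0)).
move=> [|t []] // _ /=; rewrite /code_head.
suff E n : nat_rect (fun=> nat) 0 (fun i a => G [:: i; a; t]) n
    = \sum_(i < n) ~~ odd (iter i strip2 t) by exact: E.
elim: n => [|n IHn]; rewrite ?big_ord0 // big_ord_recr /= IHn /G /= addnC.
by case: (odd _).
Qed.

Definition code_nth (j t : nat) := code_head (iter j code_tail t).

Lemma computable_code_nth j : computable1 (code_nth j).
Proof.
apply: computable1_comp computable_code_head _.
elim: j => [|j IHj]; first exact: computable_nth.
exact: computable1_comp computable_code_tail IHj.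
Qed.

Lemma code_nthK s j : j < size s -> code_nth j (CodeSeq.code s) = nth 0 s j.
Proof.
rewrite /code_nth; elim: s j => [|a s IHs] [|j] //= js; first exact: code_headK.
by rewrite -iterS iterSr -/(code_cons _ _) code_tailK IHs.
Qed.

(** * Compiling recursive functions to register machines *)

Section Reaches.
Context (T : Type) (step : T -> option T).

Definition reaches (x y : T) : Prop := exists n, iter n (obind step) (Some x) = Some y.

Lemma reaches_refl x : reaches x x.
Proof. by exists 0. Qed.

Lemma reaches_trans x y z : reaches x y -> reaches y z -> reaches x z.
Proof. by move=> [m xy] [n yz]; exists (n + m); rewrite iterD xy. Qed.

Lemma reaches_step x y z : step x = Some y -> reaches y z -> reaches x z.
Proof. by move=> xy; apply: reaches_trans; exists 1. Qed.

Lemma iter_obind_None n : iter n (obind step) None = None.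
Proof. by elim: n => //= n ->. Qed.

Lemma reachesP x z : reaches x z -> x = z \/ exists2 y, step x = Some y & reaches y z.
Proof.
move=> [[|n]]; first by case; left.
rewrite iterSr /=; case xy: (step x) => [y|]; last by rewrite iter_obind_None.
by move=> yz; right; exists y => //; exists n.
Qed.

Lemma reaches_halted x y z :
  reaches x y -> reaches x z -> step y = None -> step z = None -> y = z.
Proof.
move=> [n]; elim: n x => [|n IHn] x.
  by move=> [<-] /reachesP[-> //|[u ->]].
rewrite iterSr /=; case xu: (step x) => [u|]; last by rewrite iter_obind_None.
move=> xy /reachesP[xz|[u' u'x uz]] y0 z0; first by rewrite -xz xu in z0.
by apply: (IHn u) => //; move: u'x; rewrite xu => -[->].
Qed.

End Reaches.

Inductive cmd :=
  | Skip
  | Inc of nat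
  | Dec of nat
  | Seq of cmd & cmd
  | While of nat & cmd.

(* The control state of a program is the stack of commands left to execute. *)
Definition cmd_act (nonzero : nat -> bool) (k : seq cmd) :
    option (seq cmd * option (nat * bool)) :=
  match k with
  | [::] => None
  | Skip :: k' => Some (k', None)
  | Inc r :: k' => Some (k', Some (r, true))
  | Dec r :: k' => Some (k', Some (r, false))
  | Seq c1 c2 :: k' => Some ([:: c1, c2 & k'], None)
  | While r c :: k' => Some (if nonzero r then [:: c, While r c & k'] else k', None)
  end.

Definition upd (rho : nat -> nat) (r x : nat) : nat -> nat :=
  fun r' => if r' == r then x else rho r'.

Definition reg_op (op : option (nat * bool)) (rho : nat -> nat) : nat -> nat :=
  match op with
  | None => rho
  | Some (r, true) => upd rho r (rho r).+1
  | Some (r, false) => upd rho r (rho r).-1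
  end.

Definition cmd_step (v : seq cmd * (nat -> nat)) : option (seq cmd * (nat -> nat)) :=
  if cmd_act (fun r => 0 < v.2 r) v.1 is Some (k, op) then Some (k, reg_op op v.2)
  else None.

Definition runs (c : cmd) (rho rho' : nat -> nat) : Prop :=
  forall k, reaches cmd_step (c :: k, rho) (k, rho').

Lemma runs_one c rho rho' :
  (forall k, cmd_step (c :: k, rho) = Some (k, rho')) -> runs c rho rho'.
Proof. by move=> H k; apply: reaches_step (H k) (reaches_refl _ _). Qed.

Lemma runs_skip rho : runs Skip rho rho.
Proof. exact: runs_one. Qed.

Lemma runs_inc r rho : runs (Inc r) rho (upd rho r (rho r).+1).
Proof. exact: runs_one. Qed.

Lemma runs_dec r rho : runs (Dec r) rho (upd rho r (rho r).-1).
Proof. exact: runs_one. Qed.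

Lemma runs_seq c1 c2 rho rho1 rho2 :
  runs c1 rho rho1 -> runs c2 rho1 rho2 -> runs (Seq c1 c2) rho rho2.
Proof.
move=> r1 r2 k; apply: (@reaches_step _ _ _ ([:: c1, c2 & k], rho)) => //.
exact: reaches_trans (r1 _) (r2 _).
Qed.

Lemma runs_while0 r c rho : rho r = 0 -> runs (While r c) rho rho.
Proof. by move=> r0; apply: runs_one => k; rewrite /cmd_step /= r0. Qed.

Lemma runs_whileS r c rho rho1 rho2 :
  0 < rho r -> runs c rho rho1 -> runs (While r c) rho1 rho2 ->
  runs (While r c) rho rho2.
Proof.
move=> r0 r1 r2 k; apply: (@reaches_step _ _ _ ([:: c, While r c & k], rho)).
  by rewrite /cmd_step /= r0.
exact: reaches_trans (r1 _) (r2 _).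
Qed.

Lemma runs_eq c rho rho1 rho2 : runs c rho rho1 -> rho1 =1 rho2 -> runs c rho rho2.
Proof. by move=> r1 /funext <-. Qed.

Lemma eq_addl0 b k : (b == b + k.+1) = false.
Proof. lia. Qed.

Lemma eq_addr0 b k : (b + k.+1 == b) = false.
Proof. lia. Qed.

Ltac regs1 := rewrite /upd ?(eq_addl0, eq_addr0, eqn_add2l, eqxx) /=;
  repeat (match goal with |- context [?a == ?b] => case: (eqVneq a b) => ? end);
  try subst; try done; try lia.
Ltac regs := let r := fresh "r" in move=> r /=; regs1.

Definition clear r := While r (Dec r).

Lemma runs_clear r rho : runs (clear r) rho (upd rho r 0).
Proof.
move En: (rho r) => n; elim: n => [|n IHn] in rho En *.
  by apply: (runs_eq (runs_while0 _ En)); regs.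
apply: runs_whileS (runs_dec _ _) _; first by rewrite En.
by apply: (runs_eq (IHn _ _)); [rewrite /upd eqxx En|regs].
Qed.

Definition move_reg a o := While a (Seq (Dec a) (Inc o)).

Lemma runs_move a o rho : a != o ->
  runs (move_reg a o) rho (upd (upd rho o (rho o + rho a)) a 0).
Proof.
move=> ao; move En: (rho a) => n; elim: n => [|n IHn] in rho En *.
  by apply: (runs_eq (runs_while0 _ En)); regs.
apply: runs_whileS (runs_seq (runs_dec _ _) (runs_inc _ _)) _; first by rewrite En.
apply: (runs_eq (IHn _ _)).
  by rewrite /upd eqxx (negPf ao) En.
by regs; rewrite ?eqxx (negPf ao) in ao * => //; lia.
Qed.

Definition copy_reg a o t :=
  Seq (While a (Seq (Dec a) (Seq (Inc o) (Inc t)))) (move_reg t a).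

Lemma runs_copy a o t rho : a != o -> a != t -> o != t -> rho t = 0 ->
  runs (copy_reg a o t) rho (upd rho o (rho o + rho a)).
Proof.
move=> ao at_ ot t0.
have loop n rho' : rho' a = n ->
    runs (While a (Seq (Dec a) (Seq (Inc o) (Inc t)))) rho'
      (upd (upd (upd rho' o (rho' o + n)) t (rho' t + n)) a 0).
  elim: n => [|n IHn] in rho' * => En.
    by apply: (runs_eq (runs_while0 _ En)); regs.
  apply: runs_whileS _ (runs_seq (runs_dec _ _) (runs_seq (runs_inc _ _) (runs_inc _ _))) _.
    by rewrite En.
  apply: (runs_eq (IHn _ _)); first by rewrite /upd eqxx (negPf at_) (negPf ao) En.
  by regs; rewrite ?eqxx ?(negPf ao) ?(negPf at_) ?(negPf ot) in ao at_ ot * => //; lia.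
apply: (runs_seq (loop _ _ erefl)); apply: (runs_eq (runs_move _ _)); first by rewrite eq_sym.
move=> r; rewrite /upd.
case: (eqVneq r t) => [->|rt]; first by rewrite eq_sym (negPf ot) t0.
case: (eqVneq r a) => [->|ra]; last by [].
by rewrite !eqxx t0 (eq_sym t a) (negPf at_) (negPf ao) add0n.
Qed.

Fixpoint clear_from (b n : nat) : cmd :=
  if n is n'.+1 then Seq (clear b) (clear_from b.+1 n') else Skip.

Lemma runs_clear_from b n rho :
  runs (clear_from b n) rho (fun r => if b <= r < b + n then 0 else rho r).
Proof.
elim: n => [|n IHn] in b rho *.
  by apply: (runs_eq (runs_skip _)) => r; case: ifP => //; lia.
apply: runs_seq (runs_clear _ _) _; apply: (runs_eq (IHn _ _)) => r.
by rewrite /upd; case: (eqVneq r b) => [->|rb]; do ?case: ifP => //; lia.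
Qed.

(** The registers [ins] hold the arguments and keep them, [out] receives the value, and everything
    from [b] on is scratch space that is 0 before and after. For [PrimRec], [b] counts the remaining
    rounds, [b + 1] is the round index, [b + 2] the accumulator and [b + 3] its next value. For
    [Mu], [b] is the candidate and [b + 1] the value being tested. *)
Fixpoint compile (f : recfun) (ins : seq nat) (out b : nat) {struct f} : cmd :=
  match f with
  | Zero => Skip
  | Succ => Seq (if ins is a :: _ then copy_reg a out b else Skip) (Inc out)
  | Proj i => if i < size ins then copy_reg (nth 0 ins i) out b else Skip
  | Comp f gs =>
      Seq ((fix args hs j :=
              if hs is h :: hs' then Seq (compile h ins j (b + size gs)) (args hs' j.+1)
              else Skip) gs b)
        (Seq (compile f (iota b (size gs)) out (b + size gs)) (clear_from b (size gs)))
  | PrimRec f g =>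
      if ins is a :: rest then
        Seq (copy_reg a b (b + 4))
          (Seq (compile f rest (b + 2) (b + 4))
            (Seq (While b (Seq (Dec b)
                (Seq (compile g [:: b + 1, b + 2 & rest] (b + 3) (b + 4))
                  (Seq (clear (b + 2)) (Seq (move_reg (b + 3) (b + 2)) (Inc (b + 1)))))))
              (Seq (clear (b + 1)) (move_reg (b + 2) out))))
      else Skip
  | Mu f =>
      Seq (compile f (b :: ins) (b + 1) (b + 2))
        (Seq (While (b + 1) (Seq (clear (b + 1))
                 (Seq (Inc b) (compile f (b :: ins) (b + 1) (b + 2)))))
          (move_reg b out))
  end.

Definition compiles (f : recfun) : Prop :=
  forall ins out b rho y,
    eval f [seq rho a | a <- ins] y -> all (gtn b) ins -> out < b -> out \notin ins ->
    rho out = 0 -> (forall r, b <= r -> rho r = 0) ->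
    runs (compile f ins out b) rho (upd rho out y).

Lemma recfun_ind_nested (P : recfun -> Prop) :
  P Zero -> P Succ -> (forall i, P (Proj i)) ->
  (forall f gs, P f -> List.Forall P gs -> P (Comp f gs)) ->
  (forall f g, P f -> P g -> P (PrimRec f g)) ->
  (forall f, P f -> P (Mu f)) -> forall f, P f.
Proof.
move=> P0 PS Pp Pc Pr Pm; fix IH 1 => -[| |i|f gs|f g|f].
- exact: P0.
- exact: PS.
- exact: Pp.
- apply: Pc; first exact: IH.
  by elim: gs => [|g gs IHgs]; constructor; [exact: IH|exact: IHgs].
- by apply: Pr; exact: IH.
- by apply: Pm; exact: IH.
Qed.

Lemma map_upd rho r x ins :
  r \notin ins -> [seq upd rho r x a | a <- ins] = [seq rho a | a <- ins].
Proof.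
move=> rins; apply/eq_in_map => a ain; rewrite /upd.
by case: eqVneq rins => // <-; rewrite ain.
Qed.

Lemma all_gtn_notin b ins r : all (gtn b) ins -> b <= r -> r \notin ins.
Proof. by move=> /allP insb br; apply/negP => /insb /=; lia. Qed.

Lemma all_gtn_leq b c ins : b <= c -> all (gtn b) ins -> all (gtn c) ins.
Proof. by move=> bc; apply: sub_all => x /=; lia. Qed.

Lemma compiles_comp f gs :
  compiles f -> List.Forall compiles gs -> compiles (Comp f gs).
Proof.
move=> cf cgs ins out b rho y E insb outb outins out0 rho0.
inversion_clear E as [| | |? ? ? ys ? Egs Ef| | |] => /=.
set n := size gs.
pose setregs rho j (zs : seq nat) := fun r =>
  if j <= r < j + size zs then nth 0 zs (r - j) else rho r : nat.
(* Generalised over the next target register [j] and the current state: earlier results lie below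
   [j], and all registers from [j] on are still 0. *)
have args hs j rho' zs : List.Forall compiles hs -> b <= j -> j + size hs <= b + n ->
    (forall r, j <= r -> rho' r = 0) -> eval_all hs [seq rho' a | a <- ins] zs ->
    size zs = size hs /\
    runs ((fix args hs j := if hs is h :: hs' then
             Seq (compile h ins j (b + n)) (args hs' j.+1) else Skip) hs j)
      rho' (setregs rho' j zs).
  move=> chs; elim: chs j rho' zs => [|h hs' ch _ IH] j rho' zs bj jn z0 E.
    inversion_clear E; split=> //.
    by apply: (runs_eq (runs_skip _)) => r; rewrite /setregs; case: ifP => //=; lia.
  inversion_clear E as [|? ? ? z zs' Eh Ehs].
  have jins : j \notin ins by exact: all_gtn_notin insb bj.
  move: jn => /= jn.
  have [||||szs r2] := IH j.+1 (upd rho' j z) zs' _ _ _ _.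
  - lia.
  - lia.
  - by move=> r jr; rewrite /upd; case: eqVneq => [|_]; [lia|apply: z0; lia].
  - by rewrite map_upd.
  split; first by rewrite /= szs.
  apply: runs_seq.
    apply: (ch ins j (b + n) rho' z) => //; first by apply: all_gtn_leq insb; lia.
    - by rewrite /=; lia.
    - exact: z0.
    - by move=> r br; apply: z0; lia.
  apply: runs_eq r2 _ => r; rewrite /setregs /upd /=.
  case: (eqVneq r j) => [->|rj].
    by rewrite ltnn leqnn subnn addnS leq_addr.
  case: ifP => H; case: ifP => H'; try lia.
  by have -> : r - j = (r - j.+1).+1 by lia.
have [] := args gs b rho ys cgs (leqnn _) (leqnn _) rho0 Egs.
rewrite -/n => sys r1; apply: runs_seq r1 _.
have Eys : [seq setregs rho b ys a | a <- iota b n] = ys.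
  apply: (@eq_from_nth _ 0); first by rewrite size_map size_iota.
  move=> i; rewrite size_map size_iota => ilt.
  rewrite (nth_map 0) ?size_iota // nth_iota // /setregs sys leq_addr ltn_add2l ilt.
  by rewrite addKn.
apply: runs_seq.
  apply: (cf (iota b n) out (b + n) _ y).
  - by rewrite Eys.
  - by apply/allP => r; rewrite mem_iota /=; lia.
  - lia.
  - by rewrite mem_iota; lia.
  - by rewrite /setregs; case: ifP => //; lia.
  - by move=> r br; rewrite /setregs; case: ifP => [|_]; [lia|apply: rho0; lia].
apply: (runs_eq (runs_clear_from _ _ _)) => r; rewrite /upd /setregs sys.
case: (eqVneq r out) => [->|_]; first by case: ifP => //; lia.
rewrite -/n; case: ifP => [H|H]; last by rewrite H.
by rewrite rho0 //; case/andP: H.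
Qed.

Lemma compiles_primrec f g : compiles f -> compiles g -> compiles (PrimRec f g).
Proof.
move=> cf cg [|a rest] out b rho y E insb outb outins out0 rho0.
  by inversion E.
move: insb outins; rewrite /= inE negb_or eq_sym => /andP[ab insb] /andP[ao outins].
(* The loop state with [x] rounds left, round index [i] and accumulator [z]. *)
pose S x i z := upd (upd (upd rho b x) (b + 1) i) (b + 2) z.
pose loop := While b (Seq (Dec b)
   (Seq (compile g [:: b + 1, b + 2 & rest] (b + 3) (b + 4))
     (Seq (clear (b + 2)) (Seq (move_reg (b + 3) (b + 2)) (Inc (b + 1)))))).
have insb4 : all (gtn (b + 4)) rest by apply: all_gtn_leq insb; lia.
have notrest r : b <= r -> r \notin rest by exact: all_gtn_notin insb.
have Srest x i z : [seq S x i z a | a <- rest] = [seq rho a | a <- rest].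
  by rewrite /S !map_upd //; apply: notrest; lia.
(* The derivation of [eval] is unfolded from the last round down to [f], while the loop runs
   upwards. Hence the continuation form: a run from the state after [n] rounds is extended to one
   from the state before the first round. *)
have loopP n z : eval (PrimRec f g) (n :: [seq rho a | a <- rest]) z ->
    exists2 y0, eval f [seq rho a | a <- rest] y0 &
      forall m rho', runs loop (S m n z) rho' -> runs loop (S (n + m) 0 y0) rho'.
  elim: n z => [|n IHn] z E'.
    by inversion_clear E' as [| | | |? ? ? ? E0| |]; exists z.
  inversion_clear E' as [| | | | |? ? ? ? w ? En Eg|].
  have [y0 Ey0 H] := IHn w En; exists y0 => // m rho' r'.
  rewrite addSnnS; apply: H; apply: runs_whileS r'.
    by rewrite /S; regs1.
  apply: runs_seq (runs_dec _ _) _.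
  have -> : upd (S m.+1 n w) b (S m.+1 n w b).-1 = S m n w.
    by apply/funext; rewrite /S; regs.
  apply: runs_seq.
    apply: (cg _ (b + 3) (b + 4) (S m n w) z).
    - have S1 : S m n w (b + 1) = n by rewrite /S; regs1.
      have S2 : S m n w (b + 2) = w by rewrite /S; regs1.
      by rewrite 2!map_cons Srest S1 S2.
    - by rewrite /= insb4 !ltn_add2l.
    - lia.
    - by rewrite !inE !eqn_add2l /= notrest // leq_addr.
    - by rewrite /S; regs1; apply: rho0; lia.
    - move=> r br; by rewrite /S; regs1; apply: rho0; lia.
  apply: runs_seq (runs_clear _ _) _.
  apply: runs_seq (runs_move _ _) _; first by rewrite eqn_add2l.
  apply: (runs_eq (runs_inc _ _)); rewrite /S.
  have rho3 : rho (b + 3) = 0 by apply: rho0; lia.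
  by regs.
have [y0 Ey0 H] := loopP _ _ E.
have rhob r : rho (b + r) = 0 by apply: rho0; rewrite leq_addr.
have rb : rho b = 0 by apply: rho0.
apply: runs_seq; first by apply: runs_copy; rewrite ?rhob //; lia.
apply: runs_seq.
  apply: (cf rest (b + 2) (b + 4) _ y0) => //.
  - by rewrite map_upd // notrest.
  - lia.
  - by rewrite notrest // leq_addr.
  - by regs1; rewrite rhob.
  - by move=> r br; regs1; apply: rho0; lia.
have -> : upd (upd rho b (rho b + rho a)) (b + 2) y0 = S (rho a) 0 y0.
  by apply/funext; rewrite /S rb add0n; regs; rewrite rhob.
apply: (@runs_seq _ _ _ (S 0 (rho a) y)).
  rewrite -[X in S X 0 y0]addn0; apply: H; apply: runs_while0.
  by rewrite /S; regs1.
apply: runs_seq (runs_clear _ _) _.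
apply: (runs_eq (runs_move _ _)); first by lia.
by rewrite /S; regs; rewrite ?rb ?rhob.
Qed.

Lemma compiles_mu f : compiles f -> compiles (Mu f).
Proof.
move=> cf ins out b rho y E insb outb outins out0 rho0.
inversion_clear E as [| | | | | |? ? ? v Ev E0] => /=.
pose S i z := upd (upd rho b i) (b + 1) z.
pose val i := if i < y then (v i).+1 else 0.
have evalS i : i <= y -> eval f (i :: [seq rho a | a <- ins]) (val i).
  by rewrite /val leq_eqVlt => /orP[/eqP->|iy]; [rewrite ltnn|rewrite iy; exact: Ev].
have body i : i <= y -> runs (compile f (b :: ins) (b + 1) (b + 2)) (S i 0) (S i (val i)).
  move=> iy; apply: runs_eq (cf _ _ _ _ (val i) _ _ _ _ _ _) _.
  - have Sb : S i 0 b = i by rewrite /S; regs1.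
    rewrite map_cons Sb /S !map_upd ?(all_gtn_notin insb) ?leq_addr //; exact: evalS.
  - by rewrite /= -{1}[b]addn0 ltn_add2l /=; apply: all_gtn_leq insb; lia.
  - lia.
  - by rewrite inE negb_or (all_gtn_notin insb) ?leq_addr // andbT; lia.
  - by rewrite /S /upd eqxx.
  - by move=> r br; rewrite /S; regs1; apply: rho0; lia.
  - by rewrite /S; regs.
have S00 : S 0 0 = rho.
  have rb : rho b = 0 by apply: rho0.
  have rb1 : rho (b + 1) = 0 by apply: rho0; lia.
  by apply/funext; rewrite /S; regs.
apply: runs_seq; first by rewrite -{1}S00; exact: body.
apply: (@runs_seq _ _ _ (S y 0)).
  have loop n : n <= y -> runs (While (b + 1) (Seq (clear (b + 1))
       (Seq (Inc b) (compile f (b :: ins) (b + 1) (b + 2))))) (S (y - n) (val (y - n))) (S y 0).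
    elim: n => [|n IHn] ny.
      by rewrite subn0 /val ltnn; apply: runs_while0; rewrite /S /upd eqxx.
    apply: runs_whileS (IHn (ltnW ny)).
      by rewrite /S /upd eqxx /val; case: ifP => //; lia.
    apply: runs_seq (runs_clear _ _) _; apply: runs_seq (runs_inc _ _) _.
    rewrite (_ : upd _ _ _ = S (y - n) 0); first by apply: body; lia.
    by apply/funext; rewrite /S; regs.
  by have := loop y (leqnn _); rewrite subnn.
apply: (runs_eq (runs_move _ _)); first by lia.
have rb : rho b = 0 by apply: rho0.
have rb1 : rho (b + 1) = 0 by apply: rho0; lia.
by rewrite /S; regs; rewrite rho0 //; lia.
Qed.

Lemma compilesP f : compiles f.
Proof.
elim/recfun_ind_nested: f => [||i|f gs|f g|f].
- move=> ins out b rho y E insb outb outins out0 rho0; inversion_clear E.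
  by apply: (runs_eq (runs_skip _)); regs.
- move=> [|a ins] out b rho y E insb outb outins out0 rho0; inversion_clear E => /=.
    by apply: runs_seq (runs_skip _) _; apply: (runs_eq (runs_inc _ _)); rewrite out0.
  move: insb outins; rewrite /= inE negb_or eq_sym => /andP[ab _] /andP[ao _].
  apply: runs_seq; first by apply: (runs_copy (t := b)); [| | |exact: rho0]; lia.
  by apply: (runs_eq (runs_inc _ _)); regs; rewrite ?eqxx out0.
- move=> ins out b rho y E insb outb outins out0 rho0; inversion_clear E => /=.
  case: ltnP => [ilt|ige]; last first.
    by rewrite nth_default ?size_map //; apply: (runs_eq (runs_skip _)); regs.
  have iin := mem_nth 0 ilt; have ib := allP insb _ iin.
  rewrite (nth_map 0) //; apply: (runs_eq (runs_copy _ _ _ _)).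
  + by apply: contraNneq outins => <-.
  + by move: ib => /=; lia.
  + lia.
  + exact: rho0.
  + by rewrite out0.
- exact: compiles_comp.
- exact: compiles_primrec.
- exact: compiles_mu.
Qed.

(* A register machine whose registers may be infinite: register [r] is read
   as the sequence of bits [d 0 r, d 1 r, ...], and a number [n] is [n] ones
   followed by zeros. *)
Record machine := Machine {
  mstate : finType;
  mregs : nat;
  mact : mstate -> {ffun 'I_mregs -> bool} ->
    option (mstate * option ('I_mregs * bool));
  mstart : mstate;
  mhalt : mstate;
  minput : 'I_mregs;
  mstart_halt : mstart != mhalt;
  mact_halt : forall b, mact mhalt b = None }.

(** Bit sequences instead of numbers, because a closed shift space also contains limits of
    configurations whose registers grow without bound. *)
Definition tracks (K : nat) : Type := nat -> {ffun 'I_K -> bool}.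

Definition push K (r : 'I_K) (d : tracks K) : tracks K :=
  fun j => [ffun k => if k == r then (if j is j'.+1 then d j' r else true) else d j k].

Definition pop K (r : 'I_K) (d : tracks K) : tracks K :=
  fun j => [ffun k => if k == r then d j.+1 r else d j k].

Definition track_op K (op : option ('I_K * bool)) (d : tracks K) : tracks K :=
  match op with
  | None => d
  | Some (r, true) => push r d
  | Some (r, false) => pop r d
  end.

Definition mconfig (T : machine) : Type := (mstate T * tracks (mregs T))%type.

Definition mstep (T : machine) (v : mconfig T) : option (mconfig T) :=
  if mact v.1 (v.2 0) is Some (q, op) then Some (q, track_op op v.2) else None.

Definition minit (T : machine) (n : nat) : mconfig T :=
  (mstart T, fun j => [ffun k => (k == minput T) && (j < n)]).

(** Halting with output 0 and every register empty. A run that halts with another output stops in a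
    different configuration. *)
Definition mfinal (T : machine) : mconfig T := (mhalt T, fun=> [ffun=> false]).

Definition unary K (rho : nat -> nat) : tracks K := fun j => [ffun k : 'I_K => j < rho k].

Lemma unary_push K (r : 'I_K) rho : push r (unary K rho) = unary K (upd rho r (rho r).+1).
Proof.
apply/funext => j; apply/ffunP => k; rewrite !ffunE /upd -val_eqE /=.
by case: eqVneq => // _; case: j => [|j] //; rewrite ffunE.
Qed.

Lemma unary_pop K (r : 'I_K) rho : pop r (unary K rho) = unary K (upd rho r (rho r).-1).
Proof.
apply/funext => j; apply/ffunP => k; rewrite !ffunE /upd -val_eqE /=.
by case: eqVneq => // _; lia.
Qed.

(** * The finite control of a compiled program *)

Fixpoint max_reg (c : cmd) : nat :=
  match c with
  | Skip => 0
  | Inc r | Dec r => r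
  | Seq c1 c2 => maxn (max_reg c1) (max_reg c2)
  | While r c1 => maxn r (max_reg c1)
  end.

(** The finitely many control stacks that can arise from [c :: k] before [k] is uncovered; with the
    empty stack they become the states of the machine. The [classic] wrapper supplies equality on
    commands. *)
Fixpoint conts (c : cmd) (k : seq cmd) : seq {classic (seq cmd)} :=
  (c :: k) ::
  match c with
  | Seq c1 c2 => conts c1 (c2 :: k) ++ conts c2 k
  | While r c1 => conts c1 (While r c1 :: k)
  | _ => [::]
  end.

Lemma conts_head c k : (c :: k : {classic (seq cmd)}) \in conts c k.
Proof. by case: c => *; rewrite /= in_cons eqxx. Qed.

Lemma conts_act c k (k1 k2 : {classic (seq cmd)}) b op :
  k1 \in conts c k -> cmd_act b k1 = Some (k2, op) -> k2 \in conts c k \/ k2 = k.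
Proof.
elim: c k k1 => [|r|r|c1 IH1 c2 IH2|r c1 IH1] k k1 /=.
- by rewrite in_cons in_nil orbF => /eqP -> [<-]; right.
- by rewrite in_cons in_nil orbF => /eqP -> [<-]; right.
- by rewrite in_cons in_nil orbF => /eqP -> [<-]; right.
- rewrite in_cons mem_cat => /or3P[/eqP -> [<- _]|k1in E|k1in E].
  + by left; rewrite in_cons mem_cat conts_head orbT.
  + have [k2in| ->] := IH1 _ _ k1in E; left; rewrite in_cons mem_cat.
      by rewrite k2in orbT.
    by rewrite conts_head !orbT.
  + have [k2in| ->] := IH2 _ _ k1in E; [left|by right].
    by rewrite in_cons mem_cat k2in !orbT.
- rewrite in_cons => /orP[/eqP -> [<- _]|k1in E].
  + by case: (b r); [left; rewrite in_cons conts_head orbT|right].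
  + have [k2in| ->] := IH1 _ _ k1in E; left; rewrite in_cons; first by rewrite k2in orbT.
    by rewrite eqxx.
Qed.

Lemma conts_regs c k k1 K :
  k1 \in conts c k -> all (fun c => max_reg c < K) (c :: k) ->
  all (fun c => max_reg c < K) k1.
Proof.
elim: c k => [|r|r|c1 IH1 c2 IH2|r c1 IH1] k /=; rewrite in_cons.
- by rewrite in_nil orbF => /eqP ->.
- by rewrite in_nil orbF => /eqP ->.
- by rewrite in_nil orbF => /eqP ->.
- rewrite mem_cat => /or3P[/eqP -> //|k1in|k1in] /andP[]; rewrite gtn_max => /andP[c1K c2K] kK.
    by apply: IH1 k1in _; rewrite /= c1K c2K.
  by apply: IH2 k1in _; rewrite /= c2K.
- move=> /orP[/eqP -> //|k1in] /andP[rcK kK]; apply: IH1 k1in _; rewrite /= rcK kK !andbT.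
  by move: rcK; rewrite gtn_max => /andP[].
Qed.

Section Compile.
Context (c : cmd).

(** At least two registers: 0 for the output and 1 for the input. *)
Let K := (maxn 1 (max_reg c)).+1.
Let S : seq {classic (seq cmd)} := [::] :: conts c [::].

Lemma nil_conts : ([::] : {classic (seq cmd)}) \in S.
Proof. by rewrite in_cons eqxx. Qed.

Lemma start_conts : ([:: c] : {classic (seq cmd)}) \in S.
Proof. by rewrite in_cons conts_head orbT. Qed.

Let hlt : seq_sub S := SeqSub nil_conts.

Definition control_act (q : seq_sub S) (b : {ffun 'I_K -> bool}) :
    option (seq_sub S * option ('I_K * bool)) :=
  omap (fun kop => (insubd hlt (kop.1 : {classic (seq cmd)}),
                    omap (fun rb => (inord rb.1 : 'I_K, rb.2)) kop.2))
    (cmd_act (fun r => b (inord r)) (ssval q)).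

Lemma control_act_hlt b : control_act hlt b = None.
Proof. by []. Qed.

Lemma start_neq_hlt : SeqSub start_conts != hlt.
Proof. by rewrite -val_eqE /=; apply/eqP. Qed.

Definition cmd_machine : machine :=
  Machine (inord 1) start_neq_hlt control_act_hlt.

Lemma inord_reg (r : nat) : r < K -> nat_of_ord (inord r : 'I_K) = r.
Proof. exact: inordK. Qed.

Lemma cmd_machine_step k rho k' rho' :
  (k : {classic (seq cmd)}) \in S -> cmd_step (k, rho) = Some (k', rho') ->
  (k' : {classic (seq cmd)}) \in S /\
  @mstep cmd_machine (insubd hlt (k : {classic (seq cmd)}), unary K rho)
    = Some (insubd hlt (k' : {classic (seq cmd)}), unary K rho').
Proof.
move=> kS; rewrite /cmd_step /=.
case E: (cmd_act _ k) => [[k2 op]|] // [<- <-]; split.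
  move: kS; rewrite in_cons => /orP[/eqP k0|kc]; first by rewrite k0 in E.
  by rewrite in_cons; have [->| ->] := conts_act kc E; rewrite ?orbT ?eqxx.
have kK : all (fun c => max_reg c < K) k.
  move: kS; rewrite in_cons => /orP[/eqP -> //|kc].
  by apply: (conts_regs kc); rewrite /= andbT /K; lia.
have Eb : cmd_act (fun r => unary K rho 0 (inord r)) k = cmd_act (fun r => 0 < rho r) k.
  case: k kK {E kS} => [|[|r|r|c1 c2|r c1] k] //= /andP[rK _].
  by rewrite ffunE inord_reg //; lia.
rewrite /mstep /= /control_act.
have -> : ssval (insubd hlt (k : {classic (seq cmd)})) = k.
  by have := insubdK hlt kS.
rewrite Eb E /=; congr (Some (_, _)).
case: op E => [[r b]|] //= E.
have rK : r < K.
  case: k E kK {Eb kS} => [|[|r'|r'|c1 c2|r' c1] k] //= [_ <- _] /andP[]; rewrite /K; lia.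
by case: b {E}; rewrite ?unary_push ?unary_pop inord_reg.
Qed.

Lemma cmd_machine_reaches rho rho' :
  reaches cmd_step ([:: c], rho) ([::], rho') ->
  reaches (@mstep cmd_machine) (mstart cmd_machine, unary K rho)
    (mhalt cmd_machine, unary K rho').
Proof.
move=> [n]; have := start_conts.
have -> : mstart cmd_machine = insubd hlt ([:: c] : {classic (seq cmd)}).
  by apply/val_inj; rewrite insubdK // start_conts.
have -> : mhalt cmd_machine = insubd hlt ([::] : {classic (seq cmd)}).
  by apply/val_inj; rewrite insubdK // nil_conts.
elim: n [:: c] rho => [|n IHn] k rho kS.
  by move=> [-> ->]; exact: reaches_refl.
rewrite iterSr /=; case E: (cmd_step _) => [[k' rho1]|]; last by rewrite iter_obind_None.
move=> /IHn H; have [k'S st] := cmd_machine_step kS E.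
exact: reaches_step st (H k'S).
Qed.

End Compile.

Lemma machine_of_recfun (F : recfun) : exists T : machine,
  forall n y, eval F [:: n] y -> exists d,
    reaches (@mstep T) (minit T n) (mhalt T, d) /\
    ((mhalt T, d) = mfinal T <-> y = 0).
Proof.
(* Clearing the input register leaves the output in register 0 as the only possibly nonzero one, so
   that output 0 means stopping exactly in [mfinal]. *)
pose c := Seq (compile F [:: 1] 0 2) (clear 1).
exists (cmd_machine c) => n y E.
pose rho := upd (fun=> 0) 1 n.
have r1 : runs c rho (upd (upd rho 0 y) 1 0).
  apply: runs_seq (runs_clear _ _); apply: compilesP => //.
  by move=> [|[|r]].
have := cmd_machine_reaches (r1 [::]); set K := (maxn _ _).+1.
set rho' := upd _ 1 0.
have K1 : 1 < K by rewrite /K; lia.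
move=> rc; exists (unary K rho'); split.
  suff -> : minit (cmd_machine c) n = (mstart (cmd_machine c), unary K rho) by [].
  congr (_, _); apply/funext => j; apply/ffunP => k; rewrite !ffunE -val_eqE.
  rewrite (_ : val (minput (cmd_machine c)) = 1) /rho /upd; last exact: inord_reg.
  by case: eqP.
split=> [[] /(congr1 (fun d : tracks K => d 0 (Ordinal (ltnW K1))))|y0].
  by rewrite !ffunE /rho' /rho /upd /=; case: (y).
congr (_, _); apply/funext => j; apply/ffunP => k; rewrite !ffunE /rho' /rho /upd y0.
by do !case: eqP.
Qed.

(** * Cylinders and labelled graphs *)

Section Cylinders.
Local Open Scope classical_set_scope.
Context (M : nmodType) (A : finType).
Implicit Types x y : config M A.

Definition agree_on (s : seq M) x y : Prop := forall i, i \in s -> y i = x i.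

Lemma proj_nbhs x i : nbhs x [set y : config M A | y i = x i].
Proof.
have := @proj_continuous M (fun _ => discrete_topology A) i x.
by move=> /(_ [set x i]); apply; exact: discrete_set1.
Qed.

Lemma nbhs_config x (U : set (config M A)) :
  nbhs x U <-> exists s, forall y, agree_on s x y -> U y.
Proof.
split=> [|[s sU]].
  pose F : set_system (config M A) :=
    [set V | exists s, forall y, agree_on s x y -> V y].
  have FF : Filter F.
    split=> [|P Q [s sP] [t tQ]|P Q PQ [s sP]].
    - by exists [::].
    - exists (s ++ t) => y st; split.
        by apply: sP => i si; apply: st; rewrite mem_cat si.
      by apply: tQ => i ti; apply: st; rewrite mem_cat ti orbT.
    - by exists s => y /sP /PQ.
  suff : F --> x by apply.
  apply/cvg_sup => i.
  move=> V /= [W [[C oC <-] Cx] CV]; exists [:: i] => y yx; apply: CV => /=.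
  by rewrite (yx i) // inE.
have xF : Filter (nbhs x) by exact: nbhs_filter.
have : nbhs x [set y : config M A | agree_on s x y].
  elim: s {sU} => [|i s IHs]; first by apply: filterS (@filterT _ _ xF) => y _ j.
  apply: filterS (filterI (proj_nbhs x i) IHs) => y [yi ys] j.
  by rewrite inE => /orP[/eqP->|/ys].
exact: filterS.
Qed.

Lemma config_compact (P : set (config M A)) : closed P -> compact P.
Proof.
move=> cP; apply: (subclosed_compact cP _ (fun x _ => I : setT x)).
have := @tychonoff M (fun _ => discrete_topology A) (fun _ => setT) _.
rewrite (_ : [set f | _] = setT); last by apply/seteqP; split.
by apply=> i; apply: finite_compact; exact: (@finite_finset A).
Qed.

Lemma config_hausdorff : hausdorff_space (config M A).
Proof. by apply: hausdorff_product => i; exact: discrete_hausdorff. Qed.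

Lemma closed_config (P : set (config M A)) :
  (forall x, (forall s, exists2 y, P y & agree_on s x y) -> P x) -> closed P.
Proof.
move=> H x xcl; apply: H => s.
have [|y [Py yx]] := xcl [set y | agree_on s x y]; last by exists y.
by apply/nbhs_config; exists s.
Qed.

Lemma closed_configP (P : set (config M A)) :
  closed P -> forall x, (forall s, exists2 y, P y & agree_on s x y) -> P x.
Proof.
move=> cP x H; apply: cP => U /nbhs_config[s sU].
by have [y Py yx] := H s; exists y; split => //; exact: sU.
Qed.

Context (Y : set (config M A)).

Lemma nbhs_subconfig (x : Y) (U : set Y) :
  nbhs x U <-> exists s, forall y : Y, agree_on s (val x) (val y) -> U y.
Proof.
split=> [[_ [[V oV <-] Vx] VU]|[s sU]].
  have /nbhs_config[s sV] : nbhs (val x) V by apply: open_nbhs_nbhs; split.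
  by exists s => y /sV; exact: VU.
have : nbhs (set_val x) [set y | agree_on s (val x) y] by apply/nbhs_config; exists s.
have xF : Filter (nbhs x) by exact: nbhs_filter.
by move=> /(@initial_continuous _ _ (@set_val _ Y) x); apply: (@filterS _ _ xF) => y /sU.
Qed.

Lemma open_subconfig (U : set Y) :
  open U <-> forall x : Y, U x -> exists s, forall y : Y, agree_on s (val x) (val y) -> U y.
Proof.
rewrite openE; split=> H x Ux; first by apply/nbhs_subconfig; exact: H.
by apply/nbhs_subconfig; exact: H.
Qed.

End Cylinders.

Section ContinuousToConfig.
Context (M : nmodType) (A : finType) (T : topologicalType) (f : T -> config M A).
Local Open Scope classical_set_scope.

Lemma continuous_to_config :
  (forall x i, nbhs x [set y | f y i = f x i]) -> continuous f.
Proof.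
move=> H x U /nbhs_config[s sU].
have xF : Filter (nbhs x) by exact: nbhs_filter.
have : nbhs x [set y | agree_on s (f x) (f y)].
  elim: s {sU} => [|i s IHs]; first by apply: filterS (@filterT _ _ xF) => y _ j.
  apply: filterS (filterI (H x i) IHs) => y [yi ys] j.
  by rewrite inE => /orP[/eqP->|/ys].
by apply: filterS => y /sU.
Qed.

End ContinuousToConfig.

Local Open Scope ring_scope.

(* What [nat] and [int] have in common: the last clause says that every finite
   set of coordinates lies in a window that shifts carry to any position. *)
Definition discrete_line (M : pzSemiRingType) : Prop :=
  [/\ forall i j k : M, i + k = j + k -> i = j,
      forall i : M, injective (fun n : nat => i + n%:R),
      forall i k : M, (exists n : nat, k = i + n%:R) \/ (exists n : nat, i = k + n%:R) &
      forall s : seq M, exists (i0 : M) (n : nat),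
        (forall k, k \in s -> exists2 j : nat, (j < n)%N & k = i0 + j%:R) /\
        forall i, exists m, i = i0 + m].

Section Line.
Context (M : pzSemiRingType) (lineM : discrete_line M).
Implicit Types (i k m : M) (n j : nat).

Definition offset i k : option nat :=
  match pselect (exists n, k = i + n%:R) with
  | left h => Some (sval (cid h))
  | right _ => None
  end.

Lemma offset_add i n : offset i (i + n%:R) = Some n.
Proof.
case: lineM => _ inj _ _; rewrite /offset; case: pselect => [h|[]]; last by exists n.
by case: cid => n' /= /inj ->.
Qed.

Lemma offset0 i : offset i i = Some 0%N.
Proof. by rewrite -{2}[i]addr0 (offset_add i 0). Qed.

Lemma offset_Some i k n : offset i k = Some n -> k = i + n%:R.
Proof. by rewrite /offset; case: pselect => // h [<-]; case: cid. Qed.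

Lemma offset_None i k : offset i k = None -> exists n, i = k + n.+1%:R.
Proof.
rewrite /offset; case: pselect => // H _; case: lineM => _ _ /(_ i k)[//|[[|n] ik]] _.
  by case: H; exists 0%N; rewrite ik !mulr0n !addr0.
by exists n.
Qed.

Lemma offsetS i k n : offset i k = Some n -> offset i (k + 1) = Some n.+1.
Proof. by move=> /offset_Some ->; rewrite -addrA natr1 offset_add. Qed.

Lemma offset_NoneS i k :
  offset i k = None -> offset i (k + 1) = None \/ i = k + 1.
Proof.
move=> ik; case E: (offset i (k + 1)) => [[|n]|]; [right|exfalso|by left].
  by move/offset_Some: E; rewrite mulr0n addr0.
move/offset_Some: E; rewrite -natr1 addrA; case: lineM => c _ _ _ /c E.
by rewrite E offset_add in ik.
Qed.

Lemma offset_shift i k m : offset (i + m) (k + m) = offset i k.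
Proof.
case E: (offset i k) => [n|].
  by rewrite (offset_Some E) addrAC offset_add.
case E': (offset _ _) => [n|] //; move/offset_Some: E'; rewrite addrAC.
by case: lineM => c _ _ _ /c E'; rewrite E' offset_add in E.
Qed.

Lemma line_const (P : M -> Prop) :
  (forall i, P i <-> P (i + 1)) -> forall i k, P i -> P k.
Proof.
move=> H.
have up i n : P i <-> P (i + n%:R).
  elim: n => [|n IHn]; first by rewrite mulr0n addr0.
  by rewrite -natr1 addrA -H.
move=> i k Pi; case: lineM => _ _ /(_ i k)[[n ->]|[n ik]] _; first exact: (up i n).1.
by apply: (up k n).2; rewrite -ik.
Qed.

Lemma natr2 n i : i + 1 + n%:R = i + n.+1%:R.
Proof. by rewrite -addrA -natr1 [1 + _]addrC. Qed.

Lemma word_atS (A : finType) (x : config M A) i n :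
  word_at x i n.+1 = x i :: word_at x (i + 1) n.
Proof.
rewrite /word_at /mkseq /= mulr0n addr0; congr (_ :: _).
rewrite -[1%N]/(1 + 0)%N iotaDl -map_comp; apply: eq_map => j /=.
by rewrite natr2.
Qed.

Lemma size_word_at (A : finType) (x : config M A) i n : size (word_at x i n) = n.
Proof. exact: size_mkseq. Qed.

Lemma nth_word_at (A : finType) (x : config M A) i n a j :
  (j < n)%N -> nth a (word_at x i n) j = x (i + j%:R).
Proof. exact: nth_mkseq. Qed.

End Line.

(** * Sofic shifts given by finite labelled graphs, and automata for their languages *)

Section GraphSets.
Local Open Scope classical_set_scope.
Context (M : pzSemiRingType) (lineM : discrete_line M) (A : finType).

Definition graph_path (Q : Type) (e : Q -> A -> Q -> bool) (p : M -> Q)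
  (x : config M A) : Prop := forall i, e (p i) (x i) (p (i + 1)).

Definition graph_set (Q : Type) (e : Q -> A -> Q -> bool) : set (config M A) :=
  [set x | exists p, graph_path e p x].

Definition graph_sofic (X : set (config M A)) : Prop :=
  exists (Q : finType) (e : Q -> A -> Q -> bool), X = graph_set e.

Section Sofic.
Context (Q : finType) (e : Q -> A -> Q -> bool).

Let B := (Q * A * Q)%type.

Let edge_shift : set (config M B) :=
  [set y | forall i, e (y i).1.1 (y i).1.2 (y i).2 /\ (y i).2 = (y (i + 1)).1.1].

Let label (y : config M B) : config M A := fun i => (y i).1.2.

Lemma label_edge_shift : label @` edge_shift = graph_set e.
Proof.
apply/seteqP; split=> x.
  by move=> [y yE <-]; exists (fun i => (y i).1.1) => i /=; have [? <-] := yE i.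
by move=> [p px]; exists (fun i => (p i, x i, p (i + 1))) => // i; split=> //=; exact: px.
Qed.

Lemma sft_edge_shift : sft edge_shift.
Proof.
exists ([seq [:: t] | t <- enum {: B} & ~~ e t.1.1 t.1.2 t.2] ++
  [seq [:: t.1; t.2] | t <- enum {: B * B} & t.1.2 != t.2.1.1]).
apply/seteqP; split=> y yE.
  move=> i w; rewrite mem_cat => /orP[] /mapP[/= t].
    rewrite mem_filter => /andP[et _] -> [yt]; move: et.
    by rewrite -yt mulr0n addr0; have [->] := yE i.
  rewrite mem_filter => /andP[et _] -> [yt yt']; move: et.
  by rewrite -yt -yt' mulr0n addr0; have [_ ->] := yE i; rewrite eqxx.
move=> i; split.
  apply/negPn/negP => ne; apply: (yE i [:: y i]).
    rewrite mem_cat; apply/orP; left; apply/mapP; exists (y i) => //.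
    by rewrite mem_filter ne mem_enum.
  by rewrite word_atS.
apply/eqP/negPn/negP => ne; apply: (yE i [:: y i; y (i + 1)]).
  rewrite mem_cat; apply/orP; right; apply/mapP; exists (y i, y (i + 1)) => //.
  by rewrite mem_filter ne mem_enum.
by rewrite !word_atS.
Qed.

Lemma label_continuous : continuous label.
Proof.
apply: continuous_to_config => y i; apply/nbhs_config; exists [:: i] => z zy.
by rewrite /= /label zy // inE.
Qed.

Lemma graph_set_subshift : subshift (graph_set e).
Proof.
split; last first.
  by move=> m x [p px]; exists (fun i => p (i + m)) => i; have := px (i + m); rewrite addrAC.
rewrite -label_edge_shift; apply: compact_closed; first exact: config_hausdorff.
apply: continuous_compact.
  by apply: continuous_subspaceT => y; exact: label_continuous.
apply: config_compact; apply: closed_config => y H i.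
have [z zE zy] := H [:: i; i + 1].
by rewrite -!zy ?inE ?eqxx ?orbT //; exact: zE.
Qed.

Lemma graph_set_sofic : sofic (graph_set e).
Proof.
split; first exact: graph_set_subshift.
exists B, edge_shift, (label \o set_val); split.
- exact: sft_edge_shift.
- by move=> y; apply: continuous_comp; [exact: initial_continuous|exact: label_continuous].
- by move=> m x y xy; rewrite /= /set_val /= xy.
rewrite -label_edge_shift; apply/seteqP; split=> x.
  by move=> [y _ <-] /=; exists (val y) => //; exact: set_valP.
by move=> [y yE <-]; exists (exist _ y (mem_set yE)).
Qed.

Definition live (q : Q) : Prop := exists p x i, graph_path e p x /\ p i = q.

(** Only the two end states of a run have to be live: a path through the first supplies a past and a
    path through the last a future, which together extend the run to a point of the shift. *)
Definition graph_nfa : nfa A :=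
  Nfa [seq (enum_rank q : nat) | q <- enum Q & `[< live q >]]
      [seq (enum_rank q : nat) | q <- enum Q & `[< live q >]]
      [seq (enum_rank t.1.1 : nat, t.1.2, enum_rank t.2 : nat)
        | t <- enum {: B} & e t.1.1 t.1.2 t.2].

Fixpoint graph_run (q : Q) (w : seq A) (q' : Q) : Prop :=
  if w is a :: w' then exists2 q1, e q a q1 & graph_run q1 w' q' else q = q'.

Lemma mem_live q : (enum_rank q : nat) \in
  [seq (enum_rank q : nat) | q <- enum Q & `[< live q >]] <-> live q.
Proof.
split=> [/mapP[q' + /val_inj/enum_rank_inj ->]|lq].
  by rewrite mem_filter => /andP[/asboolP].
by apply: map_f; rewrite mem_filter mem_enum andbT; apply/asboolP.
Qed.

Lemma graph_nfa_accept q w :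
  nfa_accept_from graph_nfa (enum_rank q) w <-> exists2 q', live q' & graph_run q w q'.
Proof.
elim: w q => [|a w IHw] q.
  split=> [/= /mem_live|[q' lq' /= ->]]; first by exists q.
  exact/mem_live.
split=> [/hasP[t /mapP[b]]|[q' lq' [q1 ea rq]]].
  rewrite mem_filter => /andP[eb _] -> /= /andP[/eqP[/val_inj/enum_rank_inj bq ba]].
  move=> /IHw[q' lq' rq]; exists q' => //; exists b.2 => //.
  by rewrite -bq -ba.
apply/hasP; exists (enum_rank q : nat, a, enum_rank q1 : nat).
  by apply: (map_f _ (x := (q, a, q1))); rewrite mem_filter ea mem_enum.
by rewrite /= eqxx; apply/IHw; exists q'.
Qed.

Lemma graph_path_run p x i n :
  graph_path e p x -> graph_run (p i) (word_at x i n) (p (i + n%:R)).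
Proof.
move=> px; elim: n i => [|n IHn] i; first by rewrite mulr0n addr0.
by rewrite word_atS; exists (p (i + 1)) => //; rewrite -natr2; exact: IHn.
Qed.

Lemma graph_run_seq q w q' : graph_run q w q' -> exists r : nat -> Q,
  [/\ r 0%N = q, r (size w) = q' &
      forall j a, (j < size w)%N -> e (r j) (nth a w j) (r j.+1)].
Proof.
elim: w q => [|b w IHw] q /=; first by move=> <-; exists (fun=> q).
move=> [q1 eb /IHw[r [r0 rn rP]]]; exists (fun j => if j is j'.+1 then r j' else q).
by split=> // -[|j] a /=; [rewrite r0|exact: rP].
Qed.

(** The path follows the first live path up to its visit of [q], then the run, then the second live
    path from its visit of [q']. Keeping the position [i1] of the first path makes this work over
    [nat], where the past is finite. *)
Lemma live_glue q w q' : live q -> live q' -> graph_run q w q' ->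
  exists p x i, [/\ graph_path e p x, word_at x i (size w) = w, p i = q &
    p (i + (size w)%:R) = q'].
Proof.
move=> [p1 [x1 [i1 [px1 pq]]]] [p2 [x2 [i2 [px2 pq']]]].
move=> /graph_run_seq[r [r0 rn rP]].
pose n := size w.
pose p k := match offset i1 k with
  | None => p1 k
  | Some j => if (j < n)%N then r j else p2 (i2 + (j - n)%:R) end.
pose x k := match offset i1 k with
  | None => x1 k
  | Some j => if (j < n)%N then nth (x1 k) w j else x2 (i2 + (j - n)%:R) end.
exists p, x, i1.
have pn j : (j <= n)%N -> p (i1 + j%:R) = r j.
  rewrite leq_eqVlt /p offset_add // => /orP[/eqP->|->] //.
  by rewrite ltnn subnn mulr0n addr0 pq'.
split.
- move=> k; rewrite /x; case E: (offset i1 k) => [j|]; last first.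
    have [E'|E'] := offset_NoneS lineM E; first by rewrite /p E E'.
    rewrite {1}/p E -E'; have := pn 0%N (leq0n _); rewrite mulr0n addr0 => ->.
    by rewrite r0 -pq E'; exact: px1.
  rewrite (offset_Some E) -addrA natr1; case: ltnP => jn.
    by rewrite !pn ?(ltnW jn) //; exact: rP.
  rewrite /p !offset_add // ltnNge jn /= ltnNge (leqW jn) /= subSn //.
  by rewrite -natr1 addrA; exact: px2.
- apply: (@eq_from_nth _ (x1 i1)); first by rewrite size_word_at.
  move=> j; rewrite size_word_at => jn; rewrite nth_word_at // /x offset_add // jn.
  exact: set_nth_default.
- by have := pn 0%N (leq0n _); rewrite mulr0n addr0 => ->.
- by rewrite pn.
Qed.

Lemma graph_nfa_language : nfa_language graph_nfa = language (graph_set e).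
Proof.
apply/seteqP; split=> w.
  move=> /hasP[_ /mapP[q + ->]]; rewrite mem_filter => /andP[/asboolP lq _].
  move=> /graph_nfa_accept[q' lq' /(live_glue lq lq')[p [x [i [px wx _ _]]]]].
  by exists x, i; split=> //; exists p.
move=> [x [i [[p px] wx]]]; apply/hasP; exists (enum_rank (p i) : nat).
  by apply/mem_live; exists p, x, i.
apply/graph_nfa_accept; exists (p (i + (size w)%:R)).
  by exists p, x, (i + (size w)%:R).
by rewrite -{1}wx; exact: graph_path_run.
Qed.

End Sofic.

Lemma graph_sofic_sofic X : graph_sofic X -> sofic X.
Proof. by move=> [Q [e ->]]; exact: graph_set_sofic. Qed.

Lemma graph_sofic_nfa X :
  graph_sofic X -> exists N : nfa A, nfa_language N = language X.
Proof. by move=> [Q [e ->]]; exists (graph_nfa e); exact: graph_nfa_language. Qed.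

Lemma graph_soficU X Y : graph_sofic X -> graph_sofic Y -> graph_sofic (X `|` Y).
Proof.
move=> [Q1 [e1 ->]] [Q2 [e2 ->]].
pose e (q : Q1 + Q2) a (q' : Q1 + Q2) := match q, q' with
  | inl q, inl q' => e1 q a q' | inr q, inr q' => e2 q a q' | _, _ => false end.
exists (Q1 + Q2)%type, e; apply/seteqP; split=> x.
  by move=> [[p px]|[p px]]; [exists (inl \o p)|exists (inr \o p)].
move=> [p px].
have side i : (exists q, p i = inl q) <-> (exists q, p (i + 1) = inl q).
  have := px i; case: (p i) (p (i + 1)) => [q1|q1] [q2|q2] //= _.
    by split=> _; [exists q2|exists q1].
  by split=> -[].
case E: (p 0) => [q|q].
  have /choice[f fP] : forall i, exists q, p i = inl q.
    by move=> i; apply: (line_const lineM side (i := 0)); exists q.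
  by left; exists f => i; have := px i; rewrite !fP.
have /choice[f fP] : forall i, exists q, p i = inr q.
  move=> i; case Ei: (p i) => [q'|q']; last by exists q'.
  have [] : exists q, p 0 = inl q by apply: (line_const lineM side (i := i)); exists q'.
  by rewrite E.
by right; exists f => i; have := px i; rewrite !fP.
Qed.

(** The form in which the sofic sets below are specified: one global choice [t], a hidden sequence
    [z], and a condition on neighbouring positions. A state remembers [t] and the current pair of
    letters. *)
Lemma graph_sofic_nn (T B : finType) (r : T -> A -> B -> A -> B -> bool) :
  graph_sofic [set x | exists t (z : M -> B),
    forall i, r t (x i) (z i) (x (i + 1)) (z (i + 1))].
Proof.
pose e (q : T * A * B) a (q' : T * A * B) :=
  [&& q.1.2 == a, q'.1.1 == q.1.1 & r q.1.1 a q.2 q'.1.2 q'.2].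
exists (T * A * B)%type, e; apply/seteqP; split=> x.
  by move=> [t [z xz]]; exists (fun i => (t, x i, z i)) => i; rewrite /e /= !eqxx xz.
move=> [p px]; exists (p 0).1.1, (fun i => (p i).2) => i.
have pt : (p i).1.1 = (p 0).1.1.
  apply: (line_const lineM (P := fun i => (p i).1.1 = (p 0).1.1) _ (i := 0)) => // k.
  by have /and3P[_ /eqP <- _] := px k.
have /and3P[/eqP xi _] := px i; have /and3P[/eqP xi1 _ _] := px (i + 1).
by rewrite xi1 pt.
Qed.

Lemma languageU (X Y : set (config M A)) :
  language (X `|` Y) = language X `|` language Y.
Proof.
apply/seteqP; split=> w; first by move=> [x [i [[Xx|Yx] wx]]]; [left|right]; exists x, i.
by move=> [|] [x [i [Xx wx]]]; exists x, i; split=> //; [left|right].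
Qed.

Lemma subshift_language_inj (X Y : set (config M A)) :
  subshift X -> subshift Y -> language X = language Y -> X = Y.
Proof.
wlog suff sub : X Y / subshift X -> subshift Y -> language X = language Y -> X `<=` Y.
  by move=> sX sY L; apply/seteqP; split; apply: sub.
move=> [cX sX] [cY sY] L x Xx; apply: (closed_configP cY) => s.
(* The word may occur in [y] at another place than in [x]. The window is chosen so that a shift can
   bring any occurrence back to its left end [i0]; over [nat] this forces windows to start at 0. *)
case: lineM => canc _ _ /(_ s)[i0 [n [sn trans]]].
have : language Y (word_at x i0 n).
  by rewrite -L; exists x, i0; rewrite size_word_at.
move=> [y [i [Yy]]]; rewrite size_word_at => yx.
have [m im] := trans i; exists (shift_by m y); first exact: sY.
move=> k /sn[j jn ->]; rewrite /shift_by.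
have := congr1 (fun w => nth (x 0) w j) yx; rewrite !nth_word_at // => <-.
by rewrite im addrAC.
Qed.

End GraphSets.

Lemma nat_line : discrete_line nat.
Proof.
split=> [i j k|i j k|i k|s].
- exact: addIn.
- by rewrite !natn => /addnI.
- by case: (leqP i k) => ik; [left; exists (k - i)%N|right; exists (i - k)%N];
    rewrite natn; [rewrite -[LHS](subnKC ik)|rewrite -[LHS](subnKC (ltnW ik))].
exists 0%N, (\sum_(k <- s) k).+1; split=> [k ks|i]; last by exists i; rewrite add0r.
exists k; last by rewrite natn add0r.
by rewrite ltnS (big_rem k ks) /= leq_addr.
Qed.

Lemma int_line : discrete_line int.
Proof.
split=> [i j k|i j k|i k|s].
- exact: addIr.
- by move=> /addrI; rewrite !natz => -[].
- have [ik|ik] : (i <= k)%R \/ (k <= i)%R by lia.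
    by left; exists `|k - i|%N; rewrite natz; lia.
  by right; exists `|i - k|%N; rewrite natz; lia.
pose m := (\sum_(k <- s) `|k|)%N.
exists (- m%:Z), (2 * m).+1; split=> [k ks|i]; last by exists (i + m%:Z); lia.
have km : (`|k| <= m)%N by rewrite /m (big_rem k ks) /= leq_addr.
by exists (absz (k + m%:Z)); [lia|rewrite natz; lia].
Qed.

Local Close Scope ring_scope.

(** * Marked points *)

Section Letters.
Context (T : machine).

(* [None] is the blank left of the marker. Every other letter carries the
   marker (if any), one bit of each register and one digit of the position on
   the arc, where the digit [None] only occurs in the decorations. *)
Definition letter : finType :=
  option (option (mstate T * bool) * {ffun 'I_(mregs T) -> bool} * option bool)%type.

Definition mark (l : letter) : option (mstate T * bool) :=
  if l is Some (m, _, _) then m else None.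

Definition data (l : letter) : {ffun 'I_(mregs T) -> bool} :=
  if l is Some (_, d, _) then d else [ffun=> false].

Definition digit (l : letter) : option bool :=
  if l is Some (_, _, s) then s else Some false.

(** Left of a marked letter there are only blanks and right of it only unmarked nonblank letters, so
    there is at most one marker. *)
Definition shape_rel (l l' : letter) : bool :=
  if l is None then (l' == None) || (mark l' != None)
  else (l' != None) && (mark l' == None).

Definition base_rel (l l' : letter) : bool :=
  [&& shape_rel l l', digit l != None, digit l' != None &
    (l != None) ==> [forall k, data l' k ==> data l k]].

Definition halt_letter (e : bool) : letter :=
  Some (Some (mhalt T, e), [ffun=> false], Some false).
Definition zero_letter : letter := Some (None, [ffun=> false], Some false).
Definition star_letter : letter := Some (None, [ffun=> false], None).
Definition one_letter : letter := Some (None, [ffun k => k == minput T], Some false).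
Definition start_letter : letter :=
  Some (Some (mstart T, false), [ffun k => k == minput T], Some false).

(** Describes the isolated points near the halting configuration of copy [e]: digits that are 0 for
    a while and then stars for ever. The more zeros, the closer the point is to the start of the
    arc. *)
Definition halt_rel (e : bool) (l l' : letter) : bool :=
  (l, l') \in [:: (None, None); (None, halt_letter e); (halt_letter e, zero_letter);
    (halt_letter e, star_letter); (zero_letter, zero_letter);
    (zero_letter, star_letter); (star_letter, star_letter)].

(* State 0 is left of the marker, state 1 right of the first star, and state
   [j.+2] is followed by [j] ones. *)
Definition chain_edge (m : nat) (q : nat) (l : letter) (q' : nat) : bool :=
  [|| [&& q == 0, l == None & q' == 0],
      [&& q == 0, l == start_letter & q' == m.+2],
      [&& 2 < q, l == one_letter & q == q'.+1],
      [&& q == 2, l == zero_letter & q' == 2],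
      [&& q == 2, l == star_letter & q' == 1] |
      [&& q == 1, l == star_letter & q' == 1]].

(** One guess [t] per sequence certifies a point at infinity: either a register whose bits are all
    1, or [None] for the absence of a marker. *)
Definition inf_ok (t : option 'I_(mregs T)) (l : letter) : bool :=
  if t is Some r then (l == None) || data l r else mark l == None.

(** The last test excludes digit 1 against digit 0 at the marker. Elsewhere [dyadic_rel] traces such
    a pair back to the preceding letter, which at the marker is blank. *)
Definition dyadic_ok (l c : letter) : bool :=
  match l, c with
  | None, None => true
  | Some (m, d, Some s), Some (m', d', Some s') =>
      [&& m == m', d == d' & s ==> ~~ s' ==> (m == None)]
  | _, _ => false
  end.

(** A digit 1 stands against 0 exactly where the preceding digits already differ. So the first
    difference, if any, is 0 against 1, and all later positions show 1 against 0: the two expansions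
    of a dyadic point. *)
Definition dyadic_rel (l c l' c' : letter) : bool :=
  [&& dyadic_ok l c, dyadic_ok l' c' &
    (l != None) ==> (l' != None) ==>
      ((digit l != digit c) == ((digit l' == Some true) && (digit c' == Some false)))].

Definition step_ok (op : option ('I_(mregs T) * bool)) (l c : letter) : bool :=
  match l, c with
  | None, None => true
  | Some (m, d, s), Some (m', d', s') =>
      [&& s == Some true, s' == Some false,
          match m, m' with
          | None, None => true
          | Some (q, e), Some (q', e') =>
              [&& e == e', mact q d == Some (q', op) &
                if op is Some (r, true) then d' r else true]
          | _, _ => false
          end &
          [forall k, (omap fst op != Some k) ==> (d k == d' k)]]
  | _, _ => false
  end.

(** A push moves the track of [r] one letter to the right and a pop one letter to the left, hence
    the comparison of neighbours. The new bit which a push creates at the marker is tested in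
    [step_ok]. *)
Definition step_rel (op : option ('I_(mregs T) * bool)) (l c l' c' : letter) : bool :=
  [&& step_ok op l c, step_ok op l' c' &
    (l != None) ==> (l' != None) ==>
      match op with
      | None => true
      | Some (r, true) => data c' r == data l r
      | Some (r, false) => data c r == data l' r
      end].

(** [None] stands for equality, [Some None] for the two expansions of a dyadic point, and
    [Some (Some op)] for a machine step with register operation [op]. The operation is chosen once
    for the whole sequence, because it is determined at the marker but acts along a whole track. *)
Definition glue_kind : finType := option (option (option ('I_(mregs T) * bool))).

Definition glue_rel (t : glue_kind) (l c l' c' : letter) : bool :=
  match t with
  | None => l == c
  | Some None => dyadic_rel l c l' c'
  | Some (Some op) => step_rel op l c l' c'
  end.

Definition alphabet : finType := 'I_#|letter|.

End Letters.

Section Points.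
Local Open Scope classical_set_scope.
Local Open Scope ring_scope.
Context (M : pzSemiRingType) (lineM : discrete_line M) (T : machine).

Notation A := (alphabet T).
Notation digits := (nat -> option bool).
Implicit Types (x y z : config M A) (i k : M) (c e : bool) (v : mconfig T) (s : digits).

Definition at_ x k : letter T := enum_val (x k).

Definition point i c v s : config M A := fun k =>
  enum_rank (match offset i k with
    | None => None
    | Some j => Some (if j == 0%N then Some (v.1, c) else None, v.2 j, s j)
    end : letter T).

Lemma at_point_add i c v s (j : nat) :
  at_ (point i c v s) (i + j%:R) =
    Some (if j == 0%N then Some (v.1, c) else None, v.2 j, s j).
Proof. by rewrite /at_ /point offset_add // enum_rankK. Qed.

Lemma at_point0 i c v s : at_ (point i c v s) i = Some (Some (v.1, c), v.2 0%N, s 0%N).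
Proof. by have := at_point_add i c v s 0; rewrite mulr0n addr0. Qed.

Lemma at_point_None i c v s k : offset i k = None -> at_ (point i c v s) k = None.
Proof. by rewrite /at_ /point enum_rankK => ->. Qed.

Lemma at_point i c v s k : at_ (point i c v s) k =
  if offset i k is Some j then Some (if j == 0%N then Some (v.1, c) else None, v.2 j, s j)
  else None.
Proof. by rewrite /at_ /point enum_rankK. Qed.

Lemma at_inj x y : (forall k, at_ x k = at_ y k) -> x = y.
Proof. by move=> H; apply/funext => k; exact: enum_val_inj (H k). Qed.

Lemma mark_point i c v s k : mark (at_ (point i c v s) k) =
  if offset i k == Some 0%N then Some (v.1, c) else None.
Proof. by rewrite at_point; case: (offset i k) => [[|j]|]. Qed.

Lemma point_inj i c v s i' c' v' s' :
  point i c v s = point i' c' v' s' -> [/\ i = i', c = c', v = v' & s = s'].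
Proof.
move=> E; have ii' : i = i'.
  have := mark_point i c v s i; rewrite E mark_point offset0 //.
  by case: eqP => // /offset_Some -> _; rewrite mulr0n addr0.
have H j : at_ (point i c v s) (i + j%:R) = at_ (point i c' v' s') (i + j%:R) by rewrite E ii'.
split=> //.
- by have := H 0%N; rewrite !at_point_add /= => -[].
- have := H 0%N; rewrite !at_point_add /= => -[vv _ _ _].
  case: v v' vv H {E} => [q d] [q' d'] /= -> H; congr (_, _); apply/funext => j.
  by have := H j; rewrite !at_point_add => -[_ ->].
- by apply/funext => j; have := H j; rewrite !at_point_add => -[_ _ ->].
Qed.

Definition no_mark x : Prop := forall k, mark (at_ x k) = None.

Lemma point_mark i c v s : ~ no_mark (point i c v s).
Proof. by move=> /(_ i); rewrite at_point0. Qed.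

(** From the marker, [shape_rel] propagates unmarked nonblank letters to the right and blanks to the
    left. *)
Lemma shape_point x : (forall k, shape_rel (at_ x k) (at_ x (k + 1))) ->
  no_mark x \/ exists i c q, mark (at_ x i) = Some (q, c) /\
    x = point i c (q, fun j => data (at_ x (i + j%:R))) (fun j => digit (at_ x (i + j%:R))).
Proof.
move=> H; have [nm|] := pselect (no_mark x); first by left.
move=> /existsNP[i mi]; right; case E: (mark (at_ x i)) => [[q c]|] //.
exists i, c, q; split=> //; apply: at_inj => k; rewrite at_point.
case Ek: (offset i k) => [j|].
  rewrite (offset_Some Ek); case: j {Ek} => [|j] /=.
    by rewrite mulr0n addr0; case: (at_ x i) E => [[[m d] s]|] //= ->.
  have : forall j : nat, exists d u, at_ x (i + j.+1%:R) = Some (None, d, u).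
    elim=> [|n [d [u nu]]].
      have := H i; rewrite mulr1n; case: (at_ x i) E => [[[m d] u]|] //= _.
      by case: (at_ x (i + 1)) => [[[[?|] d'] u']|] //= _; exists d', u'.
    have := H (i + n.+1%:R); rewrite nu -addrA natr1.
    by case: (at_ x _) => [[[[?|] d'] u']|] //= _; exists d', u'.
  by move=> /(_ j)[d [u ->]].
have [n ik] := offset_None lineM Ek.
have back k' : (at_ x (k' + 1) = None \/ mark (at_ x (k' + 1)) != None) -> at_ x k' = None.
  by have := H k'; case: (at_ x k') => // l /= /andP[nN mN] [E'|]; rewrite ?E' ?mN in nN *.
have {Ek} : at_ x (k + n.+1%:R) = None \/ mark (at_ x (k + n.+1%:R)) != None.
  by right; rewrite -ik E.
elim: n k {ik} => [|n IHn] k; first by rewrite mulr1n => /back.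
by rewrite -natr2 => /IHn kN; apply: back; left.
Qed.

Definition mono v : Prop := forall j r, v.2 j.+1 r -> v.2 j r.

Definition binary s : Prop := forall j, s j != None.

Definition stars (n : nat) : digits := fun j => if (j < n)%N then Some false else None.

Definition zeros : digits := fun=> Some false.
Definition ones : digits := fun=> Some true.

Definition base_set : set (config M A) :=
  [set x | forall k, base_rel (at_ x k) (at_ x (k + 1))].
Definition halt_set e : set (config M A) :=
  [set x | forall k, halt_rel e (at_ x k) (at_ x (k + 1))].
Definition chain_set (m : nat) : set (config M A) :=
  [set x | exists p : M -> 'I_m.+3, forall k, chain_edge m (p k) (at_ x k) (p (k + 1))].

Definition fixed_set e : set (config M A) := no_mark `|` (base_set `|` halt_set e).
Definition space_set (m : nat) e : set (config M A) := fixed_set e `|` chain_set m.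

Lemma graph_sofic_letters (r : rel (letter T)) :
  graph_sofic [set x : config M A | forall k, r (at_ x k) (at_ x (k + 1))].
Proof.
have := @graph_sofic_nn M lineM A unit unit
  (fun _ a _ a' _ => r (enum_val a) (enum_val a')).
congr (graph_sofic _); apply/seteqP; split=> x; first by move=> [_ [_]].
by move=> H; exists tt, (fun=> tt).
Qed.

Lemma fixed_set_sofic e : graph_sofic (fixed_set e).
Proof.
apply: graph_soficU => //; last by apply: graph_soficU => //; exact: graph_sofic_letters.
have := graph_sofic_letters (fun l _ => mark l == None).
by congr (graph_sofic _); apply/seteqP; split=> x H k; apply/eqP; exact: H.
Qed.

Lemma chain_set_sofic m : graph_sofic (chain_set m).
Proof.
by exists 'I_m.+3,
  (fun (q : 'I_m.+3) (a : A) (q' : 'I_m.+3) => chain_edge m q (enum_val a) q').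
Qed.

Lemma space_set_sofic m e : graph_sofic (space_set m e).
Proof. by apply: graph_soficU => //; [exact: fixed_set_sofic|exact: chain_set_sofic]. Qed.

Lemma stars_or_zeros s : s 0%N = Some false ->
  (forall j, s j = Some false \/ s j = None) -> (forall j, s j = None -> s j.+1 = None) ->
  binary s \/ exists2 n, (0 < n)%N & s = stars n.
Proof.
move=> s0 sb sN; have [bs|] := pselect (binary s); first by left.
move=> /existsNP[j /negP]; rewrite negbK => sj; right.
have ex : exists j, s j == None by exists j.
case: (ex_minnP ex) => n sn minn; exists n.
  by rewrite lt0n; apply: contraTneq sn => ->; rewrite s0.
apply/funext => k; rewrite /stars; case: ltnP => kn.
  by case: (sb k) => // /eqP /minn; rewrite leqNgt kn.
by rewrite -(subnKC kn); elim: (k - n)%N => [|l IHl]; rewrite ?addn0 ?addnS ?(eqP sn) ?sN.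
Qed.

Lemma base_set_point x : base_set x -> no_mark x \/ exists i c v s,
  [/\ x = point i c v s, mono v & binary s].
Proof.
move=> xb; have [|nm|[i [c [q [qi xE]]]]] := @shape_point x; [|by left|right].
  by move=> k; have /and4P[] := xb k.
do 4 eexists; split; [exact: xE| |] => j; last by have /and4P[] := xb (i + j%:R).
move=> r /=; rewrite -natr1 addrA => djr.
have /and4P[_ _ _] := xb (i + j%:R).
have -> /= : at_ x (i + j%:R) != None by rewrite xE at_point_add.
by move=> /forallP/(_ r)/implyP; apply.
Qed.

Lemma halt_relP e (l l' : letter T) : halt_rel e l l' ->
  [/\ shape_rel l l', data l = [ffun=> false], digit l = Some false \/ digit l = None,
    digit l = None -> digit l' = None &
    mark l != None -> mark l = Some (mhalt T, e) /\ digit l = Some false].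
Proof.
rewrite /halt_rel !inE.
do 6?[case/orP]; move=> /eqP[-> ->].
all: by split=> //; first [by left|by right|by split].
Qed.

Lemma halt_set_point e x : halt_set e x -> no_mark x \/ exists i s,
  x = point i e (mfinal T) s /\ (binary s \/ exists2 n, (0 < n)%N & s = stars n).
Proof.
move=> xh; have [|nm|[i [c [q [qi xE]]]]] := @shape_point x; [|by left|right].
  by move=> k; have [] := halt_relP (xh k).
have [_ _ _ _ ] := halt_relP (xh i); rewrite qi => /(_ isT)[[qE cE] d0].
exists i, (fun j => digit (at_ x (i + j%:R))); split.
  rewrite [LHS]xE qE cE /mfinal; congr (point _ _ (_, _) _); apply/funext => j.
  by have [] := halt_relP (xh (i + j%:R)).
apply: stars_or_zeros => [|j|j]; first by rewrite mulr0n addr0.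
  by have [] := halt_relP (xh (i + j%:R)).
by have [_ _ _ + _] := halt_relP (xh (i + j%:R)); rewrite -addrA natr1.
Qed.

Lemma chain_edgeP m q (l : letter T) q' : chain_edge m q l q' ->
  [\/ q = 0%N /\ (l = None /\ q' = 0%N \/ l = start_letter T /\ q' = m.+2),
     [/\ (2 < q)%N, l = one_letter T & q = q'.+1],
     q = 2%N /\ (l = zero_letter T /\ q' = 2%N \/ l = star_letter T /\ q' = 1%N) |
     [/\ q = 1%N, l = star_letter T & q' = 1%N] ].
Proof.
rewrite /chain_edge.
move=> /orP[/and3P[/eqP-> /eqP-> /eqP->]|]; first by constructor 1; split=> //; left.
move=> /orP[/and3P[/eqP-> /eqP-> /eqP->]|]; first by constructor 1; split=> //; right.
move=> /orP[/and3P[q2 /eqP-> /eqP qq']|]; first by constructor 2.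
move=> /orP[/and3P[/eqP-> /eqP-> /eqP->]|]; first by constructor 3; split=> //; left.
move=> /orP[/and3P[/eqP-> /eqP-> /eqP->]|]; first by constructor 3; split=> //; right.
by move=> /and3P[/eqP-> /eqP-> /eqP->]; constructor 4.
Qed.

Lemma chain_edge2 m q (l : letter T) q' l' q'' :
  chain_edge m q l q' -> chain_edge m q' l' q'' ->
  [/\ shape_rel l l', digit l = Some false \/ digit l = None,
    digit l = None -> digit l' = None &
    mark l != None -> [/\ l = start_letter T & q' = m.+2] ].
Proof.
move=> /chain_edgeP[[_ [[-> q'0]|[-> q'm]]]|[q2 -> qq']|[_ [[-> q'2]|[-> q'1]]]|[_ -> q'1]].
all: move=> /chain_edgeP[[q'E [[-> _]|[-> _]]]|[q'E -> _]|[q'E [[-> _]|[-> _]]]|[q'E -> _]].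
all: try lia.
all: by split=> //; first [by left|by right|by split].
Qed.

Lemma chain_set_point m x : chain_set m x -> no_mark x \/ exists i s,
  x = point i false (minit T m.+1) s /\ (binary s \/ exists2 n, (0 < n)%N & s = stars n).
Proof.
move=> [p xp]; have x2 k := chain_edge2 (xp k) (xp (k + 1)).
have [|nm|[i [c [q [qi xE]]]]] := @shape_point x; [|by left|right].
  by move=> k; have [] := x2 k.
have [_ _ _] := x2 i; rewrite qi => /(_ isT)[xi pi1].
have pj j : (j <= m)%N -> p (i + j.+1%:R) = (m.+2 - j)%N :> nat.
  elim: j => [|j IHj] jm; first by rewrite mulr1n pi1 subn0.
  have := chain_edgeP (xp (i + j.+1%:R)); rewrite IHj ?(ltnW jm) // -addrA natr1.
  case=> [[q0 _]|[_ _ E]|[q0 _]|[q0 _]]; try lia.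
  by apply: succn_inj; rewrite -E; lia.
have data0 j : (m <= j)%N -> data (at_ x (i + j.+1%:R)) = [ffun=> false] /\
    (p (i + j.+1%:R) == 1%N :> nat) || (p (i + j.+1%:R) == 2%N :> nat).
  move=> mj; have {mj} : (p (i + j.+1%:R) == 1%N :> nat) || (p (i + j.+1%:R) == 2%N :> nat).
    rewrite -(subnKC mj); elim: (j - m)%N => [|n IHn].
      by rewrite addn0 pj // subSn ?leqnSn // subSnn orbT.
    have := chain_edgeP (xp (i + (m + n).+1%:R)); rewrite -addrA natr1 addnS.
    by case: IHn => /orP[]/eqP ->; case=> [[]|[]|[_ [[_ ->]|[_ ->]]]|[_ _ ->]]; rewrite ?orbT.
  have := chain_edgeP (xp (i + j.+1%:R)).
  by case=> [[->]|[+ _ _]|[-> [[-> _]|[-> _]]]|[-> -> _]] //; case: (p _ : nat) => [|[|[|]]].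
exists i, (fun j => digit (at_ x (i + j%:R))); split.
  rewrite [LHS]xE; move: qi; rewrite xi /= => -[<- <-].
  rewrite /minit; congr (point _ _ (_, _) _); apply/funext => -[|j].
    by rewrite mulr0n addr0 xi /=; apply/ffunP => k; rewrite !ffunE andbT.
  case: (ltnP j m) => jm; last first.
    have [-> _] := data0 j jm; apply/ffunP => k; rewrite !ffunE ltnS.
    by rewrite ltnNge jm andbF.
  have := chain_edgeP (xp (i + j.+1%:R)); rewrite (pj j (ltnW jm)).
  case=> [[]|[_ -> _]|[]|[]]; try lia.
  by apply/ffunP => k; rewrite !ffunE ltnS jm andbT.
apply: stars_or_zeros => [|j|j]; first by rewrite mulr0n addr0 xi.
  by have [] := x2 (i + j%:R).
by have [_ _ + _] := x2 (i + j%:R); rewrite -addrA natr1.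
Qed.

Lemma point_base i c v s : mono v -> binary s -> base_set (point i c v s).
Proof.
move=> mv bs k; rewrite !at_point; case E: (offset i k) => [j|].
  rewrite (offsetS lineM E) /base_rel /= bs bs /=.
  by apply/forallP => r; apply/implyP; exact: mv.
have [->|->] := offset_NoneS lineM E; first by [].
by rewrite offset0 // /base_rel /= bs.
Qed.

Lemma point_halt_stars i e n : (0 < n)%N -> halt_set e (point i e (mfinal T) (stars n)).
Proof.
move=> n0 k; rewrite !at_point; case E: (offset i k) => [j|].
  rewrite (offsetS lineM E) /halt_rel !inE /=.
  case: j E => [|j] _ /=; rewrite /stars; first by rewrite n0; case: ifP; rewrite eqxx ?orbT.
  case: (ltnP j.+1 n) => jn; last by rewrite ltnNge (leqW jn) /= eqxx ?orbT.
  by case: ifP => _; rewrite eqxx ?orbT.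
have [->|->] := offset_NoneS lineM E; first by rewrite /halt_rel !inE eqxx.
rewrite offset0 // /stars n0 /halt_rel !inE; apply/orP; right; apply/orP; left; exact: eqxx.
Qed.

Lemma point_chain_stars i m n : (m < n)%N ->
  chain_set m (point i false (minit T m.+1) (stars n)).
Proof.
move=> mn.
(* The state in which the letter at distance [j.+1] from the marker is read. The marker itself
   carries the first of the [m.+1] ones, [m] more follow, and state 2 is reached at distance [m.+1];
   stars cannot begin earlier, whence [m < n]. *)
pose st (o : option nat) : nat := if o is Some j.+1
  then (if j <= m then m.+2 - j else if j < n then 2 else 1)%N else 0%N.
have stm o : (st o < m.+3)%N.
  by case: o => [[|j]|] //=; do !case: ifP => // _; rewrite ltnS leq_subr.
exists (fun k => Ordinal (stm (offset i k))) => k; rewrite at_point /=.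
case E: (offset i k) => [[|j]|].
- rewrite (offsetS lineM E) /= /stars (leq_ltn_trans (leq0n m) mn) subn0.
  have -> : (Some (Some (mstart T, false), [ffun k => (k == minput T) && (0 < m.+1)%N],
      Some false) : letter T) = start_letter T.
    by congr (Some (_, _, _)); apply/ffunP => r; rewrite !ffunE andbT.
  by rewrite /chain_edge !eqxx /= ?orbT.
- rewrite (offsetS lineM E) /chain_edge /stars /=.
  have [jm|mj] := ltnP j m.
    have L : (Some (None, [ffun k0 => (k0 == minput T) && (j.+1 < m.+1)%N],
      if (j.+1 < n)%N then Some false else None) : letter T) == one_letter T.
      have -> : (j.+1 < n)%N by lia.
      by apply/eqP; congr (Some (_, _, _)); apply/ffunP => r; rewrite !ffunE ltnS jm andbT.
    rewrite L (ltnW jm); apply/or3P; constructor 3; apply/orP; left; apply/and3P; split=> //; lia.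
  have L u : (Some (None, [ffun k0 => (k0 == minput T) && (j.+1 < m.+1)%N], u) : letter T)
      = Some (None, [ffun=> false], u).
    by congr (Some (_, _, _)); apply/ffunP => r; rewrite !ffunE ltnS ltnNge mj andbF.
  rewrite {}L; case: (leqP j m) => jm.
    have -> : (m.+2 - j = 2)%N by lia.
    by case: (ltnP j.+1 n) => jn; rewrite !eqxx ?orbT.
  case: (ltnP j n) => jn; last first.
    have -> : (j.+1 < n)%N = false by lia.
    by rewrite !eqxx ?orbT.
  by case: (ltnP j.+1 n) => jn'; rewrite !eqxx ?orbT.
have [->|->] := offset_NoneS lineM E; first by [].
by rewrite offset0.
Qed.

Lemma space_set_point m e x : space_set m e x -> no_mark x \/ exists i c v s,
  [/\ x = point i c v s, mono v & binary s \/
    [/\ exists2 n, (0 < n)%N & s = stars n &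
      c = e /\ v = mfinal T \/ c = false /\ v = minit T m.+1] ].
Proof.
move=> [[nm|[/base_set_point|/halt_set_point]]|/chain_set_point]; first by left.
- move=> [nm|[i [c [v [s [xE mv bs]]]]]]; [by left|right].
  by exists i, c, v, s; split=> //; left.
- move=> [nm|[i [s [xE bs]]]]; [by left|right].
  exists i, e, (mfinal T), s; split; [exact: xE|by move=> j r; rewrite !ffunE|].
  by case: bs; [left|right; split=> //; left].
- move=> [nm|[i [s [xE bs]]]]; [by left|right].
  exists i, false, (minit T m.+1), s; split; first exact: xE.
    by move=> j r; rewrite !ffunE => /andP[-> /ltnW ->].
  by case: bs; [left|right; split=> //; right].
Qed.

End Points.

(** * Gluing *)

Section Gluing.
Local Open Scope classical_set_scope.
Local Open Scope ring_scope.
Context (M : pzSemiRingType) (lineM : discrete_line M) (T : machine).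

Notation A := (alphabet T).
Notation digits := (nat -> option bool).
Notation fiber := (mconfig T * digits)%type.
Implicit Types (x y z : config M A) (i k : M) (c e : bool) (v : mconfig T) (s : digits).
Implicit Types u w : fiber.

Definition fpoint i c u : config M A := point i c u.1 u.2.

Definition dyadic_pair s s' : Prop := exists n,
  [/\ forall j, (j < n)%N -> s j = s' j /\ s j != None, s n = Some false,
      s' n = Some true & forall j, (n < j)%N -> s j = Some true /\ s' j = Some false].

Definition glue_to u w : Prop :=
  (u.1 = w.1 /\ dyadic_pair u.2 w.2) \/ [/\ u.2 = ones, w.2 = zeros & mstep u.1 = Some w.1].

(** [glue_to] is a partial function whose arguments end in ones and whose values end in zeros, so it
    never applies twice in a row. One common value therefore describes the whole equivalence
    relation, even where the arcs of several predecessors end in the same configuration. *)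
Definition glued u u' : Prop :=
  exists w, (w = u \/ glue_to u w) /\ (w = u' \/ glue_to u' w).

Lemma dyadic_pair_fun s s1 s2 : dyadic_pair s s1 -> dyadic_pair s s2 -> s1 = s2.
Proof.
move=> [n1 [eq1 n1F n1T gt1]] [n2 [eq2 n2F n2T gt2]].
have n12 : n1 = n2.
  case: (ltngtP n1 n2) => // [/gt1|/gt2] [E _]; first by rewrite E in n2F.
  by rewrite E in n1F.
apply/funext => j; rewrite -{}n12 in eq2 n2T gt2.
case: (ltngtP j n1) => [jn|nj|->]; last by rewrite n1T.
  by rewrite -(eq1 j jn).1 -(eq2 j jn).1.
by rewrite (gt1 j nj).2 (gt2 j nj).2.
Qed.

Lemma dyadic_pair_ones s : ~ dyadic_pair ones s.
Proof. by move=> [n []]. Qed.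

Lemma dyadic_pair_zeros s s' : dyadic_pair s s' -> s' <> zeros.
Proof. by move=> [n [_ _ + _]] E; rewrite E. Qed.

Lemma dyadic_pair_ev_zeros s s' : dyadic_pair s s' ->
  exists n, forall j, (n < j)%N -> s' j = Some false.
Proof. by move=> [n [_ _ _ gtn]]; exists n => j /gtn[]. Qed.

Lemma dyadic_pair_ev_ones s s' : dyadic_pair s s' ->
  exists n, forall j, (n < j)%N -> s j = Some true.
Proof. by move=> [n [_ _ _ gtn]]; exists n => j /gtn[]. Qed.

Lemma dyadic_pair_binary s s' : dyadic_pair s s' -> binary s.
Proof.
move=> [n [eqn nF _ gtn]] j.
case: (ltngtP j n) => [jn|nj|->]; last by rewrite nF.
  by case: (eqn j jn).
by rewrite (gtn j nj).1.
Qed.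

Lemma glue_to_fun u w1 w2 : glue_to u w1 -> glue_to u w2 -> w1 = w2.
Proof.
case: w1 w2 => [v1 s1] [v2 s2].
move=> [[/= <- d1]|[/= o1 -> st1]] [[/= <- d2]|[/= o2 -> st2]].
- by rewrite (dyadic_pair_fun d1 d2).
- by case: (@dyadic_pair_ones s1); rewrite -o2.
- by case: (@dyadic_pair_ones s2); rewrite -o1.
- by move: st1; rewrite st2 => -[->].
Qed.

Lemma glue_to_ev_ones u w : glue_to u w -> exists n, forall j, (n < j)%N -> u.2 j = Some true.
Proof.
move=> [[_ d]|[-> _ _]]; first exact: dyadic_pair_ev_ones d.
by exists 0%N.
Qed.

Lemma glue_to_ev_zeros u w : glue_to u w -> exists n, forall j, (n < j)%N -> w.2 j = Some false.
Proof.
move=> [[_ d]|[_ -> _]]; first exact: dyadic_pair_ev_zeros d.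
by exists 0%N.
Qed.

Lemma glue_to_image u w w' : glue_to u w -> ~ glue_to w w'.
Proof.
move=> /glue_to_ev_zeros[n un] /glue_to_ev_ones[n' wn].
have := un (n + n').+1; rewrite wn; first by move=> /(_ (leq_addr _ _)).
by rewrite ltnS leq_addl.
Qed.

Lemma glued_refl u : glued u u.
Proof. by exists u; split; left. Qed.

Lemma glued_sym u u' : glued u u' -> glued u' u.
Proof. by move=> [w [uw u'w]]; exists w. Qed.

Lemma glued_trans u2 u1 u3 : glued u1 u2 -> glued u2 u3 -> glued u1 u3.
Proof.
move=> [w [u1w u2w]] [w' [u2w' u3w']].
case: u2w u2w' => [wE|u2w] [w'E|u2w'].
- by exists w; split=> //; rewrite wE -w'E.
- case: u1w => [wE'|u1w]; last by rewrite wE in u1w; case: (glue_to_image u1w u2w').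
  by exists w'; split=> //; right; rewrite -wE' wE.
- case: u3w' => [w'E'|u3w']; last by rewrite w'E in u3w'; case: (glue_to_image u3w' u2w).
  by exists w; split=> //; right; rewrite -w'E' w'E.
- by exists w; split=> //; rewrite (glue_to_fun u2w u2w').
Qed.

Definition infinite_reg v : Prop := exists r, forall j, v.2 j r.

Lemma mono_step v v' : mono v -> mstep v = Some v' -> mono v'.
Proof.
rewrite /mstep; case: mact => [[q op]|] // mv [<-] j r /=.
case: op => [[r' []]|] /=; rewrite ?ffunE.
- by case: eqP => [_|_ /mv //]; case: j => [|j] // /mv.
- by case: eqP => _ /mv.
- exact: mv.
Qed.

(** A step shifts one track by one place and leaves the others alone. When the track was popped,
    monotonicity recovers its missing first bit. *)
Lemma infinite_step v v' : mono v -> mstep v = Some v' -> infinite_reg v <-> infinite_reg v'.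
Proof.
rewrite /mstep; case: mact => [[q op]|] // mv [<-].
split=> -[r rP]; exists r => j; case: op rP => [[r' []]|] /= rP.
- by rewrite ffunE; case: eqP => // <-; case: j.
- by rewrite ffunE; case: eqP => // <-.
- exact: rP.
- by have := rP j.+1; rewrite ffunE; case: eqP => [->|_ /mv].
- by have := rP j; rewrite ffunE; case: eqP => [<- /mv|].
- exact: rP.
Qed.

Lemma glue_to_infinite u w : mono u.1 -> glue_to u w ->
  (infinite_reg u.1 <-> infinite_reg w.1).
Proof. by move=> mu [[-> _]|[_ _ /(infinite_step mu)]]. Qed.

Lemma glued_infinite u u' : mono u.1 -> mono u'.1 -> glued u u' ->
  (infinite_reg u.1 <-> infinite_reg u'.1).
Proof.
move=> mu mu' [w [uw u'w]].
have -> : infinite_reg u.1 <-> infinite_reg w.1.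
  by case: uw => [->//|]; exact: glue_to_infinite.
by case: u'w => [->//|/(glue_to_infinite mu')->].
Qed.

Definition glue_piece (t : glue_kind T) x z : Prop :=
  forall k, glue_rel t (at_ x k) (at_ z k) (at_ x (k + 1)) (at_ z (k + 1)).

Lemma glue_piece_mark t x z : glue_piece t x z ->
  forall k, (mark (at_ x k) == None) = (mark (at_ z k) == None).
Proof.
move=> xz k; have := xz k; case: t {xz} => [[op|]|] /=.
- move=> /and3P[+ _ _]; case: (at_ x k) (at_ z k) => [[[m d] s]|] [[[m' d'] s']|] //=.
  by move=> /and4P[_ _ + _]; case: m m' => [[q e]|] [[q' e']|].
- move=> /and3P[+ _ _]; case: (at_ x k) (at_ z k) => [[[m d] [s|]]|] [[[m' d'] [s'|]]|] //=.
  by move=> /and3P[/eqP ->].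
- by move=> /eqP ->.
Qed.

Lemma glue_piece_no_mark t x z : glue_piece t x z -> no_mark x <-> no_mark z.
Proof.
move=> xz; split=> nm k; apply/eqP; have := glue_piece_mark xz k.
  by rewrite nm eqxx => <-.
by rewrite nm eqxx => ->.
Qed.

Lemma glue_piece_point t i c u z : glue_piece t (fpoint i c u) z ->
  exists2 w, z = fpoint i c w & w = u \/ glue_to u w.
Proof.
case: t => [[op|]|] xz; last first.
- exists u; last by left.
  by apply: at_inj => k; have /eqP := xz k.
- have ok k : dyadic_ok (at_ (fpoint i c u) k) (at_ z k) by have /and3P[] := xz k.
  pose s' j := digit (at_ z (i + j%:R)).
  have okj j : [/\ u.2 j != None, s' j != None,
      at_ z (i + j%:R) = Some (if j == 0%N then Some (u.1.1, c) else None, u.1.2 j, s' j) &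
      u.2 j = Some true -> s' j = Some false -> j != 0%N].
    have := ok (i + j%:R); rewrite /s' at_point_add //.
    case: (at_ z _) => [[[m' d'] [t|]]|]; case: (u.2 j) => [t'|] //=.
    move=> /and3P[/eqP <- /eqP <- H]; split=> // -[t'T] [tF].
    by move: H; rewrite t'T tF; case: j.
  have zE : z = point i c u.1 s'.
    apply: at_inj => k; rewrite at_point; case E: (offset i k) => [j|].
      by rewrite (offset_Some E); have [] := okj j.
    by have := ok k; rewrite at_point_None //; case: (at_ z k) => [[[m' d'] t]|].
  exists (u.1, s') => //.
  have next j : (u.2 j != s' j) = (u.2 j.+1 == Some true) && (s' j.+1 == Some false).
    have /and3P[_ _] := xz (i + j%:R).
    by rewrite -addrA natr1 zE !at_point_add //= => /eqP.
  have [E|] := pselect (forall j, s' j = u.2 j).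
    by left; rewrite [RHS]surjective_pairing; congr (_, _); apply/funext.
  move=> /existsNP[j0 /eqP j0P]; right; left; split=> //=.
  have ex : exists j, s' j != u.2 j by exists j0.
  case: (ex_minnP ex) => n nP minn; exists n.
  have lt_n j : (j < n)%N -> s' j = u.2 j.
    by move=> jn; apply/eqP/negPn/negP => /minn; rewrite leqNgt jn.
  have gt_n j : (n < j)%N -> u.2 j = Some true /\ s' j = Some false.
    elim: j => // j IHj; rewrite ltnS leq_eqVlt => nj.
    have : u.2 j != s' j.
      case/orP: nj => [/eqP <-|/IHj[-> ->] //]; by rewrite eq_sym.
    by rewrite next => /andP[/eqP -> /eqP ->].
  (* At the first difference the digits cannot be 1 against 0: at the marker [dyadic_ok] forbids it,
     and later [next] would put a difference one position earlier. *)
  have nn : u.2 n = Some false /\ s' n = Some true.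
    have [un s'n _ n0] := okj n.
    have nTF : ~ (u.2 n = Some true /\ s' n = Some false).
      move=> [uT sF]; have := n0 uT sF.
      case: n lt_n uT sF {nP minn gt_n un s'n n0} => // n lt_n uT sF _.
      by have := next n; rewrite lt_n // eqxx uT sF.
    move: un s'n nP nTF; case: (u.2 n) (s' n) => [[]|] // [[]|] // _ _ _ H.
    by case: H.
  split; [|by case: nn|by case: nn|exact: gt_n].
  by move=> j jn; rewrite lt_n //; split=> //; have [] := okj j.
- have ok k : step_ok op (at_ (fpoint i c u) k) (at_ z k) by have /and3P[] := xz k.
  pose d' j := data (at_ z (i + j%:R)).
  have okj j : [/\ u.2 j = Some true, mark (at_ z (i + j%:R)) != None -> j = 0%N,
      exists m', at_ z (i + j%:R) = Some (m', d' j, Some false) &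
      forall r : 'I_(mregs T), omap fst op != Some r -> d' j r = u.1.2 j r].
    have := ok (i + j%:R); rewrite /d' at_point_add //.
    case: (at_ z _) => [[[m' d1] t]|] //= /and4P[/eqP sT /eqP tF mm dd]; split=> //.
    - by case: j mm {sT dd} => // j; case: m'.
    - by exists m'; rewrite tF.
    - by move=> r rop; move/forallP: dd => /(_ r); rewrite rop => /eqP.
  have := ok i; rewrite at_point0 //.
  case zi: (at_ z i) => [[[[[q' e']|] d0] t]|] //=; last by rewrite !andbF.
  move=> /and4P[_ _ /and3P[/eqP ce /eqP act opr] _].
  have zE : z = point i c (q', d') (@zeros).
    apply: at_inj => k; rewrite at_point; case E: (offset i k) => [j|].
      rewrite (offset_Some E); have [_ mj [m' zj] _] := okj j; rewrite zj /=.
      case: j mj zj {E} => [|j] mj zj /=; last first.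
        by case: m' zj => // m' zj; have := mj; rewrite zj => /(_ isT).
      by move: zj; rewrite mulr0n addr0 zi => -[<- _ _]; rewrite -ce.
    by have := ok k; rewrite at_point_None //; case: (at_ z k) => [[[m' d1] t']|].
  exists ((q', d'), @zeros) => //; right; right; split=> //=.
    by apply/funext => j; have [] := okj j.
  rewrite /mstep act; congr (Some (_, _)); apply/funext => j; apply/ffunP => r.
  have /and3P[_ _] := xz (i + j%:R).
  rewrite -addrA natr1 zE !at_point_add //=.
  have [_ _ _ /(_ r)] := okj j; case: op xz opr {act ok okj} => [[r' []]|] /= xz.
  + move=> d0r dr /eqP nxt; rewrite ffunE; case: eqP => [->|/eqP rr']; last first.
      by rewrite dr //; apply: contraNneq rr' => -[->].
    (* The pushed bit at the marker is known from [step_ok], every later bit from the condition on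
       the preceding letter. *)
    case: j {dr nxt} => [|j]; first by rewrite /d' mulr0n addr0 zi /= d0r.
    have /and3P[_ _] := xz (i + j%:R).
    by rewrite -addrA natr1 zE !at_point_add //= => /eqP.
  + move=> _ dr /eqP nxt; rewrite ffunE; case: eqP => [->|/eqP rr']; first by rewrite nxt.
    by rewrite dr //; apply: contraNneq rr' => -[->].
  + by move=> _ ->.
Qed.

End Gluing.

(** * The sofic equivalence relation *)

Section GluingSet.
Local Open Scope classical_set_scope.
Local Open Scope ring_scope.
Context (M : pzSemiRingType) (lineM : discrete_line M) (T : machine).

Notation A := (alphabet T).
Notation digits := (nat -> option bool).
Notation fiber := (mconfig T * digits)%type.
Implicit Types (x y z : config M A) (i k : M) (c e : bool) (v : mconfig T) (s : digits).
Implicit Types u w : fiber.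

Lemma dyadic_pair_cases s s' : dyadic_pair s s' -> exists n, forall j,
  [\/ (j < n)%N /\ (exists b, s j = Some b /\ s' j = Some b),
      j = n /\ (s j = Some false /\ s' j = Some true) |
      (n < j)%N /\ (s j = Some true /\ s' j = Some false)].
Proof.
move=> [n [eqn nF nT gtn]]; exists n => j.
case: (ltngtP j n) => [jn|nj|->]; [constructor 1|constructor 3|by constructor 2].
  split=> //; have [<-] := eqn j jn; case: (s j) => // b _; by exists b.
by split=> //; exact: gtn.
Qed.

Lemma glue_to_piece i c u w : glue_to u w ->
  exists t, glue_piece t (fpoint i c u) (fpoint i c w).
Proof.
case: u w => [v s] [v' s'] [[/= <- /dyadic_pair_cases[n nP]]|[/= -> -> st]].
  exists (Some None) => k; rewrite /glue_rel /fpoint !at_point /=.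
  have ok j : dyadic_ok (Some (if j == 0%N then Some (v.1, c) else None, v.2 j, s j) : letter T)
      (Some (if j == 0%N then Some (v.1, c) else None, v.2 j, s' j)).
    case: (nP j) => [[_ [b [-> ->]]]|[_ [-> ->]]|[nj [-> ->]]] /=; rewrite !eqxx ?implybN //=.
      by case: b.
    by move: nj; case: j.
  case E: (offset i k) => [j|].
    rewrite (offsetS lineM E) /dyadic_rel !ok /=.
    case: (nP j) => [[jn [b [-> ->]]]|[jn [-> ->]]|[jn [-> ->]]];
    case: (nP j.+1) => [[jn' [b' [-> ->]]]|[jn' [-> ->]]|[jn' [-> ->]]] //=;
    try lia; rewrite eqxx //.
    by case: b'.
  have [->|->] := offset_NoneS lineM E; first by [].
  by rewrite offset0 // /dyadic_rel ok.
move: st; rewrite /mstep; case act: mact => [[q op]|] // [vE]; exists (Some (Some op)) => k.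
rewrite /glue_rel /fpoint !at_point /= -vE /=.
have ok j : step_ok op (Some (if j == 0%N then Some (v.1, c) else None, v.2 j, @ones j) : letter T)
      (Some (if j == 0%N then Some (q, c) else None, track_op op v.2 j, @zeros j)).
  rewrite /step_ok; apply/and4P; split=> //.
    case: j => [|j] //=; rewrite eqxx act eqxx /=.
    by case: (op) => [[r []]|] //=; rewrite ffunE eqxx.
  apply/forallP => r; apply/implyP; case: (op) => [[r' b]|] //= rr'.
  have {}rr' : r != r' by apply: contraNneq rr' => ->.
  by case: b; rewrite ffunE (negPf rr').
case E: (offset i k) => [j|].
  rewrite (offsetS lineM E) /step_rel (ok j) (ok j.+1) /=.
  by case: (op) => [[r []]|] //=; rewrite ffunE eqxx.
have [->|->] := offset_NoneS lineM E; first by [].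
by rewrite offset0 // /step_rel ok.
Qed.

Definition inf_set : set (config M (A * A)%type) :=
  [set w | exists t : option 'I_(mregs T) * option 'I_(mregs T), forall k,
    inf_ok t.1 (enum_val (w k).1) && inf_ok t.2 (enum_val (w k).2)].

(** The hidden sequence [z] is the common value in [glued]; projecting it away keeps the set
    sofic. *)
Definition glue_set : set (config M (A * A)%type) :=
  [set w | exists (t : glue_kind T * glue_kind T) z,
    glue_piece t.1 (fun k => (w k).1) z /\ glue_piece t.2 (fun k => (w k).2) z].

Definition quotient_set : set (config M (A * A)%type) := inf_set `|` glue_set.

Lemma quotient_set_sofic : graph_sofic quotient_set.
Proof.
apply: graph_soficU => //.
  have := @graph_sofic_nn M lineM (A * A)%type
    (option 'I_(mregs T) * option 'I_(mregs T))%type unit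
    (fun t a _ _ _ => inf_ok t.1 (enum_val a.1) && inf_ok t.2 (enum_val a.2)).
  congr (graph_sofic _); apply/seteqP; split=> w; first by move=> [t [_ H]]; exists t.
  by move=> [t H]; exists t, (fun=> tt).
have := @graph_sofic_nn M lineM (A * A)%type (glue_kind T * glue_kind T)%type A
  (fun t a b a' b' =>
    glue_rel t.1 (enum_val a.1) (enum_val b) (enum_val a'.1) (enum_val b') &&
    glue_rel t.2 (enum_val a.2) (enum_val b) (enum_val a'.2) (enum_val b')).
congr (graph_sofic _); apply/seteqP; split=> w [t [z H]]; exists t, z.
  by split=> k; have /andP[] := H k.
by move=> k; apply/andP; split; [exact: H.1|exact: H.2].
Qed.

(** The shape shared by the points of all the spaces [space_set m e], so that one relation,
    independent of [m] and [e], can be analysed once for all of them. *)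
Definition proper x : Prop :=
  no_mark x \/ exists i c u, x = fpoint i c u /\ mono u.1.

Definition infinite x : Prop :=
  no_mark x \/ exists r, forall k, at_ x k = None \/ data (at_ x k) r.

Lemma infinite_fpoint i c u : infinite (fpoint i c u) <-> infinite_reg u.1.
Proof.
split=> [[nm|[r rP]]|[r rP]]; first by case: (point_mark lineM nm).
  exists r => j; have := rP (i + j%:R); rewrite at_point_add //.
  by case.
right; exists r => k; rewrite at_point; case: (offset i k) => [j|]; [right|by left].
exact: rP.
Qed.

Lemma infiniteP x : infinite x <-> exists t, forall k, inf_ok t (at_ x k).
Proof.
split=> [[nm|[r rP]]|[[r|] tP]].
- by exists None => k; apply/eqP.
- by exists (Some r) => k /=; case: (rP k) => [->//|->]; rewrite orbT.
- by right; exists r => k; have /orP[/eqP|] := tP k; [left|right].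
- by left => k; apply/eqP; exact: tP.
Qed.

Lemma inf_setP x y : inf_set (config_pair x y) <-> infinite x /\ infinite y.
Proof.
split=> [[[t t'] /= H]|[/infiniteP[t xt] /infiniteP[t' yt]]].
  by split; apply/infiniteP; [exists t|exists t'] => k; have /andP[] := H k.
by exists (t, t') => k; apply/andP; split; [exact: xt|exact: yt].
Qed.

Lemma quotient_setP x y : proper x -> proper y ->
  quotient_set (config_pair x y) <->
  (infinite x /\ infinite y) \/
  exists i c u u', [/\ x = fpoint i c u, y = fpoint i c u' & glued u u'].
Proof.
move=> px py; split=> [[/inf_setP|[[t t'] [z [/= xz yz]]]]|[|]]; first by left.
- case: px => [nm|[i [c [u [xE mu]]]]].
    left; split; left => //; apply/(glue_piece_no_mark yz).
    exact/(glue_piece_no_mark xz).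
  rewrite xE in xz; have [w zE uw] := glue_piece_point lineM xz.
  case: py => [nm|[i' [c' [u' [yE mu']]]]].
    have /(glue_piece_no_mark yz) : no_mark y by [].
    by rewrite zE => /(point_mark lineM).
  rewrite yE in yz; have [w' zE' u'w'] := glue_piece_point lineM yz.
  have [ii' cc' ww1 ww2] : [/\ i = i', c = c', w.1 = w'.1 & w.2 = w'.2].
    by apply: (point_inj lineM); rewrite zE in zE'.
  right; exists i, c, u, u'; split=> //; first by rewrite yE ii' cc'.
  exists w; split=> //.
  by rewrite [w]surjective_pairing ww1 ww2 -surjective_pairing.
- by move=> /inf_setP; left.
- move=> [i [c [u [u' [-> -> [w [uw u'w]]]]]]]; right.
  have piece u1 : w = u1 \/ glue_to u1 w -> exists t, glue_piece t (fpoint i c u1) (fpoint i c w).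
    move=> [->|]; last exact: glue_to_piece.
    by exists None => k; rewrite /glue_rel /=.
  have [t tP] := piece _ uw; have [t' t'P] := piece _ u'w.
  by exists (t, t'), (fpoint i c w).
Qed.

Lemma space_set_proper m e x : space_set m e x -> proper x.
Proof.
move=> /(space_set_point lineM)[nm|[i [c [v [s [xE mv _]]]]]]; first by left.
by right; exists i, c, (v, s).
Qed.

Lemma quotient_set_equivalence (Y : set (config M A)) :
  (forall x, Y x -> proper x) -> equivalence_on Y quotient_set.
Proof.
move=> Yp; split=> [x /Yp px|x y /Yp px /Yp py|x y z /Yp px /Yp py /Yp pz].
- apply/quotient_setP => //; case: (px) => [nm|[i [c [u [xE mu]]]]].
    by left; split; left.
  by right; exists i, c, u, u; split=> //; exact: glued_refl.
- move=> /(quotient_setP px py) H; apply/(quotient_setP py px).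
  case: H => [[]|[i [c [u [u' [xE yE g]]]]]]; [by left|right].
  by exists i, c, u', u; split=> //; exact: glued_sym.
(* The two parts of the relation do not interfere: a point glued to a point at infinity is itself at
   infinity. *)
- have inf_glue x' y' i c u u' : proper x' -> proper y' -> x' = fpoint i c u ->
      y' = fpoint i c u' -> glued u u' -> infinite x' -> infinite y'.
    have pm x1 i1 c1 u1 : proper x1 -> x1 = fpoint i1 c1 u1 -> mono u1.1.
      move=> [nm|[i2 [c2 [u2 [-> mu]]]] E].
        by move=> E; case: (@point_mark _ lineM _ i1 c1 u1.1 u1.2); rewrite -[point _ _ _ _]E.
      by have [_ _ <- _] := point_inj lineM E.
    move=> px' py' xE yE g; have mu := pm _ _ _ _ px' xE; have mu' := pm _ _ _ _ py' yE.
    by rewrite xE yE !infinite_fpoint (glued_infinite mu mu' g).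
  move=> /(quotient_setP px py) xy /(quotient_setP py pz) yz; apply/(quotient_setP px pz).
  case: xy yz => [[ix iy]|[i [c [u [u' [xE yE g]]]]]] [[iy' iz]|[i' [c' [v [v' [yE' zE g']]]]]].
  + by left.
  + by left; split=> //; exact: (inf_glue _ _ _ _ _ _ py pz yE' zE g' iy).
  + by left; split=> //; exact: (inf_glue _ _ _ _ _ _ py px yE xE (glued_sym g) iy').
  + have [ii' cc' uv1 uv2] : [/\ i = i', c = c', u'.1 = v.1 & u'.2 = v.2].
      by apply: (point_inj lineM); rewrite yE in yE'.
    right; exists i, c, u, v'; split=> //; first by rewrite zE ii' cc'.
    apply: glued_trans g _.
    by rewrite [u']surjective_pairing uv1 uv2 -surjective_pairing.
Qed.

End GluingSet.

(** * Conjugacy when the machine does not halt *)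

Section QuotientTopology.
Local Open Scope classical_set_scope.
Local Open Scope quotient_scope.
Context (M : nmodType) (A : finType).
Context (Y : set (config M A)) (Z : set (config M (A * A)%type)).
Context (Ys : subshift Y) (Zs : subshift Z) (YZ : equivalence_on Y Z).

Let W := sofic_quotient Ys Zs YZ.

Definition cls (x : Y) : W := \pi_(quotient_topology {eq_quot quotient_equiv YZ}) x.

Lemma cls_eq x y : cls x = cls y <-> Z (config_pair (val x) (val y)).
Proof.
split=> [/eqmodP/asboolP //|xy].
by apply/eqmodP/asboolP.
Qed.

Lemma cls_surj (w : W) : exists x, cls x = w.
Proof. by exists (repr w); exact: reprK. Qed.

Lemma open_cls (U : set W) : open U <->
  forall x, U (cls x) -> exists s, forall y : Y, agree_on s (val x) (val y) -> U (cls y).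
Proof.
have := open_subconfig (cls @^-1` U : set (set_type Y)).
have -> : open U = open (cls @^-1` U : set (set_type Y)) by [].
by [].
Qed.

Lemma act_cls m x : msys_act m (cls x) = cls (subshift_act Ys m x).
Proof. exact: (quotient_act_pi (quotient_equiv_act (YZ := YZ) Zs)). Qed.

Definition in_set x (Yx : Y x) : Y := exist _ x (mem_set Yx).

End QuotientTopology.

Section Swap.
Local Open Scope classical_set_scope.
Local Open Scope ring_scope.
Context (M : pzSemiRingType) (lineM : discrete_line M) (T : machine).

Notation A := (alphabet T).
Notation digits := (nat -> option bool).
Notation fiber := (mconfig T * digits)%type.
Implicit Types (x y z : config M A) (i k : M) (c e : bool) (v : mconfig T) (s : digits).
Implicit Types u w : fiber.

Lemma fpoint_inj i c u i' c' u' :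
  fpoint i c u = fpoint i' c' u' :> config M A -> [/\ i = i', c = c' & u = u'].
Proof.
case: u u' => [v s] [v' s'] E.
by have [-> -> /= -> ->] := point_inj lineM E.
Qed.

Lemma proper_fpoint i c u : proper (fpoint i c u : config M A) -> mono u.1.
Proof.
move=> [nm|[i' [c' [u' [/fpoint_inj[_ _ ->] mu]]]]] //.
by case: (point_mark lineM nm).
Qed.

(** A window reaching past the end of every register shows the marker, the state and a 0 bit of each
    track; monotonicity then fixes the tracks for ever. Only the digits beyond the window stay free.
    Thus configurations with finite registers are topologically discrete. *)
Lemma near_fpoint i c u (N : nat) : mono u.1 -> ~ infinite_reg u.1 ->
  exists2 n : nat, (N <= n)%N & forall y, proper y ->
    agree_on [seq i + j%:R | j <- iota 0 n] (fpoint i c u) y ->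
    exists2 s, y = fpoint i c (u.1, s) & forall j : nat, (j < n)%N -> s j = u.2 j.
Proof.
move=> mu finu.
have /choice[J JP] : forall r, exists j, ~~ u.1.2 j r.
  move=> r; apply: contrapT => H; apply: finu; exists r => j.
  by apply/negPn/negP => nj; apply: H; exists j.
pose n := maxn N (\max_r J r).+1; exists n => [|y py yx]; first exact: leq_maxl.
have n0 : (0 < n)%N by rewrite leq_max orbT.
have aty j : (j < n)%N -> at_ y (i + j%:R) = at_ (fpoint i c u) (i + j%:R).
  by move=> jn; rewrite /at_ yx //; apply/mapP; exists j; rewrite ?mem_iota.
case: py => [nm|[i' [c' [u' [yE mu']]]]].
  by have := nm i; have := aty 0%N n0; rewrite mulr0n addr0 => ->; rewrite at_point0.
have ii' : i' = i.
  have := aty 0%N n0; rewrite mulr0n addr0 yE => /(congr1 (@mark T)).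
  rewrite !mark_point offset0 //=; case: eqP => // /offset_Some ->.
  by rewrite mulr0n addr0.
have uu' j : (j < n)%N -> (j = 0%N -> (u'.1.1, c') = (u.1.1, c)) /\
    u'.1.2 j = u.1.2 j /\ u'.2 j = u.2 j.
  move=> jn; have := aty j jn; rewrite yE ii' !at_point_add // => -[E1 E2 E3].
  by split=> // j0; move: E1; rewrite j0 => -[-> ->].
exists u'.2 => [|j /uu'[_ []] //].
have [/(_ erefl)[q cc'] _] := uu' 0%N n0.
rewrite yE ii' cc'; congr (point _ _ _ _).
case: u u' {yE finu yx aty} mu mu' JP uu' q => [[q d] s] [[q' d'] s'] /= mu mu' JP uu' ->.
congr (_, _); apply/funext => j; case: (ltnP j n) => jn; first by have [_ []] := uu' j jn.
apply/ffunP => r.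
have Jn : (J r < n)%N by rewrite leq_max ltnS leq_bigmax orbT.
have zero (d1 : tracks (mregs T)) : (forall j r, d1 j.+1 r -> d1 j r) -> ~~ d1 (J r) r ->
    d1 j r = false.
  move=> md nd; apply/negP; rewrite -(subnKC (leq_trans (ltnW Jn) jn)).
  elim: (j - J r)%N => [|l IHl]; first by rewrite addn0; apply/negP.
  by rewrite addnS => /md.
rewrite (zero d mu (JP r)); apply: (zero d' mu').
by have [_ [-> _]] := uu' _ Jn; exact: JP.
Qed.

Definition flip_letter (l : letter T) : letter T :=
  if l is Some (Some (q, c), d, s) then Some (Some (q, ~~ c), d, s) else l.

Definition flip x : config M A := fun k => enum_rank (flip_letter (at_ x k)).

Lemma at_flip x k : at_ (flip x) k = flip_letter (at_ x k).
Proof. by rewrite /at_ /flip enum_rankK. Qed.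

Lemma flip_fpoint i c u : flip (fpoint i c u) = fpoint i (~~ c) u.
Proof.
apply: at_inj => k; rewrite at_flip !at_point.
by case: (offset i k) => [[|j]|].
Qed.

Lemma flip_no_mark x : no_mark x -> flip x = x.
Proof.
move=> nm; apply: at_inj => k; rewrite at_flip; have := nm k.
by case: (at_ x k) => [[[[[q c]|] d] s]|].
Qed.

Lemma flip_infinite x : infinite x -> infinite (flip x).
Proof.
move=> [nm|[r rP]]; first by left; rewrite flip_no_mark.
right; exists r => k; rewrite at_flip; have := rP k.
by case: (at_ x k) => [[[[[q c]|] d] s]|] //= [//|]; right.
Qed.

Lemma flip_base x : base_set x -> base_set (flip x).
Proof.
move=> xb k; rewrite !at_flip; have := xb k.
by case: (at_ x k) (at_ x (k + 1)) => [[[[[q c]|] d] s]|] [[[[[q' c'] |] d'] s']|].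
Qed.

Lemma flip_halt e x : halt_set e x -> halt_set (~~ e) (flip x).
Proof.
move=> xh k; rewrite !at_flip; have := xh k; rewrite /halt_rel.
exact: (map_f (fun ll => (flip_letter ll.1, flip_letter ll.2))).
Qed.

Definition reaching x : Prop :=
  exists i c u, x = fpoint i c u /\ reaches (@mstep T) u.1 (mfinal T).

(** Not a block map, since no window decides reachability in general; its continuity is recovered on
    the quotient only. *)
Definition swap x : config M A := if `[< reaching x >] then flip x else x.

Lemma reaching_fpoint i c u :
  reaching (fpoint i c u) <-> reaches (@mstep T) u.1 (mfinal T).
Proof.
split=> [[i' [c' [u' [/fpoint_inj[_ _ ->]]]]] //|ru].
by exists i, c, u.
Qed.

Lemma swap_fpoint i c u :
  swap (fpoint i c u) = fpoint i (c (+) `[< reaches (@mstep T) u.1 (mfinal T) >]) u.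
Proof.
rewrite /swap (asbool_equiv_eq (reaching_fpoint i c u)).
by case: asboolP => _; rewrite ?addbT ?addbF // flip_fpoint.
Qed.

Lemma swap_no_mark x : no_mark x -> swap x = x.
Proof. by move=> nm; rewrite /swap; case: asboolP => // _; exact: flip_no_mark. Qed.

Lemma swap_proper x : proper x -> proper (swap x).
Proof.
move=> [nm|[i [c [u [-> mu]]]]]; first by left; rewrite swap_no_mark.
by rewrite swap_fpoint; right; do 3 eexists.
Qed.

Lemma swapK x : proper x -> swap (swap x) = x.
Proof.
move=> [nm|[i [c [u [-> _]]]]]; first by rewrite !swap_no_mark.
by rewrite !swap_fpoint -addbA addbb addbF.
Qed.

Lemma swap_cases x : swap x = x \/ swap x = flip x.
Proof. by rewrite /swap; case: asboolP; [right|left]. Qed.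

Lemma swap_infinite x : infinite x -> infinite (swap x).
Proof. by case: (swap_cases x) => ->; last exact: flip_infinite. Qed.

(** Steps are deterministic and [mfinal] has no successor, so reaching [mfinal] is invariant under a
    step in both directions. *)
Lemma reaches_glue_to u w : glue_to u w ->
  reaches (@mstep T) u.1 (mfinal T) <-> reaches (@mstep T) w.1 (mfinal T).
Proof.
move=> [[E _]|[_ _ st]]; first by rewrite E.
split; last by move=> H; exact: reaches_step st H.
move=> H; case: (reachesP H) => [uf|[v']]; first by move: st; rewrite uf /mstep /= mact_halt.
by rewrite st => -[->].
Qed.

Lemma reaches_glued u u' : glued u u' ->
  reaches (@mstep T) u.1 (mfinal T) <-> reaches (@mstep T) u'.1 (mfinal T).
Proof.
move=> [w [uw u'w]].
have -> : reaches (@mstep T) u.1 (mfinal T) <-> reaches (@mstep T) w.1 (mfinal T).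
  by case: uw => [->|/reaches_glue_to].
by case: u'w => [->|/reaches_glue_to ->].
Qed.

Lemma swap_quotient_set x y : proper x -> proper y ->
  quotient_set (config_pair x y) -> quotient_set (config_pair (swap x) (swap y)).
Proof.
move=> px py /(quotient_setP lineM px py) H.
apply/(quotient_setP lineM (swap_proper px) (swap_proper py)).
case: H => [[ix iy]|[i [c [u [u' [-> -> g]]]]]].
  by left; split; exact: swap_infinite.
right; exists i, (c (+) `[< reaches (@mstep T) u.1 (mfinal T) >]), u, u'.
by rewrite !swap_fpoint (asbool_equiv_eq (reaches_glued g)).
Qed.

Context (m : nat) (not_halting : ~ reaches (@mstep T) (minit T m.+1) (mfinal T)).

(** Non-halting enters here: the decorated points of the start configuration stay in copy 0, while
    those of the halting configuration change copy, as passing from [e] to [~~ e] requires. *)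
Lemma swap_space e x : space_set m e x -> space_set m (~~ e) (swap x).
Proof.
have [nm _|mx] := pselect (no_mark x); first by rewrite swap_no_mark //; left; left.
move=> [[nm|[xb|xh]]|xc]; first by [].
- by left; right; left; case: (swap_cases x) => ->; last exact: flip_base.
- case: (halt_set_point lineM xh) => [//|[i [s [xE _]]]].
  left; right; right; rewrite /swap; case: asboolP => [_|[]]; first exact: flip_halt.
  by rewrite xE; exists i, e, (mfinal T, s); split=> //; exact: reaches_refl.
- case: (chain_set_point lineM xc) => [//|[i [s [xE _]]]].
  right; rewrite /swap; case: asboolP => // -[i' [c' [u [E ru]]]].
  have [_ _ uE] := @fpoint_inj i false (minit T m.+1, s) _ _ _ (etrans (esym xE) E).
  by case: not_halting; rewrite -uE in ru.
Qed.

(** [mfinal] and [minit] have finite registers, so a point at infinity carries no decoration and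
    lies, like its flip, in both spaces. *)
Lemma infinite_swap_space e x : space_set m e x -> infinite x ->
  space_set m (~~ e) x /\ space_set m (~~ e) (flip x).
Proof.
have [nm _ _|mx] := pselect (no_mark x); first by rewrite flip_no_mark //; split; left; left.
have fin v : infinite_reg v -> v <> mfinal T /\ v <> minit T m.+1.
  move=> [r rP]; split=> vE; first by have := rP 0%N; rewrite vE ffunE.
  by have := rP m.+1; rewrite vE ffunE ltnn andbF.
move=> [[nm|[xb|xh]]|xc] ix; first by [].
- by split; left; right; left => //; exact: flip_base.
- case: (halt_set_point lineM xh) => [//|[i [s [xE _]]]].
  move: ix; rewrite xE -[point _ _ _ _]/(fpoint i e (mfinal T, s)).
  by move=> /(infinite_fpoint lineM)/fin[].
- case: (chain_set_point lineM xc) => [//|[i [s [xE _]]]].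
  move: ix; rewrite xE -[point _ _ _ _]/(fpoint i false (minit T m.+1, s)).
  by move=> /(infinite_fpoint lineM)/fin[].
Qed.

End Swap.

Section System.
Local Open Scope classical_set_scope.
Local Open Scope ring_scope.
Context (M : pzSemiRingType) (lineM : discrete_line M) (T : machine) (m : nat).

Notation A := (alphabet T).

Definition space_sofic e : sofic (space_set m e : set (config M A)) :=
  graph_sofic_sofic (space_set_sofic lineM T m e).

Definition relation_sofic : sofic (@quotient_set M T) :=
  graph_sofic_sofic (quotient_set_sofic lineM T).

Definition space_equivalence e :
    equivalence_on (space_set m e) (@quotient_set M T) :=
  quotient_set_equivalence lineM (@space_set_proper M lineM T m e).

Definition system e : msystem M :=
  sofic_quotient (space_sofic e).1 relation_sofic.1 (space_equivalence e).

Notation space e := (set_type (space_set m e : set (config M A))).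

Definition pt e (x : space e) : system e :=
  cls (space_sofic e).1 relation_sofic.1 (space_equivalence e) x.

Lemma space_val_proper e (x : space e) : proper (val x).
Proof. by apply: (space_set_proper lineM (m := m) (e := e)); exact: set_valP. Qed.

Lemma pt_eq e (x y : space e) :
  pt x = pt y <-> quotient_set (config_pair (val x) (val y)).
Proof. exact: cls_eq. Qed.

Lemma pt_surj e (w : system e) : exists x, pt x = w.
Proof. exact: cls_surj. Qed.

Definition space_shift e k (x : space e) : space e := subshift_act (space_sofic e).1 k x.

Lemma act_pt e k (x : space e) : msys_act k (pt x) = pt (space_shift k x).
Proof. exact: act_cls. Qed.

Lemma open_pt e (U : set (system e)) : open U <->
  forall x, U (pt x) ->
    exists s, forall y : space e, agree_on s (val x) (val y) -> U (pt y).
Proof. exact: open_cls. Qed.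

End System.

Section Conjugacy.
Local Open Scope classical_set_scope.
Local Open Scope ring_scope.
Context (M : pzSemiRingType) (lineM : discrete_line M) (T : machine) (m : nat).
Context (not_halting : ~ reaches (@mstep T) (minit T m.+1) (mfinal T)).

Notation A := (alphabet T).
Notation space e := (set_type (space_set m e : set (config M A))).
Notation system e := (system lineM T m e).

Definition swap_pt e (x : space e) : space (~~ e) :=
  exist _ (swap (val x)) (mem_set (swap_space lineM not_halting (set_valP x))).

Definition swap_system e (w : system e) : system (~~ e) :=
  pt lineM (swap_pt (sval (cid (pt_surj w)))).

Lemma swap_system_pt e (x : space e) :
  swap_system (pt lineM x) = pt lineM (swap_pt x).
Proof.
rewrite /swap_system; case: cid => y /= /pt_eq yx; apply/pt_eq.
by apply: swap_quotient_set yx => //; exact: space_val_proper.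
Qed.

Lemma swap_system_continuous e : continuous (@swap_system e).
Proof.
apply/continuousP => U oU; apply/open_pt => x /=; rewrite swap_system_pt => Ux.
have Usw s0 : (forall y : space e, agree_on s0 (val x) (val y) -> U (pt lineM (swap_pt y))) ->
    exists s, forall y : space e, agree_on s (val x) (val y) -> U (swap_system (pt lineM y)).
  by move=> H; exists s0 => y /H; rewrite swap_system_pt.
(* At infinity the images of nearby points are near [x] or near [flip x], depending on an
   uncontrolled reachability question. Both represent the same point of the target, so the
   intersection of two cylinders suffices. *)
have [ix|fx] := pselect (infinite (val x)).
  have [x1 x2] := infinite_swap_space lineM (set_valP x) ix.
  have U12 z (zY : space_set m (~~ e) z) : infinite z -> U (pt lineM (in_set zY)).
    move=> iz; have -> // : pt lineM (in_set zY) = pt lineM (swap_pt x).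
    apply/pt_eq/quotient_setP => //; try exact: space_val_proper.
    by left; split=> //; exact: swap_infinite.
  have [s1 s1P] := (open_pt U).1 oU _ (U12 _ x1 ix).
  have [s2 s2P] := (open_pt U).1 oU _ (U12 _ x2 (flip_infinite ix)).
  apply: (Usw (s1 ++ s2)) => y yx.
  case: (swap_cases (val y)) => sy; [apply: s1P|apply: s2P] => i si /=; rewrite sy.
    by apply: yx; rewrite mem_cat si.
  by rewrite /flip /at_ yx // mem_cat si orbT.
have [s sP] := (open_pt U).1 oU _ Ux.
case: (space_val_proper lineM x) => [nm|[i [c [u [xE mu]]]]]; first by case: fx; left.
rewrite xE in fx; have fu : ~ infinite_reg u.1.
  by move=> iu; apply: fx; apply/(infinite_fpoint lineM).
(* Away from infinity a window fixes the configuration, so nearby points receive the same decision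
   as [x]. *)
have [n _ nP] := near_fpoint lineM i c 0 mu fu.
apply: (Usw ([seq i + j%:R | j <- iota 0 n] ++ s)) => y yx.
have [|s' yE _] := nP (val y) (space_val_proper lineM y).
  by rewrite -xE => k kn; apply: yx; rewrite mem_cat kn.
apply: sP => k ks /=; rewrite xE yE !swap_fpoint //=.
have : (val y) k = (val x) k by apply: yx; rewrite mem_cat ks orbT.
rewrite xE yE; case: (`[< _ >]); rewrite ?addbT ?addbF // -!flip_fpoint /flip /at_.
by move=> ->.
Qed.

Lemma swap_ptK e (x : space e) :
  quotient_set (config_pair (val (swap_pt (swap_pt x))) (val x)).
Proof.
have E : swap (swap (val x)) = val x by apply: swapK => //; exact: space_val_proper.
change (quotient_set (config_pair (swap (swap (val x))) (val x))); rewrite E.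
have [r _ _] := space_equivalence lineM T m e; apply: r; exact: set_valP.
Qed.

Lemma swap_system_falseK : cancel (@swap_system false) (@swap_system true).
Proof.
move=> w; have [x <-] := pt_surj w; rewrite (swap_system_pt x).
rewrite (swap_system_pt (swap_pt x)).
exact: ((@pt_eq M lineM T m false (swap_pt (swap_pt x)) x).2 (swap_ptK x)).
Qed.

Lemma swap_system_trueK : cancel (@swap_system true) (@swap_system false).
Proof.
move=> w; have [x <-] := pt_surj w; rewrite (swap_system_pt x).
rewrite (swap_system_pt (swap_pt x)).
exact: ((@pt_eq M lineM T m true (swap_pt (swap_pt x)) x).2 (swap_ptK x)).
Qed.

(** As long as the marker survives the shift, the configuration and hence the decision are
    unchanged. If the marker leaves on the left, which can happen over [nat], both sides become
    marker-free and thus equal in the quotient. *)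
Lemma swap_shift k (x : config M A) : proper x ->
  swap (shift_by k x) = shift_by k (swap x) \/
  no_mark (shift_by k x) /\ no_mark (shift_by k (swap x)).
Proof.
have nm_shift y : no_mark y -> no_mark (shift_by k y) by move=> nm i; exact: nm.
move=> [nm|[i [c [u [-> _]]]]].
  by right; rewrite (swap_no_mark nm); split; exact: nm_shift.
have [[i' ii']|H] := pselect (exists i', i = i' + k).
  left; have sh c' : shift_by k (fpoint i c' u) = fpoint i' c' u.
    apply: at_inj => l; rewrite -[at_ (shift_by _ _) l]/(at_ (fpoint i c' u) (l + k)).
    by rewrite !at_point ii' offset_shift.
  by rewrite swap_fpoint // !sh swap_fpoint.
right; rewrite swap_fpoint //.
have nm c' : no_mark (shift_by k (fpoint i c' u)).
  move=> l; rewrite -[at_ (shift_by _ _) l]/(at_ (fpoint i c' u) (l + k)) mark_point.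
  case: eqP => // /offset_Some E; case: H; exists l.
  by rewrite E mulr0n addr0.
by split; exact: nm.
Qed.

Lemma swap_system_act e k (w : system e) :
  swap_system (msys_act k w) = msys_act k (swap_system w).
Proof.
have [x <-] := pt_surj w.
rewrite (act_pt lineM k x) (swap_system_pt x) (act_pt lineM k (swap_pt x)).
rewrite (swap_system_pt (space_shift lineM k x)).
apply/pt_eq/quotient_setP => //; try exact: space_val_proper.
case: (swap_shift k (space_val_proper lineM x)) => [E|[nm nm']].
  change (val (swap_pt (space_shift lineM k x))) with (swap (shift_by k (val x))).
  rewrite E; apply/quotient_setP => //;
    try exact: (space_val_proper lineM (space_shift lineM k (swap_pt x))).
  have [r _ _] := space_equivalence lineM T m (~~ e); apply: r.
  exact: (set_valP (space_shift lineM k (swap_pt x))).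
left; split; left => //.
by change (no_mark (swap (shift_by k (val x)))); rewrite swap_no_mark.
Qed.

Theorem system_conjugate : conjugate (system false) (system true).
Proof.
exists (@swap_system false), (@swap_system true); split.
- exact: swap_system_falseK.
- exact: swap_system_trueK.
- exact: swap_system_continuous.
- exact: swap_system_continuous.
- exact: (@swap_system_act false).
Qed.

End Conjugacy.

(** * Isolated points and arcs *)

(* The connectedness of the arc, seen as the quotient of the Cantor space by
   w 0 1 1 1 ... ~ w 1 0 0 0 ...; the proof is by bisection. *)
Lemma binary_arc_connected (u : (nat -> bool) -> Prop) :
  (forall s, exists N, forall s', (forall j, (j < N)%N -> s' j = s j) -> u s <-> u s') ->
  (forall w, u (nth true (rcons w false)) <-> u (nth false (rcons w true))) ->
  u (fun=> false) -> u (fun=> true).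
Proof.
move=> loc dy u0; apply: contrapT => u1.
(* The default of [nth] serves as the tail: [nth false w] and [nth true w] are the ends
   [w 0 0 0 ...] and [w 1 1 1 ...] of the subarc with prefix [w]. The new digit selects the half
   where [u] still holds at the left end and fails at the right one. *)
pose next w := rcons w `[< u (nth true (rcons w false)) >].
pose W n := iter n next [::].
have sW n : size (W n) = n by elim: n => //= n IHn; rewrite size_rcons IHn.
have ext_rcons (a : bool) w : nth a (rcons w a) = nth a w.
  apply/funext => j; rewrite nth_rcons; case: ltngtP => // jw.
    by rewrite nth_default // ltnW.
  by rewrite nth_default // jw.
have ext_nil (a : bool) : nth a [::] = (fun=> a) by apply/funext; case.
have inv n : u (nth false (W n)) /\ ~ u (nth true (W n)).
  elim: n => [|n [IH0 IH1]]; first by rewrite /W /= !ext_nil.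
  rewrite /W iterS -/(W n) /next; case: asboolP => un; rewrite ext_rcons; split=> //.
  by apply/dy.
pose s j := nth false (W j.+1) j.
have Ws n j a : (j < n)%N -> nth a (W n) j = s j.
  elim: n => // n IHn; rewrite ltnS leq_eqVlt => /orP[/eqP ->|jn].
    by rewrite /s; apply: set_nth_default; rewrite sW.
  by rewrite /W iterS -/(W n) /next nth_rcons sW jn IHn.
have [N sN] := loc s; have [uN nuN] := inv N.
have E a := sN (nth a (W N)) (fun j => @Ws N j a).
by apply: nuN; apply/(E true)/(E false).
Qed.

Section SystemTopology.
Local Open Scope classical_set_scope.
Local Open Scope ring_scope.
Context (M : pzSemiRingType) (lineM : discrete_line M) (T : machine) (m : nat).

Notation A := (alphabet T).
Notation digits := (nat -> option bool).
Notation fiber := (mconfig T * digits)%type.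
Notation space e := (set_type (space_set m e : set (config M A))).
Notation system e := (system lineM T m e).
Notation pt := (pt lineM).
Implicit Types (i k : M) (c e : bool) (v : mconfig T) (s : digits).
Implicit Types u w : fiber.

Lemma fpoint_space e i c u : mono u.1 -> binary u.2 -> space_set m e (fpoint i c u).
Proof. by move=> mu bu; left; right; left; exact: point_base. Qed.

Lemma glue_to_binary u w : glue_to u w -> binary u.2 /\ binary w.2.
Proof.
move=> [[_ d]|[-> -> _]] //; split; first exact: dyadic_pair_binary d.
have [n nP] := dyadic_pair_cases d => j.
by case: (nP j) => [[_ [b [_ ->]]]|[_ [_ ->]]|[_ [_ ->]]].
Qed.

Lemma glued_binary u u' : glued u u' -> binary u.2 -> binary u'.2.
Proof.
move=> [w [uw u'w]]; case: u'w => [wE|/glue_to_binary[] //].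
by rewrite wE in uw; case: uw => [->|/glue_to_binary[]].
Qed.

Lemma glued_not_binary u u' : glued u u' -> ~ binary u.2 -> u' = u.
Proof.
move=> [w [uw u'w]] nbu; have wu : w = u by case: uw => // /glue_to_binary[].
by case: u'w => [<-//|/glue_to_binary[_]]; rewrite wu.
Qed.

(** [zeros] is neither an argument of [glue_to] nor the larger expansion of an interior dyadic
    point, so only ends of arcs are attached to the start of an arc. *)
Lemma glued_zeros u v : glued u (v, @zeros) -> u = (v, @zeros) \/ u.2 = ones.
Proof.
move=> [w [uw vw]]; have wv : w = (v, @zeros).
  by case: vw => // /glue_to_ev_ones[n /(_ n.+1 (ltnSn _))].
case: uw => [<-|]; first by left.
by rewrite wv => -[[_ /dyadic_pair_zeros]|[-> _ _]]; [|right].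
Qed.

Lemma pt_fpoint_eq e (x y : space e) i c u i' c' u' :
  val x = fpoint i c u -> val y = fpoint i' c' u' -> ~ infinite_reg u.1 ->
  pt x = pt y <-> [/\ i = i', c = c' & glued u u'].
Proof.
move=> xE yE fu; have px := space_val_proper lineM x; have py := space_val_proper lineM y.
split.
  move=> /pt_eq/(quotient_setP lineM px py).
  case=> [[]|[i1 [c1 [u1 [u1' []]]]]]; first by rewrite xE => /(infinite_fpoint lineM).
  by rewrite xE yE => /(fpoint_inj lineM)[-> -> ->] /(fpoint_inj lineM)[-> -> ->].
move=> [ii' cc' g]; apply/pt_eq/(quotient_setP lineM px py).
by right; exists i, c, u, u'; split=> //; rewrite ii' cc'.
Qed.

Lemma fpoint_not_no_mark (x : config M A) i c u : x = fpoint i c u -> ~ no_mark x.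
Proof. by move=> ->; exact: point_mark. Qed.

Lemma pt_finite e (x y : space e) i c u :
  val x = fpoint i c u -> ~ infinite_reg u.1 -> pt y = pt x ->
  exists2 u', val y = fpoint i c u' & glued u u' /\ ~ infinite_reg u'.1.
Proof.
move=> xE fu yx; have px := space_val_proper lineM x.
case: (space_val_proper lineM y) => [nm|[i' [c' [u' [yE mu']]]]].
  have [] := (quotient_setP lineM (space_val_proper lineM y) px).1 ((pt_eq lineM y x).1 yx).
    by move=> [_]; rewrite xE => /(infinite_fpoint lineM).
  by move=> [i1 [c1 [u1 [u1' [/fpoint_not_no_mark]]]]].
have [ii' cc' g] := (pt_fpoint_eq xE yE fu).1 (esym yx).
exists u'; first by rewrite yE ii' cc'.
split=> //; rewrite -(glued_infinite _ mu' g) //.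
by apply: (proper_fpoint lineM (i := i) (c := c)); rewrite -xE.
Qed.

Definition finite_part e (G : M -> bool -> fiber -> Prop) : set (system e) :=
  [set p | exists (x : space e) i c u,
    [/\ p = pt x, val x = fpoint i c u, ~ infinite_reg u.1 & G i c u]].

Definition gluable (G : M -> bool -> fiber -> Prop) : Prop :=
  forall i c u u', glued u u' -> G i c u -> G i c u'.

Lemma space_mono e (x : space e) i c u : val x = fpoint i c u -> mono u.1.
Proof.
move=> xE; apply: (proper_fpoint lineM (i := i) (c := c)); rewrite -xE.
exact: space_val_proper.
Qed.

Lemma finite_partP e G (x : space e) : gluable G ->
  finite_part G (pt x) <->
  exists i c u, [/\ val x = fpoint i c u, ~ infinite_reg u.1 & G i c u].
Proof.
move=> gG; split=> [[y [i [c [u [xy yE fu Gu]]]]]|[i [c [u [xE fu Gu]]]]]; last first.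
  by exists x, i, c, u.
have [u' xE [g fu']] := pt_finite yE fu xy.
by exists i, c, u'; split=> //; exact: gG g Gu.
Qed.

(** By [near_fpoint] a window freezes everything but the later digits, so it is enough that [G] is
    stable under changing those. *)
Lemma open_finite_part e G : gluable G ->
  (forall i c u, G i c u -> exists N : nat, forall s, (forall j, (j < N)%N -> s j = u.2 j) ->
    space_set m e (fpoint i c (u.1, s)) -> G i c (u.1, s)) ->
  open (finite_part G : set (system e)).
Proof.
move=> gG locG; apply/open_pt => x /(finite_partP x gG)[i [c [u [xE fu Gu]]]].
have [N NP] := locG _ _ _ Gu.
have [n Nn nP] := near_fpoint lineM i c N (space_mono xE) fu.
exists [seq i + j%:R | j <- iota 0 n] => y yx.
have [|s yE su] := nP (val y) (space_val_proper lineM y); first by rewrite -xE.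
apply/(finite_partP y gG); exists i, c, (u.1, s); split=> //; apply: NP => [j jN|].
  by apply: su; exact: leq_trans jN Nn.
by rewrite -yE; exact: set_valP.
Qed.

Definition isolated (X : topologicalType) (p : X) : Prop := open [set p].

(** Membership in the closure of the isolated points; isolated points themselves are included. *)
Definition near_isolated (X : topologicalType) (p : X) : Prop :=
  forall U : set X, open U -> U p -> exists2 q, U q & isolated q.

Definition decorated e c v : Prop :=
  c = e /\ v = mfinal T \/ c = false /\ v = minit T m.+1.

Lemma decorated_mono e c v : decorated e c v -> mono v.
Proof.
move=> [[_ ->]|[_ ->]] j r; rewrite !ffunE //.
by move=> /andP[-> /ltnW ->].
Qed.

Lemma decorated_finite e c v : decorated e c v -> ~ infinite_reg v.
Proof.
move=> [[_ ->]|[_ ->]] [r rP]; first by have := rP 0%N; rewrite ffunE.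
by have := rP m.+1; rewrite ffunE ltnn andbF.
Qed.

Lemma stars_space e i c v n : decorated e c v -> (m.+1 < n)%N ->
  space_set m e (fpoint i c (v, @stars n)).
Proof.
move=> [[-> ->]|[-> ->]] mn; last by right; apply: point_chain_stars => //; exact: ltnW.
by left; right; right; apply: point_halt_stars => //; exact: leq_ltn_trans mn.
Qed.

Lemma stars_not_binary n : ~ binary (@stars n).
Proof. by move=> /(_ n); rewrite /stars ltnn. Qed.

Lemma space_not_binary e i c u : space_set m e (fpoint i c u) -> ~ binary u.2 ->
  decorated e c u.1 /\ exists n, u.2 = stars n.
Proof.
move=> xY nb; case: (space_set_point lineM xY) => [/point_mark //|[i2 [c2 [v2 [s2 [E _]]]]]].
have [_ -> ->] := @fpoint_inj M lineM T i c u i2 c2 (v2, s2) E.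
have [_ _ uE] := @fpoint_inj M lineM T i c u i2 c2 (v2, s2) E.
case=> [bs|[[n _ ->] dec]]; first by case: nb; rewrite uE.
by split=> //; exists n.
Qed.

(** In [space_set] a star occurs only in a sequence [stars n], which is determined by the place of
    its first star. A window containing that place isolates the point, and no other sequence is
    glued to it. *)
Lemma not_binary_isolated e (x : space e) i c u : val x = fpoint i c u ->
  ~ infinite_reg u.1 -> ~ binary u.2 -> isolated (pt x).
Proof.
move=> xE fu nbu; apply/open_pt => x' /= x'x.
have x'E : val x' = fpoint i c u.
  by have [u' -> [/glued_not_binary -> //]] := pt_finite xE fu x'x.
have xY : space_set m e (fpoint i c u) by rewrite -xE; exact: set_valP.
have [_ [n un]] := space_not_binary xY nbu.
have [N nN NP] := near_fpoint lineM i c n.+1 (space_mono xE) fu.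
exists [seq i + j%:R | j <- iota 0 N] => y yx.
have [|s yE su] := NP (val y) (space_val_proper lineM y); first by rewrite -x'E.
suff sE : s = u.2.
  apply/(pt_fpoint_eq yE xE); first by [].
  by split=> //; rewrite sE -surjective_pairing; exact: glued_refl.
have sj j : (j <= n)%N -> s j = u.2 j by move=> jn; apply: su; exact: leq_trans nN.
have nbs : ~ binary s by move=> /(_ n); rewrite sj // un /stars ltnn.
have yY : space_set m e (fpoint i c (u.1, s)) by rewrite -yE; exact: set_valP.
have [_ [n' /= sE]] := space_not_binary yY nbs.
rewrite sE un; congr stars; case: (ltngtP n' n) => // nn'.
  by have := sj n' (ltnW nn'); rewrite sE un /stars ltnn nn'.
by have := sj n (leqnn n); rewrite sE un /stars ltnn nn'.
Qed.

Lemma offsets_bounded i (t : seq M) : exists n : nat,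
  forall k j, k \in t -> offset i k = Some j -> (j < n)%N.
Proof.
elim: t => [|k t [n nP]]; first by exists 0%N.
exists (n + (odflt 0 (offset i k)).+1)%N => k' j; rewrite inE => /orP[/eqP -> ->|k't kj].
  by rewrite /= addnS ltnS leq_addl.
by apply: leq_trans (nP _ _ k't kj) _; exact: leq_addr.
Qed.

Lemma agree_fpoint i c v s (t : seq M) : exists n : nat,
  forall s', (forall j, (j < n)%N -> s' j = s j) ->
    agree_on t (fpoint i c (v, s) : config M A) (fpoint i c (v, s')).
Proof.
have [n nP] := offsets_bounded i t; exists n => s' ss' k kt.
rewrite /fpoint /point; case E: (offset i k) => [j|] //=.
by rewrite ss' //; exact: nP kt E.
Qed.

Lemma decorated_near_isolated e (x : space e) i c v :
  val x = fpoint i c (v, @zeros) -> decorated e c v -> near_isolated (pt x).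
Proof.
move=> xE dec U oU Ux; have [t tP] := (open_pt U).1 oU x Ux.
have [n nP] := agree_fpoint i c v (@zeros) t.
(* The summand [m.+2] keeps the first star behind the ones of the input register, as the chain
   requires. *)
have sY := stars_space i dec (leq_addl n m.+2).
exists (pt (in_set sY)).
  apply: tP; rewrite xE; apply: nP => j jn.
  by rewrite /stars (leq_trans jn) ?leq_addr.
apply: (@not_binary_isolated e (in_set sY) i c (v, @stars (n + m.+2))) => //.
  exact: decorated_finite dec.
exact: stars_not_binary.
Qed.

Lemma binary_not_isolated e (x : space e) i c u : val x = fpoint i c u ->
  ~ infinite_reg u.1 -> binary u.2 -> ~ isolated (pt x).
Proof.
move=> xE fu bu /open_pt/(_ x erefl)[t /= tP].
have [n nP] := agree_fpoint i c u.1 u.2 t.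
(* Two alternating continuations of the same prefix. Neither ends in ones, so neither is an argument
   of [glue_to], and being different they are not glued; yet both would have to equal the isolated
   point. *)
pose alt b : digits := fun j => if (j < n)%N then u.2 j else Some (odd j (+) b).
have balt b : binary (alt b) by move=> j; rewrite /alt; case: ifP.
have altY b := fpoint_space e i c (u := (u.1, alt b)) (space_mono xE) (balt b).
have altx b : pt (in_set (altY b)) = pt x.
  apply: tP; rewrite xE; apply: nP => j jn.
  by rewrite /alt jn.
have altE b : val (in_set (altY b)) = fpoint i c (u.1, alt b) by [].
have [_ _ [w [w1 w2]]] := (pt_fpoint_eq (altE true) (altE false) fu).1
  (etrans (altx true) (esym (altx false))).
have no b : ~ glue_to (u.1, alt b) w.
  move=> /glue_to_ev_ones[n' /= H].
  have := H (n + n').+1; have := H (n + n').+2; rewrite /alt.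
  have -> : ((n + n').+2 < n)%N = false by lia.
  have -> : ((n + n').+1 < n)%N = false by lia.
  move=> /(_ ltac:(lia)) [E1] /(_ ltac:(lia)) [E2].
  by move: E1 E2 => /=; case: (odd _); case: (b).
case: w1 => [wE|/no[]]; case: w2 => [|/no[]]; rewrite wE => -[].
by move=> /(congr1 (fun s : digits => s n)); rewrite /alt ltnn; case: (odd n).
Qed.

Definition vertex_class e c u : Prop :=
  exists2 v, glued u (v, @zeros) & decorated e c v.

Lemma near_isolated_vertex e (x : space e) i c u : val x = fpoint i c u ->
  ~ infinite_reg u.1 -> binary u.2 -> near_isolated (pt x) -> vertex_class e c u.
Proof.
move=> xE fu bu near; apply: contrapT => nv.
(* The binary points other than decorated arc starts form an open set without isolated points. *)
pose G (_ : M) c' u' := binary u'.2 /\ ~ vertex_class e c' u'.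
have gG : gluable G.
  move=> i' c' u1 u2 g [b1 n1]; split; first exact: glued_binary g b1.
  by move=> [v g2 dec]; apply: n1; exists v => //; exact: glued_trans g g2.
have [||q /[dup] qG [y [i' [c' [u' [-> yE fu' [bu' _]]]]]]] := near (finite_part G).
- apply: open_finite_part => // i' c' u' [bu' nv'].
  (* A neighbour can leave [G] in two ways: by having stars, hence initial zeros, or by being an arc
     start, hence having digits all 0 or all 1. The windows [N0] and [N1] are long enough that then
     the digits of [u'] itself are constant. *)
  have dig (a : bool) : exists N : nat,
      (forall j, (j < N)%N -> u'.2 j = Some a) -> u'.2 = (fun=> Some a).
    have [E|nE] := pselect (u'.2 = (fun=> Some a)); first by exists 0%N.
    have [j ja] : exists j, u'.2 j <> Some a.
      apply: contrapT => H; apply: nE; apply/funext => j; apply: contrapT => ?.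
      by apply: H; exists j.
    by exists j.+1 => /(_ j (ltnSn j)).
  have [N0 N0P] := dig false; have [N1 N1P] := dig true.
  exists (maxn N0 N1) => s sj sY.
  have s0 j : (j < N0)%N -> s j = u'.2 j by move=> jN; apply: sj; rewrite leq_max jN.
  have s1 j : (j < N1)%N -> s j = u'.2 j by move=> jN; apply: sj; rewrite leq_max jN orbT.
  have u'E : u' = (u'.1, u'.2) by case: (u').
  split.
    apply: contrapT => /= nbs; have [dec [n /= sE]] := space_not_binary sY nbs.
    apply: nv'; exists u'.1 => //; rewrite {1}u'E N0P; first exact: glued_refl.
    move=> j jN; rewrite -s0 // sE /stars; case: ltnP => // nj.
    have nN := leq_ltn_trans nj jN.
    by have := bu' n; rewrite -s0 // sE /stars ltnn.
  move=> [v' g dec]; apply: nv'; exists v' => //.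
  suff sE : s = u'.2 by rewrite u'E -sE.
  case/glued_zeros: g => [[_ sE]|/= sE].
    by rewrite N0P // => j jN; rewrite -s0 // sE.
  by rewrite N1P // => j jN; rewrite -s1 // sE.
- by exists x, i, c, u.
- exact: binary_not_isolated yE fu' bu'.
Qed.

End SystemTopology.

Section HomeomorphismInvariants.
Local Open Scope classical_set_scope.
Context (X Y : topologicalType) (f : X -> Y) (g : Y -> X).
Context (fK : cancel f g) (gK : cancel g f) (cf : continuous f) (cg : continuous g).

Lemma isolated_homeo p : isolated p -> isolated (f p).
Proof.
rewrite /isolated => op.
have -> : [set f p] = g @^-1` [set p].
  by apply/seteqP; split=> q /= => [->|<-]; rewrite ?fK ?gK.
by move/continuousP: cg; apply.
Qed.

Lemma near_isolated_homeo p : near_isolated p -> near_isolated (f p).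
Proof.
move=> np U oU Up; have [||q Uq iq] := np (f @^-1` U) => //.
  by move/continuousP: cf; apply.
by exists (f q) => //; exact: isolated_homeo.
Qed.

End HomeomorphismInvariants.

(** * The two systems are not homeomorphic when the machine reaches [mfinal] *)

Section NotHomeomorphic.
Local Open Scope classical_set_scope.
Local Open Scope ring_scope.
Context (M : pzSemiRingType) (lineM : discrete_line M) (T : machine) (m : nat).

Notation A := (alphabet T).
Notation digits := (nat -> option bool).
Notation fiber := (mconfig T * digits)%type.
Notation space e := (set_type (space_set m e : set (config M A))).
Notation system e := (system lineM T m e).
Notation pt := (pt lineM).
Implicit Types (i k : M) (c e : bool) (v : mconfig T) (s : digits).
Implicit Types u w : fiber.

Lemma dyadic_pair_nth (l : seq bool) :
  dyadic_pair (fun j => Some (nth true (rcons l false) j))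
              (fun j => Some (nth false (rcons l true) j)).
Proof.
exists (size l); split=> [j jl|||j jl]; rewrite !nth_rcons ?ltnn ?eqxx //.
  by rewrite !jl; split=> //; congr Some; exact: set_nth_default.
by rewrite ltnNge (ltnW jl) /= gtn_eqF.
Qed.

Section Separation.
Context (i : M) (U V : set (system false)) (oU : open U) (oV : open V).
Context (UV : forall x u, val x = fpoint i false u -> mono u.1 -> ~ infinite_reg u.1 ->
  binary u.2 -> (U (pt x) /\ ~ V (pt x)) \/ (V (pt x) /\ ~ U (pt x))).

Let inU u : Prop := forall x : space false, val x = fpoint i false u -> U (pt x).

Lemma inU_glued u u' : mono u.1 -> ~ infinite_reg u.1 -> binary u.2 ->
  glued u u' -> inU u -> inU u'.
Proof.
move=> mu fu bu g Uu x xE.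
have yE : val (in_set (fpoint_space lineM m false i false mu bu)) = fpoint i false u by [].
by rewrite -((pt_fpoint_eq lineM yE xE fu).2 (And3 erefl erefl g)); exact: Uu.
Qed.

Lemma inU_val u (x : space false) : val x = fpoint i false u -> inU u <-> U (pt x).
Proof.
move=> xE; split=> [|Ux y yE]; first exact.
by have -> : y = x by apply: val_inj; rewrite xE.
Qed.

(** Membership in [U] is locally constant on the arc, because its complement there is cut out by the
    open set [V], and it respects the dyadic identifications; so connectedness applies. *)
Lemma inU_arc v : mono v -> ~ infinite_reg v -> inU (v, @zeros) -> inU (v, @ones).
Proof.
move=> mv fv U0.
pose arc (s : nat -> bool) : fiber := (v, fun j => Some (s j)).
have barc (s : nat -> bool) : binary (arc s).2 by [].
pose x (s : nat -> bool) : space false :=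
  in_set (fpoint_space lineM m false i false (u := arc s) mv (barc s)).
have xE (s : nat -> bool) : val (x s) = fpoint i false (arc s) by [].
change (inU (arc (fun=> true))); change (inU (arc (fun=> false))) in U0.
refine (binary_arc_connected (u := fun r : nat -> bool => inU (arc r)) _ _ U0).
  move=> s; have near (U' : set (system false)) : open U' -> U' (pt (x s)) ->
      exists N, forall r : nat -> bool, (forall j, (j < N)%N -> r j = s j) -> U' (pt (x r)).
    move=> oU' Us; have [t tP] := (open_pt U').1 oU' (x s) Us.
    have [n nP] := agree_fpoint i false v (arc s).2 t.
    exists n => s' ss'; apply: tP; rewrite !xE; apply: nP => j jn.
    by rewrite /= ss'.
  case: (UV (xE s) mv fv (barc s)) => -[Us nVs].
    have [N NP] := near _ oU Us; exists N => s' /NP Us'.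
    by split=> _; [apply/(inU_val (xE s'))|apply/(inU_val (xE s))].
  have [N NP] := near _ oV Us; exists N => s' /NP Us'.
  split=> [/(inU_val (xE s)) //|/(inU_val (xE s'))].
  by case: (UV (xE s') mv fv (barc s')) => -[? ?].
move=> l.
have g : glued (arc (nth true (rcons l false))) (arc (nth false (rcons l true))).
  exists (arc (nth false (rcons l true))); split; last by left.
  by right; left; split=> //; exact: dyadic_pair_nth.
by split; apply: inU_glued => //; exact: glued_sym.
Qed.

Lemma inU_reaches v v' : mono v -> ~ infinite_reg v -> reaches (@mstep T) v v' ->
  inU (v, @zeros) -> inU (v', @zeros).
Proof.
move=> mv fv [n]; elim: n v mv fv => [|n IHn] v mv fv; first by case=> ->.
rewrite iterSr /=; case vw: (mstep v) => [w|]; last by rewrite iter_obind_None.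
move=> wv' U0; apply: (IHn w) wv' _.
- exact: mono_step mv vw.
- by move=> /(infinite_step mv vw).
apply: (@inU_glued (v, @ones)) => //; last exact: inU_arc.
by exists (w, @zeros); split; [right; right|left].
Qed.

End Separation.

Theorem system_not_homeomorphic :
  reaches (@mstep T) (minit T m.+1) (mfinal T) ->
  ~ homeomorphic (system false) (system true).
Proof.
move=> halting [f [g [fK gK cf cg]]].
have minit_mono : mono (minit T m.+1) by apply: (@decorated_mono T m false false); right.
have minit_fin : ~ infinite_reg (minit T m.+1).
  by apply: (@decorated_finite T m false false); right.
have mfinal_mono : mono (mfinal T) by apply: (@decorated_mono T m false false); left.
have mfinal_fin : ~ infinite_reg (mfinal T).
  by apply: (@decorated_finite T m false false); left.
(* A homeomorphism need not preserve the point at infinity. At most one point is sent to it, so of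
   two different marker positions at least one consists of finite points with images away from
   infinity. *)
pose avoids i := forall (x : space false) u (y : space true),
  val x = fpoint i false u -> ~ infinite_reg u.1 -> pt y = f (pt x) -> ~ infinite (val y).
have [i avi] : exists i, avoids i.
  apply: contrapT => H.
  have bad i : exists (x : space false) u (y : space true),
      [/\ val x = fpoint i false u, ~ infinite_reg u.1, pt y = f (pt x) & infinite (val y)].
    apply: contrapT => nb; apply: H; exists i => x u y xE fu yx iy; apply: nb.
    by exists x, u, y.
  have [x [u [y [xE fu yx iy]]]] := bad 0.
  have [x' [u' [y' [x'E fu' y'x' iy']]]] := bad 1.
  have yy' : pt y = pt y'.
    apply/pt_eq/(quotient_setP lineM); [exact: space_val_proper|exact: space_val_proper|].
    by left.
  have xx' : pt x = pt x' by apply: (can_inj fK); rewrite -yx -y'x'.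
  have [E _ _] := (pt_fpoint_eq lineM xE x'E fu).1 xx'.
  case: lineM => _ /(_ 0 0%N 1%N) inj _ _.
  by have := inj; rewrite mulr0n mulr1n !add0r -E => /(_ erefl).
have image v : decorated m false false v -> exists (x : space false) (y : space true) j c v',
    [/\ val x = fpoint i false (v, @zeros), f (pt x) = pt y,
        val y = fpoint j c (v', @zeros) & decorated m true c v'].
  move=> dec; have mv := decorated_mono dec; have fv := decorated_finite dec.
  pose x : space false :=
    in_set (fpoint_space lineM m false i false (u := (v, @zeros)) mv (fun=> isT)).
  have xE : val x = fpoint i false (v, @zeros) by [].
  have [y yx] := pt_surj (f (pt x)).
  have fy := avi x (v, @zeros) y xE fv yx.
  case: (space_val_proper lineM y) => [nm|[j [c [w [yE mw]]]]]; first by case: fy; left.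
  have fw : ~ infinite_reg w.1 by move=> /(infinite_fpoint lineM j c); rewrite -yE.
  have bw : binary w.2.
    apply: contrapT => nb; have iy := not_binary_isolated lineM yE fw nb.
    apply: (binary_not_isolated (lineM := lineM) xE fv) => //.
    rewrite -(fK (pt x)) -yx.
    exact: (isolated_homeo gK fK cf iy).
  have ny : near_isolated (pt y).
    rewrite yx; apply: (near_isolated_homeo fK gK cf cg).
    exact (decorated_near_isolated (lineM := lineM) xE dec).
  have [v' wv' dec'] := near_isolated_vertex yE fw bw ny.
  have mv' := decorated_mono dec'.
  pose y' : space true :=
    in_set (fpoint_space lineM m true j c (u := (v', @zeros)) mv' (fun=> isT)).
  have y'E : val y' = fpoint j c (v', @zeros) by [].
  exists x, y', j, c, v'; split; [exact: xE| |exact: y'E|exact: dec'].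
  by rewrite -yx; exact: ((pt_fpoint_eq lineM yE y'E fw).2 (And3 erefl erefl wv')).
have [|x [y [j [c [v [xE xy yE dec]]]]]] := image (minit T m.+1); first by right.
have [|x' [y' [j' [c' [v' [x'E x'y' y'E dec']]]]]] := image (mfinal T); first by left.
(* Away from infinity, the points with the marker position and copy of the image of the start, and
   the remaining ones, form two disjoint open sets. Pulled back along [f] they cannot separate start
   and end of the run. *)
pose G (b : bool) (k : M) (d : bool) (_ : fiber) := `[< k = j /\ d = c >] = b.
have gG b : gluable (G b) by [].
have oG b : open (finite_part (G b) : set (system true)).
  by apply: open_finite_part => // k d u Gu; exists 0%N.
have oF b : open (f @^-1` finite_part (G b)) by move/continuousP: cf; apply; exact: oG.
have sep z u : val z = fpoint i false u -> mono u.1 -> ~ infinite_reg u.1 -> binary u.2 ->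
    ((f @^-1` finite_part (G true)) (pt z) /\ ~ (f @^-1` finite_part (G false)) (pt z)) \/
    ((f @^-1` finite_part (G false)) (pt z) /\ ~ (f @^-1` finite_part (G true)) (pt z)).
  move=> zE mu fu bu; have [t tz] := pt_surj (f (pt z)).
  have ft := avi z u t zE fu tz; rewrite /preimage /= -tz.
  case: (space_val_proper lineM t) => [nm|[k [d [w [tE mw]]]]]; first by case: ft; left.
  have fw : ~ infinite_reg w.1 by move=> /(infinite_fpoint lineM k d); rewrite -tE.
  have GE b : finite_part (G b) (pt t) <-> `[< k = j /\ d = c >] = b.
    split=> [/(finite_partP lineM t (gG b))[k' [d' [w' [tE' _ Gw']]]]|Gb]; last first.
      by apply/(finite_partP lineM t (gG b)); exists k, d, w.
    by have [-> -> _] := fpoint_inj lineM (etrans (esym tE) tE').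
  rewrite !GE; case: asboolP => _; [left|right]; by split.
have start : forall z : space false, val z = fpoint i false (minit T m.+1, @zeros) ->
    (f @^-1` finite_part (G true)) (pt z).
  move=> z zE; have -> : z = x by apply: val_inj; rewrite zE xE.
  rewrite /preimage /= xy; apply/(finite_partP lineM y (gG true)).
  exists j, c, (v, @zeros); split=> //; first exact: decorated_finite dec.
  by apply/asboolP.
have := inU_reaches (oF true) (oF false) sep minit_mono minit_fin halting start x'E.
rewrite /preimage /= x'y'.
move=> /(finite_partP lineM y' (gG true))[j1 [c1 [u1 [y'E1 _ /asboolP[j1E c1E]]]]].
have [j'1 c'1 _] := fpoint_inj lineM (etrans (esym y'E) y'E1).
(* For [e = 1] each copy contains a single decorated configuration, [minit] in copy 0 and [mfinal]
   in copy 1, so equal copies force equal configurations. *)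
have vv' : v = v'.
  rewrite c'1 c1E in dec'.
  by move: dec dec' => [[-> ->]|[-> ->]] [[] //|[]].
have yy' : y = y' by apply: val_inj; rewrite yE y'E vv' j'1 j1E c'1 c1E.
have ff' : f (pt x) = f (pt x').
  exact: (etrans xy (etrans (f_equal (fun z : space true => pt z) yy') (esym x'y'))).
have xx' : pt x = pt x' := can_inj fK ff'.
have [_ _ /glued_zeros[[E _]|/= E]] := (pt_fpoint_eq lineM xE x'E minit_fin).1 xx'.
  by have := mstart_halt T; rewrite E eqxx.
by have := congr1 (fun s : digits => s 0%N) E.
Qed.

End NotHomeomorphic.

(** * Presentations *)

Section Presentations.
Local Open Scope classical_set_scope.
Context (M : pzSemiRingType) (lineM : discrete_line M).

Lemma conjugate_refl (X : msystem M) : conjugate X X.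
Proof. by exists id, id; split=> // x; exact: cvg_id. Qed.

Lemma conjugate_sym (X Y : msystem M) : conjugate X Y -> conjugate Y X.
Proof.
move=> [f [g [fK gK cf cg fact]]]; exists g, f; split=> // k y.
by apply: (can_inj fK); rewrite fact !gK.
Qed.

Lemma conjugate_trans (Y X Z : msystem M) :
  conjugate X Y -> conjugate Y Z -> conjugate X Z.
Proof.
move=> [f [g [fK gK cf cg fact]]] [f' [g' [fK' gK' cf' cg' fact']]].
exists (f' \o f), (g \o g'); split.
- by move=> x /=; rewrite fK'.
- by move=> z /=; rewrite gK.
- by move=> x; apply: continuous_comp; [exact: cf|exact: cf'].
- by move=> z; apply: continuous_comp; [exact: cg'|exact: cg].
- by move=> k x /=; rewrite fact fact'.
Qed.

Lemma conjugate_homeomorphic (X Y : msystem M) : conjugate X Y -> homeomorphic X Y.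
Proof. by move=> [f [g [fK gK cf cg _]]]; exists f, g. Qed.

(** A subshift is determined by its language, so the automata fix [Y] and [Z] and thereby the
    quotient. This makes the two classes of inputs disjoint. *)
Lemma presents_conjugate p (X X' : msystem M) :
  presents p X -> presents p X' -> conjugate X X'.
Proof.
move=> [Y [Z [Ys [Zs [YZ [LY LZ XW]]]]]] [Y' [Z' [Ys' [Zs' [YZ' [LY' LZ' XW']]]]]].
have YY' : Y = Y' by apply: (subshift_language_inj lineM Ys.1 Ys'.1); rewrite -LY.
have ZZ' : Z = Z' by apply: (subshift_language_inj lineM Zs.1 Zs'.1); rewrite -LZ.
subst Y' Z'.
rewrite (Prop_irrelevance Ys' Ys) (Prop_irrelevance Zs' Zs) (Prop_irrelevance YZ' YZ) in XW'.
exact: conjugate_trans XW (conjugate_sym XW').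
Qed.

Lemma inputs_disjoint : conjugate_inputs M `&` nonhomeomorphic_inputs M = set0.
Proof.
apply/seteqP; split=> // n [[p [q [X [Y [-> pX qY XY]]]]]].
move=> [p' [q' [X' [Y' [E pX' qY' nXY]]]]]; apply: nXY.
have [pp' qq'] := encode_pair_inj E; subst p' q'.
apply: conjugate_homeomorphic; apply: conjugate_trans (presents_conjugate pX' pX) _.
exact: conjugate_trans XY (presents_conjugate qY qY').
Qed.

End Presentations.

Lemma nfa_accept_cons (A : eqType) (N : nfa A) q a w :
  reflect (exists2 q', (q, a, q') \in transitions N & nfa_accept_from N q' w)
    (nfa_accept_from N q (a :: w)).
Proof.
apply: (iffP hasP) => [[[[q0 a0] q'] tin /= /andP[/eqP[<- <-] acc]]|[q' tin acc]].
  by exists q'.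
by exists (q, a, q') => //=; rewrite eqxx.
Qed.

(** * Automata for the shift spaces, uniformly in the input *)

Section SpaceAutomaton.
Local Open Scope classical_set_scope.
Local Open Scope ring_scope.
Context (M : pzSemiRingType) (lineM : discrete_line M) (T : machine).

Notation A := (alphabet T).

Definition rank (l : letter T) : 'I_#|letter T| := enum_rank l.

Section Extension.
Context (N : nfa 'I_#|letter T|) (B : nat).
Context (initB : all (gtn B) (initial_states N)) (finalB : all (gtn B) (final_states N)).
Context (transB : all (fun t => (t.1.1 < B)%N && (t.2 < B)%N) (transitions N)).

Definition base_transitions : seq (nat * 'I_#|letter T| * nat) :=
  [:: (B, rank None, B); (B.+2, rank (zero_letter T), B.+2);
      (B.+2, rank (star_letter T), B.+1); (B.+1, rank (star_letter T), B.+1)]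
  ++ transitions N.

Fixpoint chain_transitions (m : nat) : seq (nat * 'I_#|letter T| * nat) :=
  if m is m'.+1 then (B.+3 + m', rank (one_letter T), B.+2 + m')%N :: chain_transitions m'
  else base_transitions.

(** State [q] of [chain_edge] becomes [B + q], beyond all states of [N]. One initial state (chain
    state 0) and one final state (chain state 1) are added: only words running from before the
    marker to after a star can be new, all others are accepted by [N]. *)
Definition space_nfa (m : nat) : nfa 'I_#|letter T| :=
  Nfa (B :: initial_states N) (B.+1 :: final_states N)
    ((B, rank (start_letter T), B.+2 + m)%N :: chain_transitions m).

Lemma mem_old m q a q' : (q < B)%N ->
  ((q, a, q') \in transitions (space_nfa m)) = ((q, a, q') \in transitions N).
Proof.
move=> qB; have src (q0 : nat) a0 q1 : (B <= q0)%N -> ((q, a, q') == (q0, a0, q1)) = false.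
  by move=> Bq; apply/negP => /eqP[qq0 _ _]; move: qB; rewrite qq0 ltnNge Bq.
rewrite inE src //=; elim: m => [|m IHm] /=; last by rewrite inE src ?IHm //; lia.
by rewrite !inE !src //; lia.
Qed.

Lemma mem_chain m q a q' :
  ((B + q, a, q')%N \in transitions (space_nfa m)) <->
  exists q1, [/\ q' = (B + q1)%N, (q < m.+3)%N & chain_edge m q (enum_val a) q1].
Proof.
have src (q0 : nat) a0 q1 : ((B + q, a, q')%N == (q0, rank a0, q1)%N) =
    [&& (B + q == q0)%N, enum_val a == a0 & q' == q1].
  rewrite !xpair_eqE -andbA; congr (_ && (_ && _)).
  by apply/eqP/eqP => [->|<-]; rewrite /rank ?enum_rankK ?enum_valK.
have old : ((B + q, a, q')%N \in transitions N) = false.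
  by apply/negP => /(allP transB) /=; lia.
have chain n : ((B + q, a, q')%N \in chain_transitions n) =
    [|| [&& (2 < q < n.+3)%N, enum_val a == one_letter T & q' == (B + q.-1)%N],
     [&& q == 0%N, enum_val a == None & q' == B],
     [&& q == 2, enum_val a == zero_letter T & q' == B.+2],
     [&& q == 2, enum_val a == star_letter T & q' == B.+1] |
     [&& q == 1%N, enum_val a == star_letter T & q' == B.+1] ].
  elim: n => [|n IHn] /=.
    rewrite mem_cat old orbF !inE.
    rewrite !src.
    have -> : (B + q == B)%N = (q == 0%N) by lia.
    have -> : (B + q == B.+1)%N = (q == 1%N) by lia.
    have -> : (B + q == B.+2)%N = (q == 2) by lia.
    by have -> : (2 < q < 3)%N = false by lia.
  rewrite inE IHn src orbA; congr (_ || _).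
  have -> : (B + q == B.+3 + n)%N = (q == n.+3) by lia.
  have -> : (2 < q < n.+4)%N = (q == n.+3) || (2 < q < n.+3)%N by lia.
  rewrite andb_orl; congr (_ || _).
  by case: eqP => //= ->; congr (_ && (_ == _)); lia.
have E0 : (B + q == B)%N = (q == 0%N) by lia.
rewrite [transitions _]/= inE src E0 chain /chain_edge; split.
  move=> /orP[/and3P[/eqP-> /eqP-> /eqP->]|].
    by exists m.+2; split; [lia|lia|rewrite !eqxx !orbT].
  move=> /or4P[/and3P[qm /eqP-> /eqP->]|/and3P[/eqP-> /eqP-> /eqP->]|
    /and3P[/eqP-> /eqP-> /eqP->]|/orP[] /and3P[/eqP-> /eqP-> /eqP->]].
  - exists q.-1; split; [by []|lia|].
    have -> : (2 < q)%N by lia.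
    have -> : (q == q.-1.+1) by lia.
    by rewrite eqxx !orbT.
  - by exists 0%N; split; [lia| |rewrite !eqxx].
  - by exists 2; split; [lia| |rewrite !eqxx ?orbT].
  - by exists 1%N; split; [lia| |rewrite !eqxx ?orbT].
  - by exists 1%N; split; [lia| |rewrite !eqxx ?orbT].
move=> [q1 [-> qm ce]]; have {ce} := chain_edgeP ce.
case=> [[-> [[-> ->]|[-> ->]]]|[q2 -> qq1]|[-> [[-> ->]|[-> ->]]]|[-> -> ->]].
- by rewrite addn0 !eqxx !orbT.
- have -> : (B + m.+2 = B.+2 + m)%N by lia.
  by rewrite !eqxx.
- have -> : (B + q1 = B + q.-1)%N by lia.
  by rewrite q2 qm !eqxx ?orbT.
- by rewrite addn2 !eqxx !orbT.
- by rewrite addn1 !eqxx !orbT.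
- by rewrite addn1 !eqxx !orbT.
Qed.

Lemma mem_trans_lt q a q' m : (q < B)%N ->
  (q, a, q') \in transitions (space_nfa m) -> (q' < B)%N.
Proof. by move=> qB; rewrite mem_old // => /(allP transB)/andP[]. Qed.

Lemma accept_old m q w : (q < B)%N ->
  nfa_accept_from (space_nfa m) q w = nfa_accept_from N q w.
Proof.
elim: w q => [|a w IHw] q qB; first by rewrite /= inE; case: eqVneq => // qE; lia.
apply/nfa_accept_cons/nfa_accept_cons => -[q1 tin acc]; exists q1.
- by rewrite -(mem_old m).
- by rewrite -IHw //; exact: mem_trans_lt tin.
- by rewrite mem_old.
- by rewrite IHw //; apply: (@mem_trans_lt q a q1 m); rewrite ?mem_old.
Qed.

Let edge (m : nat) (q : 'I_m.+3) (a : 'I_#|letter T|) (q' : 'I_m.+3) : bool :=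
  chain_edge m q (enum_val a) q'.

Lemma chain_edge_lt m q (l : letter T) q' : (q < m.+3)%N -> chain_edge m q l q' -> (q' < m.+3)%N.
Proof.
move=> qm /chain_edgeP.
by case=> [[_ [[_ ->]|[_ ->]]]|[_ _ qE]|[_ [[_ ->]|[_ ->]]]|[_ _ ->]] //; lia.
Qed.

Lemma accept_chain m (q : 'I_m.+3) w :
  nfa_accept_from (space_nfa m) (B + q)%N w <->
  exists2 q' : 'I_m.+3, q' = 1%N :> nat & graph_run (@edge m) q w q'.
Proof.
elim: w q => [|a w IHw] q.
  rewrite /= inE; split.
    by move=> /orP[/eqP qB|/(allP finalB) /=]; [exists q => //; lia|lia].
  by move=> [q' q'1 ->]; rewrite q'1 addn1 eqxx.
split=> [/nfa_accept_cons[q2 tin]|[q' q'1 [q1 ce run]]].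
  have [q1 [q1E qm ce]] := (mem_chain m q a q2).1 tin.
  pose q2' := Ordinal (chain_edge_lt qm ce).
  rewrite q1E -[q1]/(nat_of_ord q2') => /IHw[q' q'1 run].
  by exists q' => //; exists q2'.
apply/nfa_accept_cons; exists (B + q1)%N; last by apply/IHw; exists q'.
by apply/mem_chain; exists q1.
Qed.

Lemma chain_set_label m : chain_set m = graph_set (@edge m) :> set (config M A).
Proof. by []. Qed.

Lemma live_chain m (q : 'I_m.+3) (l : letter T) : chain_edge m q l q ->
  @live M A 'I_m.+3 (@edge m) q.
Proof.
move=> ce; exists (fun=> q), (fun=> enum_rank l : A), 0; split=> // k.
by rewrite /edge enum_rankK.
Qed.

Lemma accept_space m w : nfa_language (space_nfa m) w <->
  nfa_language N w \/ exists2 q' : 'I_m.+3, q' = 1%N :> nat & graph_run (@edge m) ord0 w q'.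
Proof.
rewrite /nfa_language /=; split.
  move=> /orP[|/hasP[q qin acc]]; last first.
    left; apply/hasP; exists q => //; rewrite -(accept_old m) //; exact: (allP initB).
  by rewrite -{1}[B]addn0 => /(accept_chain (@ord0 m.+2)); right.
move=> [/hasP[q qin acc]|run]; apply/orP; [right|left].
  apply/hasP; exists q => //; rewrite accept_old //; exact: (allP initB).
by rewrite -{1}[B]addn0; apply/(accept_chain (@ord0 m.+2)).
Qed.

(** State 0 is never re-entered, so a word starting elsewhere has no marker and occurs in a
    marker-free sequence. State 1 is absorbing and is entered by every star, so a word ending
    elsewhere has no star; replacing the stars of [x] by zeros then yields a point of [base_set]
    with the same word. *)
Lemma chain_set_fixed m e (x : config M A) p i n :
  graph_path (@edge m) p x ->
  p i <> 0%N :> nat \/ p (i + n%:R) <> 1%N :> nat ->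
  language (fixed_set e : set (config M A)) (word_at x i n).
Proof.
move=> px; have pp k : chain_edge m (p k) (at_ x k) (p (k + 1)) by exact: px.
have word_eq (y : config M A) :
    (forall j : nat, (j < n)%N -> at_ y (i + j%:R) = at_ x (i + j%:R)) ->
    word_at y i (size (word_at x i n)) = word_at x i n.
  move=> yx; rewrite size_word_at; apply/eq_in_map => j; rewrite mem_iota add0n => /= jn.
  exact: enum_val_inj (yx j jn).
case=> [pi|pn].
  exists (fun k => if mark (at_ x k) == None then x k else enum_rank (None : letter T)), i.
  split.
    left => k; rewrite /at_; case: eqP => //; by rewrite enum_rankK.
  apply: word_eq => j jn; rewrite {1}/at_.
  suff -> : mark (at_ x (i + j%:R)) == None by [].
  have pj : p (i + j%:R) <> 0%N :> nat.
    elim: j {jn} => [|j IHj]; first by rewrite mulr0n addr0.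
    have := chain_edgeP (pp (i + j%:R)); rewrite -addrA natr1.
    case=> [[/IHj]|[q2 _ qE]|[_ [[_ ->]|[_ ->]]]|[_ _ ->]] //.
    by move=> q0; rewrite qE q0 in q2.
  by have := chain_edgeP (pp (i + j%:R)); case=> [[/pj]|[_ -> _]|[_ [[-> _]|[-> _]]]|[_ -> _]].
pose unstar (l : letter T) := if l == star_letter T then zero_letter T else l.
exists (fun k => enum_rank (unstar (at_ x k))), i; split; last first.
  apply: word_eq => j jn; rewrite {1}/at_ enum_rankK /unstar; case: eqP => // xs.
  case: pn; have p1 : p (i + j.+1%:R) = 1%N :> nat.
    have := chain_edgeP (pp (i + j%:R)); rewrite xs -addrA natr1.
    by case=> [[_ [[]|[]]]|[]|[_ [[]|[]]]|[]].
  rewrite -(subnKC jn); elim: (n - j.+1)%N => [|l IHl]; first by rewrite addn0.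
  have := chain_edgeP (pp (i + (j.+1 + l)%:R)); rewrite IHl -addrA natr1 addnS.
  by case=> [[]|[]|[]|[]].
right; left => k; rewrite /at_ !enum_rankK -!/(at_ _ _).
have zo : zero_letter T == star_letter T = false by apply/negP => /eqP.
have oo : one_letter T == star_letter T = false by apply/negP => /eqP.
have so : start_letter T == star_letter T = false by apply/negP => /eqP.
have := chain_edgeP (pp (k + 1)); have := chain_edgeP (pp k); rewrite /unstar.
case=> [[_ [[-> q'0]|[-> q'm]]]|[q2 -> qq']|[_ [[-> q'2]|[-> q'1]]]|[_ -> q'1]].
all: case=> [[q'E [[-> _]|[-> _]]]|[q'E -> _]|[q'E [[-> _]|[-> _]]]|[q'E -> _]].
all: try lia.
all: rewrite ?zo ?oo ?so ?eqxx /base_rel //=.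
all: by apply/forallP => r; rewrite !ffunE ?implybb ?implyFb.
Qed.

Lemma space_nfa_language m e : nfa_language N = language (fixed_set e : set (config M A)) ->
  nfa_language (space_nfa m) = language (space_set m e : set (config M A)).
Proof.
move=> LN; rewrite /space_set languageU; apply/seteqP; split=> w.
  move=> /accept_space[|[q' q'1 run]]; first by rewrite LN; left.
  right; rewrite chain_set_label.
  have l0 : @live M A 'I_m.+3 (@edge m) ord0 by apply: (@live_chain _ _ None).
  have l1 : @live M A 'I_m.+3 (@edge m) q'.
    by apply: (@live_chain _ _ (star_letter T)); rewrite q'1 /chain_edge !eqxx ?orbT.
  have [p [x [i [px wx _ _]]]] := live_glue lineM l0 l1 run.
  by exists x, i; split=> //; exists p.
move=> [Lw|[x [i [[p px] wx]]]]; apply/accept_space; first by left; rewrite LN.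
have [p0|p0] := eqVneq (p i : nat) 0%N; last first.
  by left; rewrite LN -wx; apply: (chain_set_fixed _ px); left; exact/eqP.
have [p1|p1] := eqVneq (p (i + (size w)%:R) : nat) 1%N; last first.
  by left; rewrite LN -wx; apply: (chain_set_fixed _ px); right; exact/eqP.
right; exists (p (i + (size w)%:R)) => //.
have -> : ord0 = p i by apply: val_inj.
by rewrite -wx size_word_at; exact: graph_path_run.
Qed.

End Extension.

End SpaceAutomaton.

(** * Computability of the encoded pair of presentations *)

Definition code_triple (a b c : nat) : nat := code_cons a (code_cons b (code_cons c 0)).

Lemma computable_triple p F G H : computable p F -> computable p G -> computable p H ->
  computable p (fun xs => code_triple (F xs) (G xs) (H xs)).
Proof.
move=> cF cG cH; apply: (computable2_comp computable_code_cons cF).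
apply: (computable2_comp computable_code_cons cG).
exact: (computable2_comp computable_code_cons cH (computable_const p 0)).
Qed.

(* The code of [space_nfa N B m], where [one] and [start] are the numbers of
   the letters and [i], [f] and [t] the codes of the old states and transitions. *)
Definition chain_code (B one t m : nat) : nat :=
  nat_rect (fun=> nat) t
    (fun j a => code_cons (code_triple (B.+3 + j) one (B.+2 + j)) a) m.

Definition nfa_code (B start one i f t m : nat) : nat :=
  code_triple (code_cons B i) (code_cons B.+1 f)
    (code_cons (code_triple B start (B.+2 + m)) (chain_code B one t m)).

Definition transitions_code (k : nat) (t : seq (nat * 'I_k * nat)) : nat :=
  CodeSeq.code [seq CodeSeq.code [:: t.1.1; nat_of_ord t.1.2; t.2] | t <- t].

Lemma encode_space_nfa (T : machine) (N : nfa 'I_#|letter T|) B m :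
  encode_nfa (fun a => nat_of_ord a) (space_nfa N B m) =
  nfa_code B (rank (start_letter T)) (rank (one_letter T))
    (CodeSeq.code (initial_states N)) (CodeSeq.code (final_states N))
    (transitions_code (base_transitions N B)) m.
Proof.
rewrite /encode_nfa /nfa_code /=; congr (code_triple _ _ (code_cons _ _)).
by elim: m => //= m ->.
Qed.

(* The input [m] is also the code of the list of all the other constants, so
   that a machine can compute the pair of presentations it is itself used in. *)
Definition pair_code (m : nat) : nat :=
  let c j := code_nth j m in
  let presentation i f t :=
    code_triple (c 0) (nfa_code (c 1) (c 2) (c 3) i f t m) (c 4) in
  code_cons (presentation (c 5) (c 6) (c 7))
    (code_cons (presentation (c 8) (c 9) (c 10)) 0).

Lemma computable_pair_code : computable1 pair_code.
Proof.
have cS p F : computable p F -> computable p (fun xs => (F xs).+1).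
  exact: computable1_comp computableS.
have cm p i : computable p (fun xs => nth 0 xs i) by exact: computable_nth.
have cn p i j : computable p (fun xs => code_nth j (nth 0 xs i)).
  by apply: computable1_comp (computable_code_nth j) _; exact: cm.
have cA p F G : computable p F -> computable p G -> computable p (fun xs => F xs + G xs).
  exact: computable2_comp computableD.
have cc p F G : computable p F -> computable p G ->
    computable p (fun xs => code_cons (F xs) (G xs)).
  exact: computable2_comp computable_code_cons.
have cchain j : computable1 (fun m =>
    chain_code (code_nth 1 m) (code_nth 3 m) (code_nth j m) m).
  have cG : computable 3 (fun xs => code_cons
      (code_triple ((code_nth 1 (nth 0 xs 2)).+3 + nth 0 xs 0) (code_nth 3 (nth 0 xs 2))
        ((code_nth 1 (nth 0 xs 2)).+2 + nth 0 xs 0)) (nth 0 xs 1)).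
    apply: cc (cm _ _); apply: computable_triple (cn _ _ _) _; apply: cA (cm _ _).
      exact: (cS _ _ (cS _ _ (cS _ _ (cn 3 2 1)))).
    exact: (cS _ _ (cS _ _ (cn 3 2 1))).
  exact: (computable_rec (cn 1 0 j) cG (cm 1 0)).
have cp i f t : computable1 (fun m => code_triple (code_nth 0 m)
    (nfa_code (code_nth 1 m) (code_nth 2 m) (code_nth 3 m)
      (code_nth i m) (code_nth f m) (code_nth t m) m) (code_nth 4 m)).
  apply: computable_triple (cn _ _ _) _ (cn _ _ _); apply: computable_triple.
  - exact: (cc _ _ _ (cn _ _ _) (cn _ _ _)).
  - exact: (cc _ _ _ (cS _ _ (cn _ _ _)) (cn _ _ _)).
  - apply: cc (cchain t); apply: computable_triple (cn _ _ _) (cn _ _ _) _.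
    exact: (cA _ _ _ (cS _ _ (cS _ _ (cn 1 0 1))) (cm 1 0)).
exact: (cc _ _ _ (cp _ _ _) (cc _ _ _ (cp _ _ _) (computable_const _ _))).
Qed.

(** Stated for all larger bounds, so that the automata for both values of [e] can share one [B], as
    in [pair_code]. *)
Lemma states_bounded (A : Type) (N : nfa A) : exists B, forall B', B <= B' ->
  [/\ all (gtn B') (initial_states N), all (gtn B') (final_states N) &
      all (fun t => (t.1.1 < B') && (t.2 < B')) (transitions N)].
Proof.
have bounded (s : seq nat) : exists B, forall B', B <= B' -> all (gtn B') s.
  elim: s => [|q s [B BP]]; first by exists 0.
  exists (B + q.+1) => B' BB' /=; rewrite BP ?andbT; lia.
have [B1 B1P] := bounded (initial_states N).
have [B2 B2P] := bounded (final_states N).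
have [B3 B3P] := bounded [seq t.1.1 | t <- transitions N].
have [B4 B4P] := bounded [seq t.2 | t <- transitions N].
exists (B1 + B2 + (B3 + B4)) => B' BB'; split; [apply: B1P; lia|apply: B2P; lia|].
rewrite all_predI; apply/andP; split.
  by have := B3P B'; rewrite all_map; apply; lia.
by have := B4P B'; rewrite all_map; apply; lia.
Qed.

(** * The diagonal argument *)

Section Reduction.
Local Open Scope classical_set_scope.
Context (M : pzSemiRingType) (lineM : discrete_line M) (T : machine).

Lemma system_presented m e (N : nfa 'I_#|letter T|)
    (NZ : nfa ('I_#|letter T| * 'I_#|letter T|)%type) B :
  nfa_language N = language (fixed_set e : set (config M (alphabet T))) ->
  nfa_language NZ = language (@quotient_set M T) ->
  [/\ all (gtn B) (initial_states N), all (gtn B) (final_states N) &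
      all (fun t => (t.1.1 < B) && (t.2 < B)) (transitions N)] ->
  presents (Presentation (space_nfa N B m) NZ) (system lineM T m e).
Proof.
move=> LN LNZ [iB fB tB].
exists (space_set m e), (@quotient_set M T), (space_sofic lineM T m e), (relation_sofic lineM T).
exists (space_equivalence lineM T m e); split=> //.
  exact: (space_nfa_language lineM iB fB tB m LN).
exact: conjugate_refl.
Qed.

Lemma pair_code_presents : exists m, exists p q : presentation,
  [/\ pair_code m = encode_pair p q, presents p (system lineM T m false) &
      presents q (system lineM T m true)].
Proof.
have [N0 LN0] := graph_sofic_nfa lineM (fixed_set_sofic lineM T false).
have [N1 LN1] := graph_sofic_nfa lineM (fixed_set_sofic lineM T true).
have [NZ LNZ] := graph_sofic_nfa lineM (quotient_set_sofic lineM T).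
have [B0 B0P] := states_bounded N0; have [B1 B1P] := states_bounded N1.
pose B := B0 + B1.
pose zcode := encode_nfa (fun ab : 'I_#|letter T| * 'I_#|letter T| =>
  CodeSeq.code [:: nat_of_ord ab.1; nat_of_ord ab.2]) NZ.
(* The order matches the indices in [pair_code]. None of these constants depends on [m], since
   [fixed_set] and [quotient_set] do not; so there is no circularity in taking their code as [m]. *)
pose s := [:: #|letter T|; B; rank (start_letter T) : nat; rank (one_letter T) : nat; zcode;
  CodeSeq.code (initial_states N0); CodeSeq.code (final_states N0);
  transitions_code (base_transitions N0 B);
  CodeSeq.code (initial_states N1); CodeSeq.code (final_states N1);
  transitions_code (base_transitions N1 B)].
exists (CodeSeq.code s).
exists (Presentation (space_nfa N0 B (CodeSeq.code s)) NZ).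
exists (Presentation (space_nfa N1 B (CodeSeq.code s)) NZ); split.
- rewrite /pair_code !code_nthK // /encode_pair /encode_presentation /=.
  by rewrite !encode_space_nfa.
- exact (@system_presented (CodeSeq.code s) false N0 NZ B LN0 LNZ (B0P B (leq_addr _ _))).
- exact (@system_presented (CodeSeq.code s) true N1 NZ B LN1 LNZ (B1P B (leq_addl _ _))).
Qed.

End Reduction.

Lemma inputs_inseparable (M : pzSemiRingType) : discrete_line M ->
  recursively_inseparable (conjugate_inputs M) (nonhomeomorphic_inputs M).
Proof.
move=> lineM; split; first exact: inputs_disjoint.
move=> [C [[f fC] conjC nonhomC]].
pose chi n : nat := `[< C n >]%classic.
have chiC : computable1 chi.
  exists f => -[|n []] //= _; rewrite /chi.
  by case: asboolP => Cn; have [] := fC n => H1 H0; [exact: H1|exact: H0].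
(* The predecessor undoes the shift in [minit T m.+1], where the marker letter holds one extra 1.
   The output is 0 exactly if [C] contains the pair, so the machine reaches [mfinal], making the
   systems non-homeomorphic, exactly when [C] claims that they may be conjugate. *)
have [F FP] : computable1 (fun n => 1 - chi (pair_code n.-1)).
  apply: computable1_comp computable_rsub1 _; apply: computable1_comp chiC _.
  apply: computable1_comp computable_pair_code _.
  by apply: computable1_comp computable_pred _; exact: computable_nth.
have [T TP] := machine_of_recfun F.
have [m [p [q [mE pX qY]]]] := pair_code_presents lineM T.
have [d [run dE]] := TP m.+1 _ (FP [:: m.+1] erefl).
have [Cm|nCm] := pselect (C (pair_code m)).
  have halting : reaches (@mstep T) (minit T m.+1) (mfinal T).
    by rewrite -(dE.2 _) //= /chi; case: asboolP.
  have : (C `&` nonhomeomorphic_inputs M)%classic (pair_code m).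
    split=> //; exists p, q, (system lineM T m false), (system lineM T m true); split=> //.
    exact: system_not_homeomorphic halting.
  by rewrite nonhomC.
have not_halting : ~ reaches (@mstep T) (minit T m.+1) (mfinal T).
  move=> halting; have : (mhalt T, d) = mfinal T.
    by apply: reaches_halted run halting _ _; rewrite /mstep /= mact_halt.
  by move/dE; rewrite /= /chi; case: asboolP.
apply: nCm; apply: conjC.
exists p, q, (system lineM T m false), (system lineM T m true); split=> //.
exact: system_conjugate not_halting.
Qed.

Theorem theorem1p9 :
  recursively_inseparable (conjugate_inputs nat) (nonhomeomorphic_inputs nat) /\
  recursively_inseparable (conjugate_inputs int) (nonhomeomorphic_inputs int).
Proof. by split; apply: inputs_inseparable; [exact: nat_line|exact: int_line]. Qed.
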